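(* Let $p\in[1,+\infty)$. If $f\in W^{1,p}(\mathbb{R}^n)$, then $$\lim_{\alpha\to1^-}\|\nabla^\alpha_w f-\nabla_w f\|_{L^p(\mathbb{R}^n;\,\mathbb{R}^n)}=0.$$
   Context: Here $n\in\mathbb{N}$, $n\ge 1$, and $\nabla_w f$ is the weak gradient of $f$. For $\alpha\in(0,1)$ let $\mu_{n,\alpha}:=2^\alpha\pi^{-n/2}\,\Gamma\big(\tfrac{n+\alpha+1}{2}\big)/\Gamma\big(\tfrac{1-\alpha}{2}\big)$, and for $\varphi\in C^\infty_c(\mathbb{R}^n;\mathbb{R}^n)$ let $$\mathrm{div}^\alpha\varphi(x):=\mu_{n,\alpha}\int_{\mathbb{R}^n}\frac{(y-x)\cdot(\varphi(y)-\varphi(x))}{|y-x|^{n+\alpha+1}}\,dy,\qquad x\in\mathbb{R}^n,$$ which belongs to $L^q(\mathbb{R}^n)$ for all $q\in[1,+\infty]$. For $f\in L^p(\mathbb{R}^n)$, the weak fractional $\alpha$-gradient $\nabla^\alpha_w f\in L^1_{\rm loc}(\mathbb{R}^n;\mathbb{R}^n)$ is the (unique, if it exists) function such that $\int_{\mathbb{R}^n} f\,\mathrm{div}^\alpha\varphi\,dx=-\int_{\mathbb{R}^n}\nabla^\alpha_w f\cdot\varphi\,dx$ for all $\varphi\in C^\infty_c(\mathbb{R}^n;\mathbb{R}^n)$. For $f\in W^{1,p}(\mathbb{R}^n)$ and every $\alpha\in(0,1)$, $\nabla^\alpha_w f$ exists and belongs to $L^p(\mathbb{R}^n;\mathbb{R}^n)$.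 *)

(* Defs.v *)
From HB Require Import structures.
From mathcomp Require Import all_boot all_order all_algebra.
From mathcomp Require Import all_classical all_reals all_analysis.

Set Implicit Arguments.
Unset Strict Implicit.
Unset Printing Implicit Defensive.
Import Order.TTheory GRing.Theory Num.Theory.
Import numFieldNormedType.Exports.

Local Open Scope classical_set_scope.
Local Open Scope ring_scope.

(* 'rV[R]_n carries the product sigma-algebra of the Borel sigma-algebras of
   the factors, i.e. the Borel sigma-algebra of R^n (the library equips
   n.-tuple T in the same way). *)
Definition rV_display : measure_display.
Proof. exact: default_measure_display. Qed.

Section rV_measurable.
Context {R : realType} (n : nat).

Let coord (i : 'I_n) (x : 'rV[R]_n) : R := x ord0 i.

Let rV_measurable0 : g_sigma_preimage coord set0.
Proof. exact: sigma_algebra0. Qed.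

Let rV_measurableC A : g_sigma_preimage coord A -> g_sigma_preimage coord (~` A).
Proof. exact: sigma_algebraC. Qed.

Let rV_measurable_bigcup (F : (set 'rV[R]_n)^nat) :
  (forall i, g_sigma_preimage coord (F i)) ->
  g_sigma_preimage coord (\bigcup_i F i).
Proof. exact: sigma_algebra_bigcup. Qed.

HB.instance Definition _ := @isMeasurable.Build rV_display
  'rV[R]_n (g_sigma_preimage coord)
  rV_measurable0 rV_measurableC rV_measurable_bigcup.

End rV_measurable.

Section rV_measurable_fun.
Context {R : realType}.

Lemma measurable_rV_coord n (i : 'I_n) :
  measurable_fun [set: 'rV[R]_n] (fun x : 'rV[R]_n => x ord0 i).
Proof.
move=> _ Y mY; rewrite setTI; apply: sub_sigma_algebra => /=.
rewrite -bigcup_seq/=; exists i => /=; first by rewrite mem_index_enum.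
by exists Y => //; rewrite setTI.
Qed.

Lemma measurable_fun_rV d (T : measurableType d) n (f : T -> 'rV[R]_n) :
  (forall i, measurable_fun [set: T] (fun x => f x ord0 i)) ->
  measurable_fun [set: T] f.
Proof.
move=> mf.
suff : g_sigma_preimage (fun i x => f x ord0 i) `<=` @measurable _ T.
  rewrite (g_sigma_preimage_comp (fun (i : 'I_n) (x : 'rV[R]_n) => x ord0 i)).
  by move=> prefS _ A mA; apply: prefS; exists A.
apply: smallest_sub; first exact: sigma_algebra_measurable.
case: n f mf => [|n] f mf; first by rewrite big_ord0.
rewrite -bigcup_mkord_ord; apply: bigcup_sub => i _.
by move=> A [B mB <-]; exact: mf.
Qed.

Definition rV_cons n (xt : R * 'rV[R]_n) : 'rV[R]_n.+1 :=
  row_mx (xt.1)%:M xt.2.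

Definition rV_uncons n (x : 'rV[R]_n.+1) : R * 'rV[R]_n :=
  (x ord0 ord0, \row_(i < n) x ord0 (lift ord0 i)).

Lemma rV_cons0 n (xt : R * 'rV[R]_n) : rV_cons xt ord0 ord0 = xt.1.
Proof.
rewrite /rV_cons (_ : ord0 = lshift n (ord0 : 'I_1)); last exact/val_inj.
by rewrite (@row_mxEl R 1 1 n) mxE mulr1n.
Qed.

Lemma rV_consS n (xt : R * 'rV[R]_n) (i : 'I_n) :
  rV_cons xt ord0 (lift ord0 i) = xt.2 ord0 i.
Proof.
rewrite /rV_cons (_ : lift ord0 i = rshift 1 i); last exact/val_inj.
by rewrite (@row_mxEr R 1 1 n).
Qed.

Lemma rV_consK n : cancel (@rV_cons n) (@rV_uncons n).
Proof.
move=> [x t]; rewrite /rV_uncons rV_cons0; congr pair.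
by apply/rowP => i; rewrite mxE rV_consS.
Qed.

Lemma measurable_rV_cons n : measurable_fun [set: R * 'rV[R]_n] (@rV_cons n).
Proof.
apply: measurable_fun_rV => i; have [j ->|->] := unliftP ord0 i.
  rewrite (_ : (fun _ => _) = (fun t : 'rV[R]_n => t ord0 j) \o snd).
    exact: measurableT_comp (measurable_rV_coord j) measurable_snd.
  by apply/funext => xt; rewrite rV_consS.
rewrite (_ : (fun _ => _) = fst); first exact: measurable_fst.
by apply/funext => xt; rewrite rV_cons0.
Qed.

Lemma measurable_rV_uncons n : measurable_fun [set: 'rV[R]_n.+1] (@rV_uncons n).
Proof.
apply: measurable_fun_pair; first exact: measurable_rV_coord.
apply: measurable_fun_rV => i.
rewrite (_ : (fun _ => _) = (fun x : 'rV[R]_n.+1 => x ord0 (lift ord0 i))).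
  exact: measurable_rV_coord.
by apply/funext => x; rewrite mxE.
Qed.

End rV_measurable_fun.

(* Lebesgue measure on R^n, by recursion on n: the Dirac mass on the point R^0
   and the product measure on R^(n+1) = R * R^n. *)
Section lebesgue_rV_succ.
Context {R : realType} (n : nat).
Variable mu : {sigma_finite_measure set 'rV[R]_n -> \bar R}.

Definition lebesgue_rV_succ : set 'rV[R]_n.+1 -> \bar R :=
  pushforward (lebesgue_measure \x mu)%E (@rV_cons R n).

Let measurable_preimage_cons (A : set 'rV[R]_n.+1) :
  measurable A -> measurable (@rV_cons R n @^-1` A).
Proof.
by move=> mA; rewrite -[X in measurable X]setTI; exact: measurable_rV_cons.
Qed.

Let lebesgue_rV_succ0 : lebesgue_rV_succ set0 = 0%E.
Proof. by rewrite /lebesgue_rV_succ /pushforward preimage_set0 measure0. Qed.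

Let lebesgue_rV_succ_ge0 A : (0 <= lebesgue_rV_succ A)%E.
Proof. by rewrite /lebesgue_rV_succ /pushforward; apply: measure_ge0. Qed.

Let lebesgue_rV_succ_sigma_additive : semi_sigma_additive lebesgue_rV_succ.
Proof.
move=> F mF tF mUF; rewrite /lebesgue_rV_succ /pushforward preimage_bigcup.
apply: measure_semi_sigma_additive.
- by move=> k; exact: measurable_preimage_cons.
- apply/trivIsetP => /= i j _ _ ij; rewrite -preimage_setI.
  by move/trivIsetP : tF => /(_ _ _ _ _ ij) ->//; rewrite preimage_set0.
- by rewrite -preimage_bigcup; exact: measurable_preimage_cons.
Qed.

HB.instance Definition _ := isMeasure.Build _ _ _ lebesgue_rV_succ
  lebesgue_rV_succ0 lebesgue_rV_succ_ge0 lebesgue_rV_succ_sigma_additive.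

Let lebesgue_rV_succ_sigma_finite : sigma_finite setT lebesgue_rV_succ.
Proof.
have /sigma_finiteP[F [TF ndF Foo]] := sigma_finiteT (@lebesgue_measure R).
have /sigma_finiteP[G [TG ndG Goo]] := sigma_finiteT mu.
exists (fun k => @rV_uncons R n @^-1` (F k `*` G k)).
  apply/esym; rewrite -subTset => x _ /=.
  have [i _ Fi] : (\bigcup_i F i) (x ord0 ord0) by rewrite -TF.
  have [j _ Gj] : (\bigcup_i G i) (@rV_uncons R n x).2 by rewrite -TG.
  exists (maxn i j) => //; split => /=.
    by move: Fi; exact/subsetPset/ndF/leq_maxl.
  by move: Gj; exact/subsetPset/ndG/leq_maxr.
move=> k; have [mFk Fkoo] := Foo k; have [mGk Gkoo] := Goo k; split.
  rewrite -[X in measurable X]setTI; apply: measurable_rV_uncons => //.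
  exact: measurableX.
rewrite /lebesgue_rV_succ /pushforward -comp_preimage.
rewrite (_ : _ \o _ = id); last by apply/funext => xt /=; rewrite rV_consK.
by rewrite preimage_id product_measure1E// lte_mul_pinfty// ge0_fin_numE.
Qed.

HB.instance Definition _ := Measure_isSigmaFinite.Build _ _ _ lebesgue_rV_succ
  lebesgue_rV_succ_sigma_finite.

End lebesgue_rV_succ.

Fixpoint lebesgue_rV (R : realType) (n : nat) :
    {sigma_finite_measure set 'rV[R]_n -> \bar R} :=
  match n with
  | 0 => @dirac _ 'rV[R]_0 0 R
  | m.+1 => lebesgue_rV_succ (lebesgue_rV R m)
  end.

Lemma lebesgue_rV_box (R : realType) (n : nat) (A : 'I_n -> set R) :
  (forall i, measurable (A i)) ->
  lebesgue_rV R n [set x | forall i, A i (x ord0 i)] =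
  (\prod_(i < n) lebesgue_measure (A i))%E.
Proof.
elim: n A => [|n IHn] A mA.
  by rewrite big_ord0 /= diracE mem_set//; case.
rewrite big_ord_recl -IHn// -product_measure1E//; last first.
  rewrite (_ : [set x | _] =
    \bigcap_(i in [set: 'I_n]) [set x | A (lift ord0 i) (x ord0 i)]).
    apply: fin_bigcap_measurable => // i _.
    rewrite -[X in measurable X]setTI.
    exact: (@measurable_rV_coord R n i measurableT _ (mA _)).
  by apply/seteqP; split => [x /= Ax i _|x /= Ax i]; exact: Ax.
  exact: mA.
rewrite /= /lebesgue_rV_succ /pushforward; congr product_measure1.
apply/seteqP; split => [[x t] /= Axt|[x t] /= [Ax At] i].
  split => [|i]; first by have := Axt ord0; rewrite rV_cons0.
  by have := Axt (lift ord0 i); rewrite rV_consS.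
by have [j ->|->] := unliftP ord0 i; rewrite ?rV_consS ?rV_cons0.
Qed.

Section euclidean.
Context {R : realType} (n : nat).
Implicit Types (u v : 'rV[R]_n).

Definition dotv u v : R := \sum_(i < n) u ord0 i * v ord0 i.

(* The library's norm on 'rV[R]_n is the maximum norm. *)
Definition enorm u : R := Num.sqrt (dotv u u).

End euclidean.

Section test_fields.
Context {R : realType} (n : nat).

Definition partial (i : 'I_n) (phi : 'rV[R]_n -> 'rV[R]_n) :
    'rV[R]_n -> 'rV[R]_n :=
  fun x => 'D_(delta_mx ord0 i) phi x.

(* s lists the successive directions of an iterated partial derivative *)
Definition iter_partial (s : seq 'I_n) (phi : 'rV[R]_n -> 'rV[R]_n) :=
  foldr partial phi s.

Definition smooth (phi : 'rV[R]_n -> 'rV[R]_n) : Prop :=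
  forall s : seq 'I_n, continuous (iter_partial s phi) /\
    forall (i : 'I_n) (x : 'rV[R]_n),
      derivable (iter_partial s phi) x (delta_mx ord0 i).

(* C^oo_c(R^n; R^n) *)
Definition test_field (phi : 'rV[R]_n -> 'rV[R]_n) : Prop :=
  smooth phi /\ compact (closure [set x | phi x != 0]).

Definition divergence (phi : 'rV[R]_n -> 'rV[R]_n) (x : 'rV[R]_n) : R :=
  \sum_(i < n) partial i phi x ord0 i.

End test_fields.

(* The integral converges exactly when 0 < z. *)
Definition Gamma {R : realType} (z : R) : R :=
  \int[lebesgue_measure]_(t in `]0, +oo[) (t `^ (z - 1) * expR (- t)).

Section gradients.
Context {R : realType} (n : nat).
Local Notation mu := (lebesgue_rV R n).

Definition mu_const (alpha : R) : R :=
  2 `^ alpha * pi `^ (- (n%:R / 2)) *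
  Gamma ((n%:R + alpha + 1) / 2) / Gamma ((1 - alpha) / 2).

Definition frac_div (alpha : R) (phi : 'rV[R]_n -> 'rV[R]_n) (x : 'rV[R]_n)
    : R :=
  mu_const alpha * \int[mu]_y
    (dotv (y - x) (phi y - phi x) / enorm (y - x) `^ (n%:R + alpha + 1)).

Definition loc_integrable (g : 'rV[R]_n -> 'rV[R]_n) : Prop :=
  measurable_fun setT g /\
  forall K : set 'rV[R]_n, compact K ->
    (\int[mu]_(x in K) (enorm (g x))%:E < +oo)%E.

Definition Lpnorm (p : R) (g : 'rV[R]_n -> 'rV[R]_n) : \bar R :=
  Lnorm mu p%:E (fun x => (enorm (g x))%:E).

Definition Lp_field (p : R) (g : 'rV[R]_n -> 'rV[R]_n) : Prop :=
  measurable_fun setT g /\ (Lpnorm p g < +oo)%E.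

Definition is_weak_grad (f : 'rV[R]_n -> R) (g : 'rV[R]_n -> 'rV[R]_n)
    : Prop :=
  loc_integrable g /\
  forall phi, test_field phi ->
    \int[mu]_x (f x * divergence phi x) = - \int[mu]_x dotv (g x) (phi x).

Definition is_weak_frac_grad (alpha : R) (f : 'rV[R]_n -> R)
    (g : 'rV[R]_n -> 'rV[R]_n) : Prop :=
  loc_integrable g /\
  forall phi, test_field phi ->
    \int[mu]_x (f x * frac_div alpha phi x) = - \int[mu]_x dotv (g x) (phi x).

(* The weak gradients are unique up to negligible sets; a representative is
   chosen when one exists, and the value is the zero field otherwise. *)
Definition weak_grad (f : 'rV[R]_n -> R) : 'rV[R]_n -> 'rV[R]_n :=
  xget (cst 0) [set g | is_weak_grad f g].

Definition weak_frac_grad (alpha : R) (f : 'rV[R]_n -> R) :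
    'rV[R]_n -> 'rV[R]_n :=
  xget (cst 0) [set g | is_weak_frac_grad alpha f g].

(* f \in W^{1,p}(R^n) *)
Definition W1p (p : R) (f : 'rV[R]_n -> R) : Prop :=
  f \in Lfun mu p%:E /\ exists2 g, is_weak_grad f g & Lp_field p g.

End gradients.

(* Main.v *)
(* The Gamma integral of Gaussians representing |h|^-(n+alpha+1) writes
   div^alpha phi as a superposition over times s > 0 of Gaussian averages of
   first differences of phi.  Splitting its weight by 1 = exp(-s) + (1 - exp(-s))
   and integrating the first half by parts gives
     div^alpha phi = k * div phi + sum_i k_i * phi_i,
   where k is the law of a diffusion at a Gamma(eps) distributed time,
   eps = (1 - alpha)/2, and k_i is integrable.  By duality
   grad^alpha f = k~ * grad f - (k_i~ * f)_i, where ~ reflects kernels.  As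
   alpha -> 1^-, |k_i|_1 = O(1/Gamma(eps)) tends to 0 and k concentrates at the
   origin, its mean time being O(1/Gamma(eps)), so that continuity of
   translations in L^p yields k~ * grad f -> grad f.  The fundamental lemma of
   the calculus of variations identifies the chosen weak gradients with these
   representatives almost everywhere. *)
Require Import Defs.
From HB Require Import structures.
From mathcomp Require Import all_boot all_order all_algebra.
From mathcomp Require Import all_classical all_reals all_analysis.
From mathcomp Require Import measurable_realfun ring lra zify.

Set Implicit Arguments.
Unset Strict Implicit.
Unset Printing Implicit Defensive.
Import Order.TTheory GRing.Theory Num.Theory.
Import numFieldNormedType.Exports.

Local Open Scope classical_set_scope.
Local Open Scope ring_scope.

(** * Lebesgue measure on R^n *)

(** The split cures an obstruction that has two sides. At time s the superposition carries the
    weight s^(eps - 3/2), too singular at 0; integrating by parts at all times improves it to s^(eps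
    - 1), which is not integrable at infinity. The factor exp(-s) keeps the derivative to short
    times, and 1 - exp(-s) = O(s) tames the remainder, on which no derivative is taken. With this
    cut-off the time weight of k is a Gamma density of mass Gamma(eps), the very Gamma factor in the
    denominator of mu_(n,alpha). Hence k has mass exactly 1, and the only asymptotic input on Gamma
    is a lower bound near 0. Both kernels stay on pairs (time, Gaussian variable), so the density of
    the displacement on R^n is never computed. Derivatives fall on test fields alone, so f is not
    approximated by smooth functions: continuity of translations is built up from indicators of
    half-spaces. The inequality t <= 1 + t^p stands in for Hölder's, which puts p = 1 and p > 1 on
    the same footing. *)

Lemma measurable_affine1 (R : realType) (b c : R) :
  measurable_fun setT (fun t : measurableTypeR R => (b + c * t : measurableTypeR R)).
Proof. by apply: measurable_funD => //; exact: measurable_funM. Qed.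

(** Uniqueness of Lebesgue measure leaves only half-open intervals to be checked; a negative [c]
    exchanges their ends, so that case meets intervals closed on the left. *)
Lemma lebesgue_measure_affine (R : realType) (b c : R) (A : set R) : c != 0 ->
  measurable A ->
  (`|c|%:E * pushforward lebesgue_measure
     (fun t : measurableTypeR R => (b + c * t : measurableTypeR R)%R) A =
   lebesgue_measure A)%E.
Proof.
move=> c0 mA.
have c0' : 0 <= `|c| by [].
pose nu := mscale (NngNum c0') (measure_function_pushforward__canonical__measure_function_Measure lebesgue_measure (measurable_affine1 b c)).
change (nu A = lebesgue_measure A).
apply/esym.
apply: lebesgue_measure_unique => //= _ [[x y]] _ <- /=.
rewrite /nu /mscale /= /pushforward.
have [cn|cp|/eqP] := ltgtP c 0; last by rewrite (negbTE c0).
- rewrite (_ : _ @^-1` _ = `[(y - b) / c, (x - b) / c[%classic); last first.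
    apply/seteqP; split => t /=; rewrite !in_itv/= ler_ndivrMr// ltr_ndivlMr//.
      by rewrite (mulrC t); move=> /andP[? ?]; apply/andP; split; lra.
    by rewrite (mulrC t); move=> /andP[? ?]; apply/andP; split; lra.
  rewrite !lebesgue_measure_itv/= !lte_fin ltr_nM2r ?invr_lt0// ltrD2r.
  case: ifPn => _; last by rewrite mule0.
  by rewrite ltr0_norm// !EFinN -?EFinD -?EFinM -?EFinD; congr EFin; field.
- rewrite (_ : _ @^-1` _ = `](x - b) / c, (y - b) / c]%classic); last first.
    apply/seteqP; split => t /=; rewrite !in_itv/= ler_pdivlMr// ltr_pdivrMr//.
      by rewrite (mulrC t); move=> /andP[? ?]; apply/andP; split; lra.
    by rewrite (mulrC t); move=> /andP[? ?]; apply/andP; split; lra.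
  rewrite !lebesgue_measure_itv/= !lte_fin ltr_pM2r ?invr_gt0// ltrD2r.
  case: ifPn => _; last by rewrite mule0.
  by rewrite gtr0_norm// -?EFinD -?EFinM -?EFinD; congr EFin; field.
Qed.

Lemma ge0_integral_affine1 (R : realType) (b c : R) (F : R -> \bar R) :
  c != 0 -> measurable_fun setT F -> (forall t, 0 <= F t)%E ->
  (\int[lebesgue_measure]_t F t =
   `|c|%:E * \int[lebesgue_measure]_t F (b + c * t)%R)%E.
Proof.
move=> c0 mF F0.
have c0' : 0 <= `|c| by [].
pose nu := (measure_function_pushforward__canonical__measure_function_Measure lebesgue_measure (measurable_affine1 b c)).
transitivity (\int[mscale (NngNum c0') nu]_t F t)%E.
  apply: eq_measure_integral => A mA _.
  exact/esym/lebesgue_measure_affine.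
rewrite ge0_integral_mscale//=; congr (_ * _)%E.
rewrite (@ge0_integral_pushforward _ _ (measurableTypeR R) (measurableTypeR R) R _ (measurable_affine1 b c) lebesgue_measure setT F)//.
Qed.

Section rV_integral.
Context {R : realType}.
Implicit Type n : nat.

Lemma ge0_integral_rVS n (F : 'rV[R]_n.+1 -> \bar R) :
  measurable_fun setT F -> (forall x, 0 <= F x)%E ->
  (\int[lebesgue_rV R n.+1]_x F x =
   \int[lebesgue_measure]_t \int[lebesgue_rV R n]_y F (rV_cons (t, y)))%E.
Proof.
move=> mF F0.
transitivity (\int[(lebesgue_measure \x lebesgue_rV R n)%E]_z (F \o @rV_cons R n) z)%E.
  exact: (@ge0_integral_pushforward _ _ (measurableTypeR R * 'rV[R]_n)%type
    'rV[R]_n.+1 R (@rV_cons R n) (@measurable_rV_cons R n) _ setT F).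
rewrite fubini_tonelli1//=.
by apply: measurableT_comp => //; exact: measurable_rV_cons.
Qed.

Lemma rV_cons_affine n (b : 'rV[R]_n.+1) c t (y : 'rV[R]_n) :
  b + c *: rV_cons (t, y) =
  rV_cons (b ord0 ord0 + c * t, (rV_uncons b).2 + c *: y).
Proof.
apply/rowP => i; have [j ->|->] := unliftP ord0 i.
  by rewrite 2!mxE !rV_consS/= !mxE.
by rewrite 2!mxE !rV_cons0.
Qed.

Lemma measurable_rV_affine n (b : 'rV[R]_n) c :
  measurable_fun setT (fun x : 'rV[R]_n => b + c *: x).
Proof.
apply: measurable_fun_rV => i.
under eq_fun do rewrite 2!mxE.
apply: measurable_funD => //; apply: measurable_funM => //.
exact: measurable_rV_coord.
Qed.

(** The measure is built one coordinate at a time: induction peels one off, and each contributes a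
    factor [|c|] through [ge0_integral_affine1]. *)
Lemma ge0_integral_affine n (b : 'rV[R]_n) c (F : 'rV[R]_n -> \bar R) :
  c != 0 -> measurable_fun setT F -> (forall x, 0 <= F x)%E ->
  (\int[lebesgue_rV R n]_x F x =
   (`|c| ^+ n)%:E * \int[lebesgue_rV R n]_x F (b + c *: x)%R)%E.
Proof.
move=> c0; elim: n b F => [b F mF F0|n IH b F mF F0].
  rewrite expr0 mul1e; apply: eq_integral => x _; congr F.
  by apply/rowP => -[].
rewrite ge0_integral_rVS// [in RHS]ge0_integral_rVS//; last first.
  by apply: measurableT_comp => //; exact: measurable_rV_affine.
pose H := fun t => (\int[lebesgue_rV R n]_y F (rV_cons (t, y)))%E.
have mH : measurable_fun setT H.
  apply: (@measurable_fun_fubini_tonelli_F _ _ _ _ R (lebesgue_rV R n)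
    (fun z => F (rV_cons z))) => //.
  by apply: measurableT_comp => //; exact: measurable_rV_cons.
have H0 t : (0 <= H t)%E by exact: integral_ge0.
have -> := ge0_integral_affine1 (b ord0 ord0) c0 mH H0.
rewrite exprS EFinM -muleA; congr (_ * _)%E.
rewrite -ge0_integralZl//; last 2 first.
- apply: (@measurable_fun_fubini_tonelli_F _ _ _ _ R (lebesgue_rV R n)
    (fun z => F (b + c *: rV_cons z))) => //.
  exact: (measurableT_comp mF (measurableT_comp (measurable_rV_affine b c)
    (@measurable_rV_cons R n))).
- by move=> t _; exact: integral_ge0.
apply: eq_integral => t _; rewrite /H (IH (rV_uncons b).2).
- by congr (_ * _)%E; apply: eq_integral => y _; rewrite rV_cons_affine.
- apply: measurableT_comp => //; apply: measurableT_comp => //.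
  exact: measurable_rV_cons.
- by move=> y.
Qed.

Lemma ge0_integral_shift n (b : 'rV[R]_n) (F : 'rV[R]_n -> \bar R) :
  measurable_fun setT F -> (forall x, 0 <= F x)%E ->
  (\int[lebesgue_rV R n]_x F (x + b)%R = \int[lebesgue_rV R n]_x F x)%E.
Proof.
move=> mF F0; rewrite [RHS](@ge0_integral_affine _ b 1)// normr1 expr1n mul1e.
by apply: eq_integral => x _; rewrite scale1r addrC.
Qed.

Lemma measurable_rV_shift n (b : 'rV[R]_n) :
  measurable_fun setT (fun x : 'rV[R]_n => x + b).
Proof.
apply: measurable_fun_rV => i; under eq_fun do rewrite mxE.
by apply: measurable_funD => //; exact: measurable_rV_coord.
Qed.

(** Measurability suffices: positive and negative parts are shifted separately, and the same
    difference of extended reals stands on both sides. *)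
Lemma integral_shift n (b : 'rV[R]_n) (F : 'rV[R]_n -> \bar R) :
  measurable_fun setT F ->
  (\int[lebesgue_rV R n]_x F (x + b)%R = \int[lebesgue_rV R n]_x F x)%E.
Proof.
move=> mF; rewrite integralE [RHS]integralE; congr (_ - _)%E.
- rewrite -(ge0_integral_shift b (measurable_funepos mF))//.
  by apply: eq_integral => x _; rewrite !funeposE.
- rewrite -(ge0_integral_shift b (measurable_funeneg mF))//.
  by apply: eq_integral => x _; rewrite !funenegE.
Qed.

Lemma ge0_integral_rVN n (F : 'rV[R]_n -> \bar R) :
  measurable_fun setT F -> (forall x, 0 <= F x)%E ->
  (\int[lebesgue_rV R n]_x F (- x)%R = \int[lebesgue_rV R n]_x F x)%E.
Proof.
move=> mF F0; rewrite [RHS](@ge0_integral_affine _ 0 (-1))// ?oppr_eq0//.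
rewrite normrN normr1 expr1n mul1e.
by apply: eq_integral => x _; rewrite scaleN1r add0r.
Qed.

Lemma measurable_rV_opp n : measurable_fun setT (fun x : 'rV[R]_n => - x).
Proof.
apply: measurable_fun_rV => i; under eq_fun do rewrite mxE.
by apply: measurableT_comp => //; exact: measurable_rV_coord.
Qed.

Lemma integral_rVN n (F : 'rV[R]_n -> \bar R) :
  measurable_fun setT F ->
  (\int[lebesgue_rV R n]_x F (- x)%R = \int[lebesgue_rV R n]_x F x)%E.
Proof.
move=> mF; rewrite integralE [RHS]integralE; congr (_ - _)%E.
- rewrite -(ge0_integral_rVN (measurable_funepos mF))//.
  by apply: eq_integral => x _; rewrite !funeposE.
- rewrite -(ge0_integral_rVN (measurable_funeneg mF))//.
  by apply: eq_integral => x _; rewrite !funenegE.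
Qed.

End rV_integral.

(** * Open sets, cubes and compact sets of R^n *)

Section rV_borel.
Context {R : realType} (n : nat).

Lemma open_measurable_rV (U : set 'rV[R]_n) : open U -> measurable U.
Proof.
move=> oU.
(* Cubes with rational centre and half-side: a countable base whose members are finite intersections
   of coordinate preimages. *)
pose box (z : 'rV[rat]_n * rat) : set 'rV[R]_n :=
  [set x | forall i, `|x ord0 i - ratr (z.1 ord0 i : rat)| < ratr z.2 :> R].
have mbox z : measurable (box z).
  rewrite (_ : box z = \bigcap_(i in [set: 'I_n])
      [set x | `|x ord0 i - ratr (z.1 ord0 i)| < ratr z.2 :> R]); last first.
    by apply/seteqP; split => [x Mx i _|x Mx i]; [exact: Mx|exact: (Mx i)].
  apply: fin_bigcap_measurable => // i _.
  rewrite [X in measurable X](_ : _ = (fun x : 'rV[R]_n => x ord0 i) @^-1`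
      (ball (ratr (z.1 ord0 i) : R) (ratr z.2))); last first.
    by apply/seteqP; split => x /=; rewrite /ball/= distrC.
  rewrite -[X in measurable X]setTI.
  by apply: (measurable_rV_coord i measurableT); exact: measurable_ball.
rewrite (_ : U = \bigcup_z (if `[< box z `<=` U >] then box z else set0)).
  apply: countable_bigcupT_measurable => [|z]; first exact: countableP.
  by case: ifPn.
apply/seteqP; split => [x Ux|x [z _]]; last by case: ifPn => // /asboolP; exact.
have /nbhs_ballP[e /= e0 eU] : nbhs x U by apply: open_nbhs_nbhs.
(* A radius below [e / 2] and a centre within that radius of [x] keep the whole cube inside the ball
   of radius [e]. *)
have [r] := @rat_in_itvoo R 0 (e / 2) ltac:(by rewrite divr_gt0).
rewrite in_itv/= => /andP[r0 re].
have hq i : exists q : rat, `|x ord0 i - ratr q| < ratr r.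
  have [q] := @rat_in_itvoo R (x ord0 i - ratr r) (x ord0 i + ratr r) ltac:(lra).
  by rewrite in_itv/= => /andP[? ?]; exists q; rewrite ltr_norml; lra.
have [q Hq] := choice hq.
exists (\row_i q i, r) => //; rewrite asboolT/=.
  by move=> i; rewrite mxE.
move=> y /= Hy; apply: eU; split => // i j; rewrite /ball/= (ord1 i).
have := Hy j; rewrite mxE => Hyj; have := Hq j => Hqj.
rewrite (_ : _ - _ = (x ord0 j - ratr (q j)) - (y ord0 j - ratr (q j))); last lra.
by rewrite (le_lt_trans (ler_normB _ _))//; lra.
Qed.

Lemma closed_measurable_rV (A : set 'rV[R]_n) : closed A -> measurable A.
Proof.
by move=> cA; rewrite -(setCK A); apply: measurableC; apply: open_measurable_rV; exact: closed_openC.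
Qed.

Lemma continuous_measurable_rV (F : 'rV[R]_n -> R) :
  continuous F -> measurable_fun setT F.
Proof.
move=> cF; apply: (measurability _ (RGenOInfty.measurableE R)).
move=> _ [_ [a ->] <-]; rewrite setTI; apply: open_measurable_rV.
by move/continuousP : cF; apply; exact: interval_open.
Qed.

(** For [0 <= M] the closed ball of the maximum norm, written by coordinates so that the product
    formula [lebesgue_rV_box] and the compactness lemma [rV_compact] both apply. *)
Definition cube (M : R) : set 'rV[R]_n := [set x | forall i, `|x ord0 i| <= M].

Lemma measurable_cube M : measurable (cube M).
Proof.
rewrite (_ : cube M = \bigcap_(i in [set: 'I_n])
    [set x | `|x ord0 i| <= M]); last first.
  by apply/seteqP; split => [x Mx i _|x Mx i]; [exact: Mx|exact: (Mx i)].
apply: fin_bigcap_measurable => // i _.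
rewrite [X in measurable X](_ : _ = (fun x : 'rV[R]_n => x ord0 i) @^-1` `[- M, M]); last first.
  by apply/seteqP; split => x /=; rewrite in_itv/= ler_norml.
rewrite -[X in measurable X]setTI.
by apply: (measurable_rV_coord i measurableT); exact: measurable_itv.
Qed.

Lemma cube_lty M : (lebesgue_rV R n (cube M) < +oo)%E.
Proof.
rewrite (_ : cube M = [set x | forall i, `[- M, M]%classic (x ord0 i)]).
  rewrite (@lebesgue_rV_box R n (fun=> `[(- M)%R, M]%classic))//.
  rewrite lebesgue_measure_itv/= lte_fin.
  by case: ifPn => _; rewrite -?EFinB prodEFin ltry.
by apply/seteqP; split => x /= h i; have := h i; rewrite /= in_itv/= ler_norml.
Qed.

Lemma cubeD M d x h : cube M x -> cube d h -> cube (M + d) (x + h).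
Proof.
by move=> Mx dh i; rewrite mxE (le_trans (ler_normD _ _))// lerD.
Qed.

Lemma cubeN M x : cube M x -> cube M (- x).
Proof. by move=> Mx i; rewrite mxE normrN. Qed.

Lemma cube_le M N : M <= N -> cube M `<=` cube N.
Proof. by move=> MN x Mx i; rewrite (le_trans (Mx i)). Qed.

Lemma bigcup_cube : \bigcup_k cube k%:R = setT.
Proof.
apply/seteqP; split => // x _.
exists (\max_(i < n) (Num.bound `|x ord0 i|).+1)%N => // i.
rewrite (@le_trans _ _ ((Num.bound `|x ord0 i|).+1%:R))//; last first.
  by rewrite ler_nat; exact: (leq_bigmax i).
by apply/ltW; rewrite (lt_le_trans (archi_boundP _))// ler_nat.
Qed.

Lemma closed_cube M : closed (cube M).
Proof.
rewrite (_ : cube M = \bigcap_(i in [set: 'I_n])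
    (fun x : 'rV[R]_n => x ord0 i) @^-1` `[- M, M]); last first.
  apply/seteqP; split => [x Mx i _|x Mx i].
    by rewrite /= in_itv/= -ler_norml; exact: Mx.
  by have := Mx i I; rewrite /= in_itv/= -ler_norml.
apply: closed_bigI => i _; apply: preimage_closed; last exact: interval_closed.
by move=> x _; exact: coord_continuous.
Qed.

Lemma compact_cube M : compact (cube M).
Proof.
rewrite (_ : cube M = [set x | forall i, `[- M, M]%classic (x ord0 i)]).
  apply: (@rV_compact _ n (fun=> `[(- M)%R, M]%classic)) => i.
  exact: segment_compact.
by apply/seteqP; split => x /= h i; have := h i; rewrite /= in_itv/= ler_norml.
Qed.

Lemma coord_le_norm (x : 'rV[R]_n) i : `|x ord0 i| <= `|x|.
Proof.
rewrite [leRHS]/Num.norm /= mx_normrE.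
by apply/bigmax_geP; right => /=; exists (ord0, i).
Qed.

Lemma compact_sub_cube (K : set 'rV[R]_n) : compact K ->
  exists2 M, 0 < M & K `<=` cube M.
Proof.
move=> /compact_bounded[M [_ KM]]; exists (`|M| + 1); first by rewrite ltr_pwDr.
move=> x Kx i; rewrite (le_trans (coord_le_norm _ _))//.
by apply: KM => //; rewrite ltr_pwDr// ler_norm.
Qed.

Lemma compact_measurable_rV (K : set 'rV[R]_n) : compact K -> measurable K.
Proof.
by move=> cK; apply: closed_measurable_rV; exact: compact_closed.
Qed.

Lemma compact_lty (K : set 'rV[R]_n) : compact K ->
  (lebesgue_rV R n K < +oo)%E.
Proof.
move=> cK; have [M _ KM] := compact_sub_cube cK.
apply: le_lt_trans (cube_lty M); apply: le_measure; rewrite ?inE//.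
- exact: compact_measurable_rV.
- exact: measurable_cube.
Qed.

End rV_borel.

(** * Averages over translations *)

Section powR_ineq.
Context {R : realType}.
Implicit Types (p c t : R).

(* The tangent line at c, obtained from Young's inequality for t and c^(p-1). *)
Lemma powR_tangent p c t : 1 <= p -> 0 <= c -> 0 <= t ->
  c `^ p + p * c `^ (p - 1) * (t - c) <= t `^ p.
Proof.
move=> p1 c0 t0; have p0 : 0 < p by lra.
have [->|pn1] := eqVneq p 1; first by rewrite subrr powRr0 !powRr1//; lra.
have p1' : 0 < p - 1 by rewrite subr_gt0 lt_neqAle eq_sym pn1.
have := @conjugate_powR R t (c `^ (p - 1)) p (p / (p - 1)) t0 (powR_ge0 _ _) p0.
rewrite divr_gt0// => /(_ isT).
have -> : p^-1 + (p / (p - 1))^-1 = 1 by field; rewrite ?gt_eqF.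
move=> /(_ erefl); rewrite -powRrM.
have -> : (p - 1) * (p / (p - 1)) = p by field; rewrite ?gt_eqF.
have -> : t `^ p / p + c `^ p / (p / (p - 1)) = (t `^ p + (p - 1) * c `^ p) / p.
  by field; rewrite ?gt_eqF.
rewrite ler_pdivlMr// => h.
have := mulr_powRB1 c0 p0; set x := _ `^ (p - 1) in h * => cx; nra.
Qed.

(** Substitute for Hölder's inequality wherever only finiteness matters: a first power is absorbed
    by a constant and a [p]-th power. *)
Lemma le1D_powR p t : 1 <= p -> 0 <= t -> t <= 1 + t `^ p.
Proof.
move=> p1 t0; have [t1|t1] := leP t 1.
  by rewrite (le_trans t1)// lerDl powR_ge0.
by rewrite (le_trans (le1r_powR (ltW t1) p1))// lerDr.
Qed.

Lemma powRD_le p (a b : R) : 0 <= p -> 0 <= a -> 0 <= b ->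
  (a + b) `^ p <= 2 `^ p * (a `^ p + b `^ p).
Proof.
move=> p0 a0 b0.
apply: (@le_trans _ _ ((2 * Num.max a b) `^ p)).
  apply: ge0_ler_powR; rewrite ?nnegrE ?addr_ge0 ?mulr_ge0 ?le_max ?a0//.
  by have [] := leP a b => ?; lra.
rewrite powRM ?le_max ?a0// ler_wpM2l ?powR_ge0//.
by have [] := leP a b => ?; rewrite ?lerDl ?lerDr powR_ge0.
Qed.

Lemma sum_powR_le n p : 0 < p -> exists2 C : R, 0 <= C &
  forall a : 'I_n -> R, (forall i, 0 <= a i) ->
  (\sum_i a i) `^ p <= C * \sum_i a i `^ p.
Proof.
move=> p0; elim: n => [|n [C C0 IH]].
  by exists 0 => // a _; rewrite !big_ord0 mul0r powR0// gt_eqF.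
exists (2 `^ p * (1 + C)); first by rewrite mulr_ge0 ?powR_ge0 ?addr_ge0.
move=> a a0; rewrite !big_ord_recl.
apply: (le_trans (powRD_le (ltW p0) (a0 _) (sumr_ge0 _ (fun i _ => a0 _)))).
rewrite -mulrA ler_wpM2l ?powR_ge0//.
have := IH (fun i => a (lift ord0 i)) (fun i => a0 _).
set S := \sum_(i < n) _ `^ p => h.
have S0 : 0 <= S by apply: sumr_ge0 => i _; exact: powR_ge0.
have := powR_ge0 (a ord0) p; nra.
Qed.

End powR_ineq.

Lemma eqW d (T : porderType d) (x y : T) : x = y -> (x <= y)%O.
Proof. by move=> ->. Qed.

(** * Real-valued integrals and Jensen's inequality *)

Section general_integral.
Context d (T : measurableType d) (R : realType) (m : {measure set T -> \bar R}).
Implicit Types (f g : T -> R).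

Lemma measurable_fun_powR f p : measurable_fun setT f ->
  measurable_fun setT (fun x => f x `^ p).
Proof. by move=> mf; exact: (measurableT_comp (measurable_powR p) mf). Qed.

Lemma measurable_norm_powR f p : measurable_fun setT f ->
  measurable_fun setT (fun x => (`|f x| `^ p)%:E).
Proof.
move=> mf; apply/measurable_EFinP; apply: measurable_fun_powR.
exact: measurableT_comp.
Qed.

(** The real integral is [fine] of the extended one. A finite extended integral forces
    integrability, and [fine] sends both infinities to 0. *)
Lemma Rintegral_nint f : measurable_fun setT f ->
  ~ m.-integrable setT (EFin \o f) -> \int[m]_x f x = 0.
Proof.
move=> mf nf; rewrite /Rintegral.
have mEf : measurable_fun setT (EFin \o f) by exact/measurable_EFinP.
have := (abse_integralP m measurableT mEf).1.
case: (\int[m]_x (f x)%:E)%E => [r|//|//] h.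
exfalso; apply: nf; apply/integrableP; split => //.
by apply: h; rewrite /= ltry.
Qed.

(** The default value 0 makes homogeneity unconditional: for nonzero [c], [f] and [c * f] are
    integrable together. Constants can thus be moved at every point, including those where a section
    fails to be integrable. *)
Lemma RintegralZl_total f (c : R) : measurable_fun setT f ->
  \int[m]_x (c * f x) = c * \int[m]_x f x.
Proof.
move=> mf; have [intf|nf] := pselect (m.-integrable setT (EFin \o f)).
  exact: RintegralZl.
rewrite (Rintegral_nint mf nf) mulr0.
have [->|c0] := eqVneq c 0.
  by under eq_Rintegral do rewrite mul0r; rewrite Rintegral_cst// mul0r.
apply: Rintegral_nint; first exact: measurable_funM.
move=> intcf; apply: nf.
have := @integrableZl _ _ _ m _ measurableT c^-1 _ intcf.
by apply: eq_integrable => // x _ /=; rewrite -EFinM mulKf.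
Qed.

Lemma le_integrableR f g : measurable_fun setT f ->
  (forall x, `|f x| <= g x) -> m.-integrable setT (EFin \o g) ->
  m.-integrable setT (EFin \o f).
Proof.
move=> mf fg; apply: le_integrable => //; first exact/measurable_EFinP.
by move=> x _; rewrite lee_fin (le_trans (fg x))// ler_norm.
Qed.

Lemma ge0_integrableR f : measurable_fun setT f -> (forall x, 0 <= f x) ->
  (\int[m]_x (f x)%:E < +oo)%E -> m.-integrable setT (EFin \o f).
Proof.
move=> mf f0 foo; apply/integrableP; split; first exact/measurable_EFinP.
by under eq_integral do rewrite /= ger0_norm//.
Qed.

Lemma EFin_Rintegral f : m.-integrable setT (EFin \o f) ->
  ((\int[m]_x f x)%:E = \int[m]_x (f x)%:E)%E.
Proof. by move=> intf; rewrite /Rintegral fineK//; exact: integrable_fin_num. Qed.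

(** Integrate the tangent inequality [powR_tangent] against [|k|]. Working with a bound [K] on the
    mass, rather than a normalised measure, covers signed kernels and gives Young's inequality with
    the constant [K ^ p]. *)
Lemma jensen_powR (k g : T -> R) (K p : R) : measurable_fun setT k ->
  measurable_fun setT g -> 0 < K -> 1 <= p ->
  (\int[m]_z `|k z|%:E <= K%:E)%E ->
  ((`|\int[m]_z (k z * g z)| `^ p)%:E <=
   (K `^ (p - 1))%:E * \int[m]_z (`|k z| * `|g z| `^ p)%:E)%E.
Proof.
move=> mk mg K0 p1 kK; have p0 : 0 < p by lra.
have mkk : measurable_fun setT (fun z => `|k z|) by exact: measurableT_comp.
have mgp : measurable_fun setT (fun z => `|g z| `^ p).
  by apply: measurable_fun_powR; exact: measurableT_comp.
have mI : measurable_fun setT (fun z => `|k z| * `|g z| `^ p).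
  exact: measurable_funM.
have I0 z : 0 <= `|k z| * `|g z| `^ p by rewrite mulr_ge0 ?powR_ge0.
have [Ioo|] := ltP (\int[m]_z (`|k z| * `|g z| `^ p)%:E)%E +oo%E; last first.
  by rewrite leye_eq => /eqP ->; rewrite gt0_muley ?leey// lte_fin powR_gt0.
have intI := ge0_integrableR mI I0 Ioo.
have intk : m.-integrable setT (EFin \o (fun z => `|k z|)).
  by apply: ge0_integrableR => //; exact: le_lt_trans kK (ltry _).
have mkg : measurable_fun setT (fun z => `|k z| * `|g z|).
  by apply: measurable_funM => //; exact: measurableT_comp.
have intkg : m.-integrable setT (EFin \o (fun z => `|k z| * `|g z|)).
  apply: (@le_integrableR _ (fun z => `|k z| + `|k z| * `|g z| `^ p)) => //.
    move=> z; rewrite ger0_norm ?mulr_ge0//.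
    have := ler_wpM2l (normr_ge0 (k z)) (le1D_powR p1 (normr_ge0 (g z))).
    by rewrite mulrDr mulr1.
  by have := integrableD measurableT intk intI; apply: eq_integrable.
pose A := \int[m]_z (`|k z| * `|g z|).
have A0 : 0 <= A by apply: Rintegral_ge0 => z _; rewrite mulr_ge0.
(* For mass exactly [K] this is the mean of [|g|]. For a smaller mass [L] the error is
   [(1 - p) * c ^ p * (L - K)], of the right sign because [1 <= p]. *)
pose c := A / K; have c0 : 0 <= c by rewrite divr_ge0// ltW.
pose L := \int[m]_z `|k z|.
have LK : L <= K by rewrite -lee_fin /L EFin_Rintegral.
have normA : `|\int[m]_z (k z * g z)| <= A.
  have : m.-integrable setT (EFin \o (fun z => k z * g z)).
    apply: (le_integrableR _ _ intkg); first exact: measurable_funM.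
    by move=> z; rewrite normrM.
  move/(le_normr_Rintegral measurableT)/le_trans; apply.
  by under eq_Rintegral do rewrite normrM.
rewrite -(EFin_Rintegral intI) -EFinM lee_fin.
apply: (@le_trans _ _ (A `^ p)).
  by apply: ge0_ler_powR; rewrite ?nnegrE// ltW.
have -> : A `^ p = K `^ (p - 1) * (K * c `^ p).
  rewrite mulrCA mulrA (mulr_powRB1 (ltW K0) p0) -powRM// ?(ltW K0)//.
  by congr powR; rewrite /c; field; rewrite gt_eqF.
rewrite ler_wpM2l ?powR_ge0//.
have tan : (1 - p) * c `^ p * L + p * c `^ (p - 1) * A <=
    \int[m]_z (`|k z| * `|g z| `^ p).
  rewrite -(RintegralZl _ measurableT intk) -(RintegralZl _ measurableT intkg).
  have i1 := @integrableZl _ _ _ m _ measurableT ((1 - p) * c `^ p) _ intk.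
  have i2 := @integrableZl _ _ _ m _ measurableT (p * c `^ (p - 1)) _ intkg.
  rewrite -RintegralD//; apply: le_Rintegral => //.
    by have := integrableD measurableT i1 i2; apply: eq_integrable.
  move=> z _.
  have := powR_tangent p1 c0 (normr_ge0 (g z)).
  rewrite mulrBr -[in X in _ - X]mulrA (mulrC (c `^ (p - 1)) c) mulr_powRB1//.
  move=> h; have := ler_wpM2l (normr_ge0 (k z)) h; lra.
apply: le_trans tan.
have -> : A = K * c by rewrite /c; field; rewrite gt_eqF.
rewrite (_ : p * c `^ (p - 1) * (K * c) = p * K * (c * c `^ (p - 1))); last by ring.
rewrite mulr_powRB1//.
have pX : 0 <= (p - 1) * c `^ p by rewrite mulr_ge0 ?powR_ge0// subr_ge0.
have := ler_wpM2l pX LK; lra.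
Qed.

End general_integral.

(** * Fubini's theorem for real-valued integrals *)

Section fubini_real.
Context d1 d2 (T1 : measurableType d1) (T2 : measurableType d2) (R : realType).
Variables (m1 : {sigma_finite_measure set T1 -> \bar R})
          (m2 : {sigma_finite_measure set T2 -> \bar R}).
Variable f : T1 * T2 -> R.
Hypothesis intf : (m1 \x m2)%E.-integrable setT (EFin \o f).

(** Applying [fine] to the inner integral changes it only on the null set where that integral is
    infinite. *)
Lemma Rintegral_prod1 :
  \int[m1]_x \int[m2]_y f (x, y) = \int[(m1 \x m2)%E]_z f z.
Proof.
rewrite /Rintegral -(integral12_prod_meas1 intf); congr fine.
have iF := integrable_fubini_F intf.
apply: ae_eq_integral => //.
- apply/measurable_EFinP; apply: measurableT_comp => //.
  exact: measurable_int iF.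
- exact: measurable_int iF.
- by have := integrable_ae measurableT iF; apply: filterS => x /= /(_ I) h _; rewrite fineK.
Qed.

Let integrable_fubini_G : m2.-integrable setT (fubini_G m1 (EFin \o f)).
Proof.
apply/integrableP; split; first exact: (measurable_fubini_G intf).
have mf := measurable_int _ intf.
apply: le_lt_trans ((integrable21ltyP m1 m2 mf).1 intf).
apply: ge0_le_integral => //.
- by apply: measurableT_comp => //; exact: (measurable_fubini_G intf).
- apply: (measurable_fun_fubini_tonelli_G (abse \o (EFin \o f))) => //=.
  exact: measurableT_comp.
- move=> y _; apply: le_abse_integral => //.
  exact: measurableT_comp.
Qed.

Lemma Rintegral_prod2 :
  \int[m2]_y \int[m1]_x f (x, y) = \int[(m1 \x m2)%E]_z f z.
Proof.
rewrite /Rintegral -(integral21_prod_meas1 intf); congr fine.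
apply: ae_eq_integral => //.
- apply/measurable_EFinP; apply: measurableT_comp => //.
  exact: measurable_int integrable_fubini_G.
- exact: measurable_int integrable_fubini_G.
- have := integrable_ae measurableT integrable_fubini_G.
  by apply: filterS => x /= /(_ I) h _; rewrite fineK.
Qed.

Lemma integrable_Rintegral1 :
  m1.-integrable setT (EFin \o (fun x => \int[m2]_y f (x, y))).
Proof.
have := integrable_fubini_F intf; apply: le_integrable => //.
  apply/measurable_EFinP; apply: measurableT_comp => //.
  exact: (measurable_fubini_F intf).
move=> x _ /=; rewrite /fubini_F /= /Rintegral.
by case: (\int[m2]_y _)%E => [r| |] //=; rewrite normr0 leey.
Qed.

Lemma integrable_Rintegral2 :
  m2.-integrable setT (EFin \o (fun y => \int[m1]_x f (x, y))).
Proof.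
have := integrable_fubini_G; apply: le_integrable => //.
  apply/measurable_EFinP; apply: measurableT_comp => //.
  exact: (measurable_fubini_G intf).
move=> y _ /=; rewrite /fubini_G /= /Rintegral.
by case: (\int[m1]_x _)%E => [r| |] //=; rewrite normr0 leey.
Qed.

Lemma Rfubini :
  \int[m1]_x \int[m2]_y f (x, y) = \int[m2]_y \int[m1]_x f (x, y).
Proof. by rewrite Rintegral_prod1 -Rintegral_prod2. Qed.

End fubini_real.

Section measurable_Rintegral.
Context d1 d2 (T1 : measurableType d1) (T2 : measurableType d2) (R : realType).
Variables (m2 : {sigma_finite_measure set T2 -> \bar R}).

Lemma measurable_Rintegral (f : T1 * T2 -> R) : measurable_fun setT f ->
  measurable_fun setT (fun x => \int[m2]_y f (x, y)).
Proof.
move=> mf; apply: measurableT_comp => //.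
have mEf : measurable_fun setT (EFin \o f) by exact/measurable_EFinP.
rewrite (_ : (fun _ => _) = (fun x => \int[m2]_y (EFin \o f)^\+ (x, y)) \-
    (fun x => \int[m2]_y (EFin \o f)^\- (x, y)))%E.
  apply: emeasurable_funB; apply: measurable_fun_fubini_tonelli_F => //.
    exact: measurable_funepos.
  exact: measurable_funeneg.
apply/funext => x; rewrite integralE.
by congr (_ - _)%E; apply: eq_integral => y _; rewrite ?funeposE ?funenegE.
Qed.

End measurable_Rintegral.

(** * Averaged translates: Young's inequality and duality *)

Section avg.
Context {R : realType} (n : nat).
Local Notation E := 'rV[R]_n.
Local Notation mu := (lebesgue_rV R n).

Lemma measurable_fun_rVD d (X : measurableType d) (f g : X -> E) :
  measurable_fun setT f -> measurable_fun setT g ->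
  measurable_fun setT (fun x => f x + g x).
Proof.
move=> mf mg; apply: measurable_fun_rV => i; under eq_fun do rewrite mxE.
by apply: measurable_funD; [exact: (measurableT_comp (measurable_rV_coord i) mf)|
  exact: (measurableT_comp (measurable_rV_coord i) mg)].
Qed.

Lemma measurable_fun_rVZ d (X : measurableType d) (c : X -> R) (f : X -> E) :
  measurable_fun setT c -> measurable_fun setT f ->
  measurable_fun setT (fun x => c x *: f x).
Proof.
move=> mc mf; apply: measurable_fun_rV => i; under eq_fun do rewrite mxE.
by apply: measurable_funM => //; exact: (measurableT_comp (measurable_rV_coord i) mf).
Qed.

Context d (T : measurableType d) (m : {sigma_finite_measure set T -> \bar R}).
Implicit Types (k : T -> R) (u : T -> E) (F psi : E -> R).

(** Convolution with the image of the measure [k m] under [u], up to reflection. The parameter space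
    is left abstract, so the image measure needs no density: it is R^n itself for mollifiers and
    time times R^n for the heat kernels. *)
Definition avg k u F (x : E) : R := \int[m]_z (k z * F (x + u z)).

(** The [p]-th power of the [L^p] modulus of continuity; without the root it can be averaged over
    [h] by Tonelli. *)
Definition modulus (p : R) F (h : E) : \bar R :=
  (\int[mu]_x (`|F (x + h) - F x| `^ p)%:E)%E.

Lemma measurable_shift2 u F : measurable_fun setT u -> measurable_fun setT F ->
  measurable_fun setT (fun xz : E * T => F (xz.1 + u xz.2)).
Proof.
move=> mu' mF; apply: (measurableT_comp mF); apply: measurable_fun_rVD.
  exact: measurable_fst.
exact: (measurableT_comp mu' measurable_snd).
Qed.

Lemma measurable_kernel2 k u F : measurable_fun setT k ->
  measurable_fun setT u -> measurable_fun setT F ->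
  measurable_fun setT (fun xz : E * T => k xz.2 * F (xz.1 + u xz.2)).
Proof.
move=> mk mu' mF; apply: measurable_funM; last exact: (measurable_shift2 mu' mF).
exact: (measurableT_comp mk measurable_snd).
Qed.

Lemma measurable_avg k u F : measurable_fun setT k ->
  measurable_fun setT u -> measurable_fun setT F ->
  measurable_fun setT (avg k u F).
Proof.
move=> mk mu' mF.
exact: (measurable_Rintegral m (measurable_kernel2 mk mu' mF)).
Qed.

Lemma measurable_shift1 u F x : measurable_fun setT u -> measurable_fun setT F ->
  measurable_fun setT (fun z => F (x + u z)).
Proof.
move=> mu' mF; apply: (measurableT_comp mF); exact: measurable_fun_rVD.
Qed.

(** Young's inequality: Jensen in [z] for each [x], then Tonelli and translation invariance in [x].
    Jensen supplies [K ^ (p - 1)] and the mass of [k] the last factor [K]. *)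
Lemma avg_Lp k u F (K p : R) : measurable_fun setT k ->
  measurable_fun setT u -> measurable_fun setT F -> 0 < K -> 1 <= p ->
  (\int[m]_z `|k z|%:E <= K%:E)%E ->
  (\int[mu]_x (`|avg k u F x| `^ p)%:E <=
   (K `^ p)%:E * \int[mu]_x (`|F x| `^ p)%:E)%E.
Proof.
move=> mk mu' mF K0 p1 kK.
have mkk : measurable_fun setT (fun z => `|k z|) by exact: measurableT_comp.
have mFp : measurable_fun setT (fun x => `|F x| `^ p).
  by apply: measurable_fun_powR; exact: measurableT_comp.
have mker : measurable_fun setT
    (fun xz : E * T => (`|k xz.2| * `|F (xz.1 + u xz.2)| `^ p)%:E).
  apply/measurable_EFinP.
  exact: (measurable_kernel2 mkk mu' mFp).
have ker0 xz : (0 <= (`|k xz.2| * `|F (xz.1 + u xz.2)| `^ p)%:E)%E.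
  by rewrite lee_fin mulr_ge0 ?powR_ge0.
apply: (@le_trans _ _ (\int[mu]_x ((K `^ (p - 1))%:E *
    \int[m]_z (`|k z| * `|F (x + u z)| `^ p)%:E))%E).
  apply: ge0_le_integral => //.
  - apply/measurable_EFinP; apply: measurable_fun_powR; apply: measurableT_comp => //.
    exact: (measurable_avg mk mu' mF).
  - apply: measurable_funeM.
    exact: (measurable_fun_fubini_tonelli_F _ mker ker0).
  - move=> x _; apply: jensen_powR => //; exact: measurable_shift1.
rewrite ge0_integralZl//; last 3 first.
- exact: (measurable_fun_fubini_tonelli_F _ mker ker0).
- by move=> x _; apply: integral_ge0 => z _; exact: (ker0 (x, z)).
- by rewrite lee_fin powR_ge0.
rewrite (fubini_tonelli (m1 := mu) (m2 := m) _ mker ker0)/=.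
have mFpE : measurable_fun setT (fun x => (`|F x| `^ p)%:E) by exact/measurable_EFinP.
have Ip0 : (0 <= \int[mu]_x (`|F x| `^ p)%:E)%E.
  by apply: integral_ge0 => x _; rewrite lee_fin powR_ge0.
have -> : (\int[m]_z \int[mu]_x (`|k z| * `|F (x + u z)| `^ p)%:E =
    \int[m]_z (`|k z|%:E * \int[mu]_x (`|F x| `^ p)%:E))%E.
  apply: eq_integral => z _.
  rewrite -(ge0_integral_shift (u z) mFpE); last by move=> x; rewrite lee_fin powR_ge0.
  rewrite -ge0_integralZl//.
  by apply: (measurableT_comp mFpE); exact: measurable_rV_shift.
rewrite ge0_integralZr//=; last exact/measurable_EFinP.
rewrite muleA lee_wpmul2r//.
have -> : K `^ p = K `^ (p - 1) * K.
  by rewrite mulrC mulr_powRB1//; [exact: ltW|lra].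
by rewrite EFinM lee_wpmul2l// lee_fin powR_ge0.
Qed.

(** Since [k] has mass 1, [F x] goes under the average; Jensen with [K = 1] and Tonelli then leave
    the mean of the modulus. *)
Lemma avg_sub_Lp k u F (p : R) : measurable_fun setT k ->
  measurable_fun setT u -> measurable_fun setT F -> 1 <= p ->
  (forall z, 0 <= k z) -> (\int[m]_z (k z)%:E = 1)%E ->
  (\int[mu]_x (`|avg k u F x - F x| `^ p)%:E <=
   \int[m]_z ((k z)%:E * modulus p F (u z)))%E.
Proof.
move=> mk mu' mF p1 k0 k1.
have mdif : measurable_fun setT
    (fun xz : E * T => `|F (xz.1 + u xz.2) - F xz.1| `^ p).
  apply: measurable_fun_powR; apply: measurableT_comp => //.
  apply: measurable_funB; first exact: (measurable_shift2 mu' mF).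
  exact: (measurableT_comp mF measurable_fst).
have mker : measurable_fun setT
    (fun xz : E * T => (k xz.2 * `|F (xz.1 + u xz.2) - F xz.1| `^ p)%:E).
  apply/measurable_EFinP; apply: measurable_funM => //.
  exact: (measurableT_comp mk measurable_snd).
have ker0 xz : (0 <= (k xz.2 * `|F (xz.1 + u xz.2) - F xz.1| `^ p)%:E)%E.
  by rewrite lee_fin mulr_ge0 ?powR_ge0.
have intk : m.-integrable setT (EFin \o k).
  by apply: ge0_integrableR => //; rewrite k1 ltry.
apply: (@le_trans _ _ (\int[mu]_x
    \int[m]_z (k z * `|F (x + u z) - F x| `^ p)%:E)%E).
  apply: ge0_le_integral => //.
  - apply/measurable_EFinP; apply: measurable_fun_powR; apply: measurableT_comp => //.
    by apply: measurable_funB => //; exact: (measurable_avg mk mu' mF).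
  - exact: (measurable_fun_fubini_tonelli_F _ mker ker0).
  - move=> x _.
    have msh := measurable_shift1 x mu' mF.
    have mI : measurable_fun setT (fun z => k z * `|F (x + u z) - F x| `^ p).
      apply: measurable_funM => //; apply: measurable_fun_powR.
      by apply: measurableT_comp => //; exact: measurable_funB.
    have I0 z : 0 <= k z * `|F (x + u z) - F x| `^ p.
      by rewrite mulr_ge0 ?powR_ge0.
    (* Where this integral is infinite, [avg] may be the default 0, but the bound is then trivial.
       Elsewhere the differences are integrable against [k] and the real integrals may be
       subtracted. *)
    have [Ioo|] := ltP (\int[m]_z (k z * `|F (x + u z) - F x| `^ p)%:E)%E +oo%E; last first.
      by rewrite leye_eq => /eqP ->; rewrite leey.
    have intI := ge0_integrableR mI I0 Ioo.
    have intd : m.-integrable setT (EFin \o (fun z => k z * (F (x + u z) - F x))).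
      apply: (@le_integrableR _ _ _ _ _ (fun z => k z + k z * `|F (x + u z) - F x| `^ p)).
      - by apply: measurable_funM => //; exact: measurable_funB.
      - move=> z; rewrite normrM (ger0_norm (k0 z)).
        have := ler_wpM2l (k0 z) (le1D_powR p1 (normr_ge0 (F (x + u z) - F x))).
        by rewrite mulrDr mulr1.
      - by have := integrableD measurableT intk intI; apply: eq_integrable.
    have intkF : m.-integrable setT (EFin \o (fun z => k z * F x)).
      have := @integrableZl _ _ _ m _ measurableT (F x) _ intk.
      by apply: eq_integrable => // z _; rewrite /= -EFinM mulrC.
    have -> : avg k u F x - F x = \int[m]_z (k z * (F (x + u z) - F x)).
      rewrite -[F x in LHS]mul1r -[in X in _ - X * _](_ : \int[m]_z k z = 1); last first.
        by rewrite /Rintegral k1.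
      rewrite -RintegralZr// /avg; apply/eqP; rewrite subr_eq -RintegralD//.
      by apply/eqP; apply: eq_Rintegral => z _; ring.
    have := @jensen_powR _ _ _ m k (fun z => F (x + u z) - F x) 1 p mk _ ltr01 p1 _.
    rewrite powR1 mul1e => /(_ (measurable_funB msh (@measurable_cst _ _ _ _ _ _))).
    have -> : (\int[m]_z `|k z|%:E = 1)%E.
      by rewrite -k1; apply: eq_integral => z _; rewrite ger0_norm.
    move=> /(_ (lexx _))/le_trans; apply.
    by apply: eqW; apply: eq_integral => z _; rewrite ger0_norm.
rewrite (fubini_tonelli (m1 := mu) (m2 := m) _ mker ker0)/=.
apply: eqW; apply: eq_integral => z _.
rewrite -ge0_integralZl//.
- by apply/measurable_EFinP; exact: (measurable_fun_pair1 z mdif).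
- by rewrite lee_fin.
Qed.

Section duality.
Variables (k : T -> R) (u : T -> E) (F psi : E -> R) (p M : R).
Hypotheses (mk : measurable_fun setT k) (mu' : measurable_fun setT u)
  (mF : measurable_fun setT F) (mpsi : measurable_fun setT psi)
  (p1 : 1 <= p) (intk : m.-integrable setT (EFin \o k))
  (Fp : (\int[mu]_x (`|F x| `^ p)%:E < +oo)%E)
  (psiM : forall x, `|psi x| <= M) (intpsi : mu.-integrable setT (EFin \o psi)).

Let M0 : 0 <= M. Proof. exact: le_trans (psiM 0). Qed.

Let C : R := \int[mu]_x `|psi x| + M * \int[mu]_x (`|F x| `^ p).

Let mFp : measurable_fun setT (fun x => `|F x| `^ p).
Proof. by apply: measurable_fun_powR; exact: measurableT_comp. Qed.

Let intFp : mu.-integrable setT (EFin \o (fun x => `|F x| `^ p)).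
Proof. by apply: ge0_integrableR => // x; exact: powR_ge0. Qed.

(** Uniformity in [h] is what Fubini requires, since [h] will be [u z]. From [|F| <= 1 + |F|^p] and
    [|psi| <= M], the integrand is at most a translate of [|psi|] plus [M * |F|^p]. *)
Let pairing_le h : (\int[mu]_x `|F x * psi (x + h)|%:E <= C%:E)%E.
Proof.
have mpsih : measurable_fun setT (fun x : E => psi (x + h)).
  by apply: (measurableT_comp mpsi); exact: measurable_rV_shift.
have intapsi : mu.-integrable setT (EFin \o (fun x => `|psi x|)).
  exact: integrable_norm.
have ipsi : mu.-integrable setT (EFin \o (fun x : E => `|psi (x + h)|)).
  apply: ge0_integrableR => //; first exact: measurableT_comp.
  rewrite (ge0_integral_shift h (F := fun x => `|psi x|%:E))//.
    by case/integrableP: intpsi.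
  by apply/measurable_EFinP; exact: measurableT_comp.
have iMF := @integrableZl _ _ _ mu _ measurableT M _ intFp.
apply: (@le_trans _ _ (\int[mu]_x (`|psi (x + h)| + M * `|F x| `^ p)%:E)%E).
  apply: ge0_le_integral => //.
  - by apply/measurable_EFinP; apply: measurableT_comp => //; exact: measurable_funM.
  - apply/measurable_EFinP; apply: measurable_funD; first exact: measurableT_comp.
    exact: measurable_funM.
  - move=> x _; rewrite lee_fin normrM.
    have h1 := ler_wpM2r (normr_ge0 (psi (x + h))) (le1D_powR p1 (normr_ge0 (F x))).
    have h2 := ler_wpM2l (powR_ge0 `|F x| p) (psiM (x + h)).
    by rewrite (le_trans h1)// mulrDl mul1r lerD2l (mulrC M).
under eq_integral do rewrite EFinD EFinM.
rewrite integralD// integralZl// /C EFinD EFinM !EFin_Rintegral//.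
rewrite leeD2r// (ge0_integral_shift h (F := fun x => `|psi x|%:E))//.
by apply/measurable_EFinP; exact: measurableT_comp.
Qed.

Let integrable_kernel1 : (mu \x m)%E.-integrable setT
  (EFin \o (fun xz : E * T => F xz.1 * (k xz.2 * psi (xz.1 + u xz.2)))).
Proof.
have mker : measurable_fun setT
    (fun xz : E * T => F xz.1 * (k xz.2 * psi (xz.1 + u xz.2))).
  apply: measurable_funM; first exact: (measurableT_comp mF measurable_fst).
  exact: (measurable_kernel2 mk mu' mpsi).
apply/integrable21ltyP; first exact/measurable_EFinP.
apply: (@le_lt_trans _ _ (\int[m]_z (`|k z|%:E * C%:E))%E).
  apply: ge0_le_integral => //.
  - by move=> z _; exact: integral_ge0.
  - apply: (measurable_fun_fubini_tonelli_G
      (abse \o (EFin \o (fun xz : E * T => F xz.1 * (k xz.2 * psi (xz.1 + u xz.2)))))) => //=.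
    by apply: measurableT_comp => //; exact/measurable_EFinP.
  - apply: emeasurable_funM => //; apply/measurable_EFinP; exact: measurableT_comp.
  - move=> z _ /=.
    under eq_integral do rewrite mulrCA normrM EFinM.
    rewrite ge0_integralZl//; last first.
      apply/measurable_EFinP; apply: measurableT_comp => //.
      apply: measurable_funM => //.
      by apply: (measurableT_comp mpsi); exact: measurable_rV_shift.
    exact: lee_wpmul2l (pairing_le (u z)).
rewrite ge0_integralZr//.
- by rewrite lte_mul_pinfty//; [exact: integral_ge0|
    exact: (integrable_fin_num measurableT (integrable_norm intk))|exact: ltry].
- by apply/measurable_EFinP; exact: measurableT_comp.
- by rewrite lee_fin /C addr_ge0// ?mulr_ge0//; apply: Rintegral_ge0 => x _; rewrite ?powR_ge0.
Qed.

Lemma Rintegral_mul_avg :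
  \int[mu]_x (F x * avg k u psi x) =
  \int[m]_z (k z * \int[mu]_x (F x * psi (x + u z))).
Proof.
transitivity (\int[mu]_x \int[m]_z (F x * (k z * psi (x + u z)))).
  apply: eq_Rintegral => x _; rewrite RintegralZl_total//.
  by apply: measurable_funM => //; exact: measurable_shift1.
rewrite (Rfubini integrable_kernel1); apply: eq_Rintegral => z _.
under eq_Rintegral do rewrite /= mulrCA.
rewrite RintegralZl_total//; apply: measurable_funM => //.
by apply: (measurableT_comp mpsi); exact: measurable_rV_shift.
Qed.

Lemma integrable_mul_avg : mu.-integrable setT
  (EFin \o (fun x => F x * avg k u psi x)).
Proof.
have := integrable_Rintegral1 integrable_kernel1; apply: eq_integrable => // x _ /=.
congr EFin; rewrite RintegralZl_total//.
by apply: measurable_funM => //; exact: measurable_shift1.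
Qed.

Lemma integrable_kernel_pairing : m.-integrable setT
  (EFin \o (fun z => k z * \int[mu]_x (F x * psi (x + u z)))).
Proof.
have := integrable_Rintegral2 integrable_kernel1; apply: eq_integrable => // z _ /=.
congr EFin; under eq_Rintegral do rewrite /= mulrCA.
rewrite RintegralZl_total//; apply: measurable_funM => //.
by apply: (measurableT_comp mpsi); exact: measurable_rV_shift.
Qed.

Let integrable_kernel2 : (mu \x m)%E.-integrable setT
  (EFin \o (fun xz : E * T => k xz.2 * (F (xz.1 - u xz.2) * psi xz.1))).
Proof.
have mu'' : measurable_fun setT (fun z => - u z).
  exact: (measurableT_comp (@measurable_rV_opp R n) mu').
have mker : measurable_fun setT
    (fun xz : E * T => k xz.2 * (F (xz.1 - u xz.2) * psi xz.1)).
  apply: measurable_funM; first exact: (measurableT_comp mk measurable_snd).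
  apply: measurable_funM; last exact: (measurableT_comp mpsi measurable_fst).
  exact: (measurable_shift2 mu'' mF).
apply/integrable21ltyP; first exact/measurable_EFinP.
apply: (@le_lt_trans _ _ (\int[m]_z (`|k z|%:E * C%:E))%E).
  apply: ge0_le_integral => //.
  - by move=> z _; exact: integral_ge0.
  - apply: (measurable_fun_fubini_tonelli_G
      (abse \o (EFin \o (fun xz : E * T => k xz.2 * (F (xz.1 - u xz.2) * psi xz.1))))) => //=.
    by apply: measurableT_comp => //; exact/measurable_EFinP.
  - apply: emeasurable_funM => //; apply/measurable_EFinP; exact: measurableT_comp.
  - move=> z _ /=.
    under eq_integral do rewrite normrM EFinM.
    rewrite ge0_integralZl//; last first.
      apply/measurable_EFinP; apply: measurableT_comp => //.
      apply: measurable_funM => //.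
      by apply: (measurableT_comp mF); exact: measurable_rV_shift.
    apply: lee_wpmul2l => //; apply: le_trans (pairing_le (u z)).
    rewrite -(@ge0_integral_shift _ _ (u z) (fun x => `|F (x - u z) * psi x|%:E))//.
      by under eq_integral do rewrite addrK.
    apply/measurable_EFinP; apply: measurableT_comp => //; apply: measurable_funM => //.
    by apply: (measurableT_comp mF); exact: measurable_rV_shift.
rewrite ge0_integralZr//.
- by rewrite lte_mul_pinfty//; [exact: integral_ge0|
    exact: (integrable_fin_num measurableT (integrable_norm intk))|exact: ltry].
- by apply/measurable_EFinP; exact: measurableT_comp.
- by rewrite lee_fin /C addr_ge0// ?mulr_ge0//; apply: Rintegral_ge0 => x _; rewrite ?powR_ge0.
Qed.

(** Fubini on both sides; in between, for each [z], the translation by [u z] moves the displacement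
    from [psi] to [F] and reverses it. *)
Lemma Rintegral_avg_adjoint :
  \int[mu]_x (F x * avg k u psi x) =
  \int[mu]_x (avg k (fun z => - u z) F x * psi x).
Proof.
have mu'' : measurable_fun setT (fun z => - u z).
  exact: (measurableT_comp (@measurable_rV_opp R n) mu').
rewrite Rintegral_mul_avg.
transitivity (\int[mu]_x \int[m]_z (k z * (F (x - u z) * psi x))); last first.
  apply: eq_Rintegral => x _; rewrite mulrC -RintegralZl_total//.
    by apply: eq_Rintegral => z _; ring.
  by apply: measurable_funM => //; exact: (measurable_shift1 x mu'' mF).
rewrite (Rfubini integrable_kernel2); apply: eq_Rintegral => z _ /=.
have mFz : measurable_fun setT (fun x : E => F (x - u z) * psi x).
  by apply: measurable_funM => //; apply: (measurableT_comp mF); exact: measurable_rV_shift.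
rewrite RintegralZl_total//; congr (_ * _).
rewrite /Rintegral -[in RHS](@integral_shift _ _ (u z) (fun x => (F (x - u z) * psi x)%:E)).
  by under [in RHS]eq_integral do rewrite addrK.
exact/measurable_EFinP.
Qed.

Lemma integrable_avg_mul : mu.-integrable setT
  (EFin \o (fun x => avg k (fun z => - u z) F x * psi x)).
Proof.
have mu'' : measurable_fun setT (fun z => - u z).
  exact: (measurableT_comp (@measurable_rV_opp R n) mu').
have := integrable_Rintegral1 integrable_kernel2; apply: eq_integrable => // x _ /=.
congr EFin; rewrite [RHS]mulrC -RintegralZl_total//.
  by apply: eq_Rintegral => z _; ring.
by apply: measurable_funM => //; exact: (measurable_shift1 x mu'' mF).
Qed.

End duality.

End avg.

(** * Continuity of translations in L^p *)

Section powR_diff.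
Context {R : realType}.
Implicit Types a b p : R.

(** Write each power as [t * t ^ (p - 1)] and use that the second factor is nondecreasing. *)
Lemma powR_superadd p a b : 1 <= p -> 0 <= a -> 0 <= b ->
  a `^ p + b `^ p <= (a + b) `^ p.
Proof.
move=> p1 a0 b0; have p0 : 0 < p by lra.
rewrite -(mulr_powRB1 a0 p0) -(mulr_powRB1 b0 p0).
rewrite -(mulr_powRB1 (addr_ge0 a0 b0) p0) mulrDl lerD// ler_wpM2l//;
  by apply: ge0_ler_powR; rewrite ?nnegrE ?subr_ge0 ?addr_ge0 ?lerDl ?lerDr.
Qed.

(** Transfers continuity of translations from [L^1], applied to [p]-th powers, to [L^p], so that
    approximation is only ever done in [L^1]. *)
Lemma powR_dist_le p a b : 1 <= p -> 0 <= a -> 0 <= b ->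
  `|a - b| `^ p <= `|a `^ p - b `^ p|.
Proof.
move=> p1; wlog ab : a b / b <= a => [h|] a0 b0.
  by have [ba|/ltW ab] := leP b a; [exact: h|rewrite distrC (distrC (a `^ p)); exact: h].
have d0 : 0 <= a - b by rewrite subr_ge0.
have := powR_superadd p1 d0 b0; rewrite subrK => h.
by rewrite (ger0_norm d0) ger0_norm; rewrite ?lerBrDr ?add0r// (le_trans _ h)// lerDr powR_ge0.
Qed.

End powR_diff.

Section translation.
Context {R : realType} (n : nat).
Local Notation E := 'rV[R]_n.
Local Notation mu := (lebesgue_rV R n).
Implicit Types (F G H : E -> R) (A : set E) (M e d : R).

(** Integrating over a cube only admits constants and indicators of sets of infinite measure, so
    that the property can be stable under complements. *)
Definition loc_transl_cont F := measurable_fun setT F /\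
  forall M e, 0 < e -> exists2 d, 0 < d & forall h, cube d h ->
    (\int[mu]_x (`|F (x + h) - F x| * \1_(cube M) x)%:E <= e%:E)%E.

Let mshift F h : measurable_fun setT F -> measurable_fun setT (fun x : E => F (x + h)).
Proof. by move=> mF; apply: (measurableT_comp mF); exact: measurable_rV_shift. Qed.

Let mcube M : measurable_fun setT (\1_(cube M) : E -> R).
Proof. by apply: measurable_indic; exact: measurable_cube. Qed.

Let mdiff F h : measurable_fun setT F ->
  measurable_fun setT (fun x : E => `|F (x + h) - F x|).
Proof.
by move=> mF; apply: measurableT_comp => //; apply: measurable_funB => //; exact: mshift.
Qed.

Let mdiffE F h M : measurable_fun setT F ->
  measurable_fun setT (fun x : E => (`|F (x + h) - F x| * \1_(cube M) x)%:E).
Proof.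
by move=> mF; apply/measurable_EFinP; apply: measurable_funM => //; exact: mdiff.
Qed.

Let diffE_ge0 F h M x : (0 <= (`|F (x + h) - F x| * \1_(cube M) x)%:E)%E.
Proof. by rewrite lee_fin mulr_ge0. Qed.

(** Serves complements, finite unions and linear combinations at once: in each case the increments
    are controlled by those of two functions already treated. *)
Lemma loc_transl_cont_lip c F G H : 0 < c -> measurable_fun setT F ->
  loc_transl_cont G -> loc_transl_cont H ->
  (forall x y, `|F x - F y| <= c * (`|G x - G y| + `|H x - H y|)) ->
  loc_transl_cont F.
Proof.
move=> c0 mF [mG cG] [mH cH] FGH; split => // M e e0.
have e' : 0 < e / (2 * c) by rewrite divr_gt0// mulr_gt0.
have [d1 d10 h1] := cG M _ e'; have [d2 d20 h2] := cH M _ e'.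
exists (Num.min d1 d2); first by rewrite lt_min d10.
move=> h dh; have {}h1 := h1 h (cube_le _ dh); have {}h2 := h2 h (cube_le _ dh).
apply: (@le_trans _ _ (c%:E * (\int[mu]_x (`|G (x + h) - G x| * \1_(cube M) x)%:E +
    \int[mu]_x (`|H (x + h) - H x| * \1_(cube M) x)%:E))%E).
  rewrite -ge0_integralD//; [|exact: mdiffE..].
  rewrite -ge0_integralZl//; last 3 first.
  - by apply: emeasurable_funD; exact: mdiffE.
  - by move=> x _; rewrite adde_ge0.
  - by rewrite lee_fin ltW.
  apply: ge0_le_integral => //.
  - exact: mdiffE.
  - by apply: measurable_funeM; apply: emeasurable_funD; exact: mdiffE.
  - move=> x _; rewrite -EFinD -EFinM lee_fin -mulrDl mulrA.
    by rewrite ler_wpM2r.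
have -> : e%:E = (c%:E * ((e / (2 * c))%:E + (e / (2 * c))%:E))%E.
  by rewrite -EFinD -EFinM; congr EFin; field; rewrite gt_eqF.
rewrite lee_wpmul2l ?lee_fin ?(ltW c0)// leeD//.
- by rewrite h1// ge_min lexx.
- by rewrite h2// ge_min lexx orbT.
Qed.

Lemma loc_transl_cont_cst c : loc_transl_cont (cst c).
Proof.
split=> // M e e0; exists 1 => // h _.
under eq_integral do rewrite /= subrr normr0 mul0r.
by rewrite integral0 lee_fin ltW.
Qed.

Lemma loc_transl_cont_lim F : measurable_fun setT F ->
  (forall M e, 0 < e -> exists2 G, loc_transl_cont G &
    (\int[mu]_x (`|F x - G x| * \1_(cube M) x)%:E <= e%:E)%E) ->
  loc_transl_cont F.
Proof.
move=> mF app; split => // M e e0; have e3 : 0 < e / 3 by rewrite divr_gt0.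
(* For [h] in the unit cube, the translate of [cube M] stays inside [cube (M + 1)], so one
   approximation controls both [F x] and [F (x + h)]. *)
have [G [mG cG] FG] := app (M + 1) _ e3.
have [d d0 hd] := cG M _ e3.
exists (Num.min d 1); first by rewrite lt_min d0/=.
move=> h dh.
have {}hd : (\int[mu]_x (`|G (x + h) - G x| * \1_(cube M) x)%:E <= (e / 3)%:E)%E.
  by apply: hd; apply: cube_le dh; rewrite ge_min lexx.
have h1 : cube 1 h by apply: cube_le dh; rewrite ge_min lexx orbT.
have mFG : measurable_fun setT (fun x => (`|F x - G x| * \1_(cube (M + 1)) x)%:E).
  apply/measurable_EFinP; apply: measurable_funM => //; apply: measurableT_comp => //.
  exact: measurable_funB.
have FG0 x : (0 <= (`|F x - G x| * \1_(cube (M + 1)) x)%:E)%E.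
  by rewrite lee_fin mulr_ge0.
have mFGh : measurable_fun setT
    (fun x : E => (`|F (x + h) - G (x + h)| * \1_(cube (M + 1)) (x + h))%:E).
  by apply: (measurableT_comp mFG); exact: measurable_rV_shift.
have mGh : measurable_fun setT (fun x : E => (`|G (x + h) - G x| * \1_(cube M) x)%:E).
  exact: mdiffE.
apply: (@le_trans _ _ (\int[mu]_x (
   (`|F (x + h) - G (x + h)| * \1_(cube (M + 1)) (x + h))%:E +
   ((`|G (x + h) - G x| * \1_(cube M) x)%:E +
   (`|F x - G x| * \1_(cube (M + 1)) x)%:E)))%E).
  apply: ge0_le_integral => //.
  - exact: mdiffE.
  - by apply: emeasurable_funD => //; exact: emeasurable_funD.
  - move=> x _; rewrite -!EFinD lee_fin.
    have [xM|xM] := pselect (cube M x); last first.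
      have -> : \1_(cube M) x = 0 :> R by rewrite indicE memNset.
      by rewrite !mulr0 add0r addr_ge0// mulr_ge0.
    have -> : \1_(cube M) x = 1 :> R by rewrite indicE mem_set.
    have -> : \1_(cube (M + 1)) x = 1 :> R.
      by rewrite indicE mem_set//; apply: cube_le xM; rewrite lerDl.
    have -> : \1_(cube (M + 1)) (x + h) = 1 :> R.
      by rewrite indicE mem_set//; exact: cubeD.
    rewrite !mulr1 (_ : F (x + h) - F x = (F (x + h) - G (x + h)) + ((G (x + h) - G x) - (F x - G x))); last by ring.
    by rewrite (le_trans (ler_normD _ _))// lerD2l (le_trans (ler_normB _ _)).
rewrite ge0_integralD//; last 2 first.
- by move=> x _; rewrite adde_ge0.
- exact: emeasurable_funD.
rewrite ge0_integralD// (ge0_integral_shift h mFG FG0).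
have -> : e%:E = ((e / 3)%:E + ((e / 3)%:E + (e / 3)%:E))%E.
  by rewrite -!EFinD; congr EFin; field.
by rewrite !leeD.
Qed.

Let indic_dist A B (x y : E) :
  `|\1_(A `|` B) x - \1_(A `|` B) y : R| <=
  1 * (`|\1_A x - \1_A y : R| + `|\1_B x - \1_B y|).
Proof.
rewrite mul1r !indicE !in_setU.
by do 4 (case: (_ \in _)); rewrite /= ?subrr ?subr0 ?sub0r ?normrN ?normr1 ?normr0 ?addr0 ?add0r ?lerDl.
Qed.

(** The delicate case is a countable union: on a cube it differs from its finite subunions by
    decreasing sets with empty intersection, whose finite measures tend to 0, so its indicator is a
    local [L^1] limit. *)
Lemma sigma_algebra_loc_transl_cont :
  sigma_algebra setT [set A | measurable A /\ loc_transl_cont (\1_A : E -> R)].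
Proof.
split.
- split => //; rewrite (_ : \1_set0 = cst 0); first exact: loc_transl_cont_cst.
  by apply/funext => x; rewrite indic0.
- move=> A [mA cA]; rewrite setTD; split; first exact: measurableC.
  apply: (loc_transl_cont_lip ltr01 _ cA (loc_transl_cont_cst 0)).
    by apply: measurable_indic; exact: measurableC.
  move=> x y; rewrite /= subrr normr0 addr0 mul1r !indicE !in_setC.
  by do 2 (case: (_ \in _)); rewrite /= ?subrr ?subr0 ?sub0r ?normrN.
- move=> A AD; have mA k : measurable (A k) by have [] := AD k.
  have mUA : measurable (\bigcup_i A i) by exact: bigcupT_measurable.
  split => //.
  apply: loc_transl_cont_lim; first exact: measurable_indic.
  move=> M e e0.
  pose B k := \big[setU/set0]_(i < k) A i.
  have mB k : measurable (B k) by apply: bigsetU_measurable => i _.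
  pose D k := (\bigcup_i A i `\` B k) `&` cube M.
  have mD k : measurable (D k).
    by apply: measurableI; [exact: measurableD|exact: measurable_cube].
  have : mu (D k) @[k --> \oo] --> mu (\bigcap_k D k).
    apply: nonincreasing_cvg_mu => //.
    - apply: le_lt_trans (cube_lty n M); apply: le_measure; rewrite ?inE//.
        exact: measurable_cube.
      by move=> x [].
    - by apply: bigcap_measurableType.
    - move=> k l kl; apply/subsetPset => x [[xA nB] xM]; split => //; split => //.
      apply: contra_not nB; rewrite /B -!bigcup_mkord => -[i /= ik Ai].
      by exists i => //=; exact: leq_trans kl.
  have -> : \bigcap_k D k = set0.
    apply/seteqP; split => // x xD; have [[[i _ Ai] _] _] := xD 0%N I.
    have [[_ nB] _] := xD i.+1 I; apply: nB; rewrite /B -bigcup_mkord.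
    by exists i => /=.
  rewrite measure0 => /fine_cvgP[Dfin Dcvg].
  have /cvgrPdist_le/(_ e e0)[N _ HN] := Dcvg.
  have [N' _ HN'] := Dfin.
  pose K := maxn N N'.
  exists (\1_(B K)).
    rewrite /B; elim: K => [|k IH].
      rewrite big_ord0 (_ : \1_set0 = cst 0); first exact: loc_transl_cont_cst.
      by apply/funext => x; rewrite indic0.
    rewrite big_ord_recr/=.
    apply: (loc_transl_cont_lip ltr01 _ IH (AD k).2 (indic_dist _ _)).
    by apply: measurable_indic; apply: measurableU => //; exact: mB.
  have := HN K (leq_maxl _ _); have := HN' K (leq_maxr _ _).
  rewrite /= sub0r normrN => DK fK.
  have : (mu (D K) <= e%:E)%E by rewrite -(fineK DK) lee_fin (le_trans (ler_norm _)).
  apply: le_trans; rewrite -[in leRHS](setIT (D K)) -integral_indic//.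
  apply: eqW; apply: eq_integral => x _.
  congr EFin; rewrite !indicE /D in_setI in_setD.
  have : B K x -> (\bigcup_i A i) x.
    by rewrite /B -bigcup_mkord => -[i _ ?]; exists i.
  case: (boolP (x \in B K)) => [|_ _].
    by rewrite inE => BK /(_ BK) Ax; rewrite (mem_set Ax)/= subrr normr0 mul0r.
  by rewrite subr0; do 2 (case: (_ \in _)); rewrite /= ?normr1 ?normr0 ?mulr1 ?mulr0 ?mul0r.
Qed.

(** The indicator differs between [x] and [x + h] only in a slab of width [2 * d] about the
    hyperplane, and the slab meets the cube in a box of measure proportional to [d]. *)
Lemma loc_transl_cont_halfspace (i : 'I_n) (c : R) :
  loc_transl_cont (\1_[set x : E | c < x ord0 i]).
Proof.
set A := [set x | _].
have mA : measurable A.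
  rewrite /A (_ : mkset _ = (fun x : E => x ord0 i) @^-1` `]c, +oo[).
    by rewrite -[X in measurable X]setTI; apply: (measurable_rV_coord i measurableT); exact: measurable_itv.
  by apply/seteqP; split => x /=; rewrite in_itv/= andbT.
split; first exact: measurable_indic.
move=> M e e0.
pose I d (j : 'I_n) : set R := if j == i then `[c - d, c + d]%classic else `[- M, M]%classic.
have mI d j : measurable (I d j) by rewrite /I; case: ifP => _; exact: measurable_itv.
pose K := (\prod_(j < n | j != i) lebesgue_measure (`[(- M)%R, M]%classic : set R))%E.
have K0 : (0 <= K)%E by apply: prode_ge0.
have Kfin : K \is a fin_num.
  by apply: prode_fin_num => j _; rewrite lebesgue_measure_itv/= lte_fin; case: ifP.
have boxE d : 0 <= d ->
    mu [set x | forall j, I d j (x ord0 j)] = ((2 * d)%:E * K)%E.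
  move=> d0; rewrite lebesgue_rV_box// (bigD1 i)//= /I eqxx; congr (_ * _)%E.
    rewrite lebesgue_measure_itv/= lte_fin; case: ifPn => [_|].
      by rewrite -EFinB; congr EFin; ring.
    rewrite -leNgt => h; have -> : d = 0 by lra.
    by rewrite mulr0.
  by apply: eq_bigr => j /negbTE ->.
(* The box has measure [2 * d * K]; adding 1 keeps [d] positive even when [M <= 0] makes [K]
   vanish. *)
exists (e / (2 * (fine K + 1))).
  by rewrite divr_gt0// mulr_gt0// ltr_wpDl// fine_ge0.
set d := e / _ => h dh.
have d0 : 0 < d by rewrite divr_gt0// mulr_gt0// ltr_wpDl// fine_ge0.
pose box : set E := [set x | forall j, I d j (x ord0 j)].
have mbox : measurable box.
  rewrite (_ : box = \bigcap_(j in [set: 'I_n]) [set x : E | I d j (x ord0 j)]).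
    apply: fin_bigcap_measurable => // j _.
    by rewrite -[X in measurable X]setTI; exact: (measurable_rV_coord j measurableT (mI d j)).
  by apply/seteqP; split => [x Mx j _|x Mx j]; [exact: Mx|exact: (Mx j)].
apply: (@le_trans _ _ (mu box)).
  rewrite -[in leRHS](setIT box) -integral_indic//.
  apply: ge0_le_integral => //.
  - by apply: mdiffE; exact: measurable_indic.
  - by apply/measurable_EFinP; exact: measurable_indic.
  - move=> x _; rewrite lee_fin.
    rewrite [leRHS]indicE; case: (boolP (x \in box)) => [_|].
      rewrite !indicE /=; do 3 (case: (_ \in _)); rewrite /= ?mulr0 ?mulr1 ?subrr ?subr0 ?sub0r ?normrN ?normr1 ?normr0//.
    rewrite notin_setE/= => nbox.
    suff : x \notin cube M \/ (x \in A) = (x + h \in A).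
      by case=> [/negbTE xM|xA]; rewrite !indicE ?xM ?mulr0// xA subrr normr0 mul0r.
    have [xM|] := boolP (x \in cube M); last by left.
    right; apply/eqP/negPn/negP => Axh; apply: nbox => j; rewrite /I; case: eqVneq => [->|_].
      have := dh i; rewrite ler_norml => /andP[dh1 dh2].
      move: Axh; rewrite /= in_itv/=.
      case: (boolP (x \in A)); rewrite ?inE ?notin_setE /A/= => xA;
       case: (boolP (x + h \in A)); rewrite ?inE ?notin_setE /A/= => xhA // _;
       move: xA xhA; rewrite !mxE => xA xhA; apply/andP; split; lra.
    by move: xM; rewrite inE => /(_ j); rewrite ler_norml /= in_itv.
have -> : mu box = (2 * d * fine K)%:E.
  by rewrite EFinM fineK// -boxE// ltW.
rewrite lee_fin.
have k0 : 0 <= fine K by rewrite fine_ge0.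
rewrite /d (_ : _ * _ = e * (fine K / (fine K + 1))); last first.
  by field; lra.
by rewrite ler_piMr ?(ltW e0)// ler_pdivrMr ?mul1r; lra.
Qed.

Lemma loc_transl_cont_indic A : measurable A -> loc_transl_cont (\1_A : E -> R).
Proof.
move=> mA; have saD := sigma_algebra_loc_transl_cont.
suff : [set B | measurable B] `<=`
    [set A : set E | measurable A /\ loc_transl_cont (\1_A : E -> R)].
  by move=> /(_ A mA)[].
apply: smallest_sub; first exact: saD.
move=> B; rewrite -bigcup_seq/= => -[i _ [Y mY <-]]; rewrite setTI {B}.
(* A second generation argument, now on the line: Borel sets are generated by the rays []c, +oo[],
   whose preimages are half-spaces. *)
pose D := [set Y : set R | measurable ((fun x : E => x ord0 i) @^-1` Y) /\
  loc_transl_cont (\1_((fun x : E => x ord0 i) @^-1` Y) : E -> R)].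
suff : (@ocitv R).-sigma.-measurable `<=` D by move=> /(_ Y mY).
rewrite (RGenOInfty.measurableE R); apply: smallest_sub.
  case: saD => [D0 DC DU]; split.
  - by rewrite /D /= preimage_set0; exact: D0.
  - by move=> Z /DC; rewrite setTD preimage_setC setTD.
  - by move=> Z ZD; rewrite /D/= preimage_bigcup; exact: DU.
move=> _ [c ->]; rewrite /D /=.
have -> : (fun x : E => x ord0 i) @^-1` `]c, +oo[ = [set x : E | c < x ord0 i].
  by apply/seteqP; split => x /=; rewrite in_itv/= andbT.
split; last exact: loc_transl_cont_halfspace.
by have [/measurable_indicP] := loc_transl_cont_halfspace i c.
Qed.

Lemma loc_transl_cont_sum (s : seq R) (c : R -> R) (A : R -> set E) :
  (forall y, measurable (A y)) ->
  loc_transl_cont (fun x => \sum_(y <- s) c y * \1_(A y) x).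
Proof.
move=> mA; elim: s => [|y s IH].
  rewrite (_ : (fun _ => _) = cst 0); first exact: loc_transl_cont_cst.
  by apply/funext => x; rewrite big_nil.
have cy0 : 0 < `|c y| + 1 by rewrite ltr_wpDl.
have [mS _] := IH.
apply: (loc_transl_cont_lip cy0 _ IH (loc_transl_cont_indic (mA y))).
  under eq_fun do rewrite big_cons.
  by apply: measurable_funD => //; apply: measurable_funM.
move=> x z; rewrite !big_cons.
set a := \sum_(_ <- _) _; set b := \sum_(_ <- _) _.
rewrite (_ : _ - _ = c y * (\1_(A y) x - \1_(A y) z) + (a - b)); last by ring.
rewrite (le_trans (ler_normD _ _))// normrM mulrDr addrC lerD//.
- by rewrite ler_peMl// lerDr.
- by rewrite ler_wpM2r// lerDl.
Qed.

Import HBSimple.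

Lemma loc_transl_cont_integrable F : mu.-integrable setT (EFin \o F) ->
  loc_transl_cont F.
Proof.
move=> intF; have mF : measurable_fun setT F by apply/measurable_EFinP; exact: measurable_int intF.
apply: loc_transl_cont_lim => // M e e0.
have [g [intg _ /fine_cvgP[gfin gcvg]]] := approximation_sfun_integrable measurableT intF.
have /cvgrPdist_le/(_ e e0)[N _ HN] := gcvg.
have [N' _ HN'] := gfin.
pose K := maxn N N'.
have := HN K (leq_maxl _ _); have := HN' K (leq_maxr _ _).
rewrite /= sub0r normrN => DK fK.
exists (g K).
  rewrite (_ : (g K : E -> R) = (fun x => \sum_(y <- finmap.enum_fset
      (fset_set (range (g K)))) y * \1_(g K @^-1` [set y]) x)).
    by apply: (@loc_transl_cont_sum _ id) => y; exact: measurable_funPTI.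
  by apply/funext => x; rewrite fimfunE fsbig_finite//; exact: fimfunP.
apply: (@le_trans _ _ (\int[mu]_z `|(F z)%:E - (g K z)%:E|)%E).
  have mFg : measurable_fun setT (fun x => `|F x - g K x|).
    by apply: measurableT_comp => //; exact: measurable_funB.
  apply: ge0_le_integral => //.
  - by apply/measurable_EFinP; apply: measurable_funM.
  - exact/measurable_EFinP.
  - by move=> x _; rewrite lee_fin indicE; case: (_ \in _); rewrite ?mulr1 ?mulr0.
by rewrite -(fineK DK) lee_fin (le_trans (ler_norm _)).
Qed.

(** Local continuity on a large cube, together with the tails of [F] and of its translate, which
    dominated convergence makes small. *)
Lemma transl_cont_L1 F e : mu.-integrable setT (EFin \o F) -> 0 < e ->
  exists2 d, 0 < d & forall h, cube d h ->
    (\int[mu]_x `|F (x + h) - F x|%:E <= e%:E)%E.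
Proof.
move=> intF e0; have [mF cF] := loc_transl_cont_integrable intF.
have e4 : 0 < e / 4 by rewrite divr_gt0.
pose tail k (x : E) : R := `|F x| * (1 - \1_(cube k%:R) x).
have mtail k : measurable_fun setT (tail k).
  apply: measurable_funM; first exact: measurableT_comp.
  by apply: measurable_funB => //; exact: mcube.
have tail0 k x : 0 <= tail k x.
  by rewrite mulr_ge0// subr_ge0 indicE lern1 leq_b1.
have taille k x : tail k x <= `|F x|.
  by rewrite ler_piMr// gerBl indicE ler0n.
have [k Hk] : exists k, (\int[mu]_x (tail k x)%:E <= (e / 4)%:E)%E.
  have [] := @dominated_convergence _ _ _ mu _ measurableT
    (fun k => EFin \o tail k) (cst 0%E) (EFin \o (fun x => `|F x|)).
  - by move=> k; exact/measurable_EFinP.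
  - exact: measurable_cst.
  - apply: aeW => x _; apply: cvg_near_cst.
    have [N _ HN] : (\bigcup_k cube k%:R) x by rewrite bigcup_cube.
    exists N => // k /= Nk; rewrite /tail indicE mem_set ?subrr ?mulr0//.
    by apply: cube_le HN; rewrite ler_nat.
  - exact: integrable_norm.
  - by apply: aeW => x k _; rewrite /= lee_fin ger0_norm.
  rewrite integral_cst// mul0e => _ _ /fine_cvgP[fin cvg0].
  have /cvgrPdist_le/(_ _ e4)[N _ HN] := cvg0; have [N' _ HN'] := fin.
  exists (maxn N N'); have := HN _ (leq_maxl N N'); have := HN' _ (leq_maxr N N').
  by rewrite /= sub0r normrN => DK fK; rewrite -(fineK DK) lee_fin (le_trans (ler_norm _)).
(* The margin 1 ensures that outside this larger cube both [x] and [x + h] lie outside [cube k],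
   where the tails take over. *)
have [d d0 hd] := cF (k%:R + 1) _ (divr_gt0 e0 (ltr0Sn _ 1)).
exists (Num.min d 1); first by rewrite lt_min d0/=.
move=> h dh.
have {}hd : (\int[mu]_x (`|F (x + h) - F x| * \1_(cube (k%:R + 1)) x)%:E <= (e / 2)%:E)%E.
  by apply: hd; apply: cube_le dh; rewrite ge_min lexx.
have h1 : cube 1 h by apply: cube_le dh; rewrite ge_min lexx orbT.
have mtE : measurable_fun setT (fun x => (tail k x)%:E) by exact/measurable_EFinP.
have mthE : measurable_fun setT (fun x : E => (tail k (x + h))%:E).
  by apply: (measurableT_comp mtE); exact: measurable_rV_shift.
apply: (@le_trans _ _ (\int[mu]_x (
   (`|F (x + h) - F x| * \1_(cube (k%:R + 1)) x)%:E +
   ((tail k (x + h))%:E + (tail k x)%:E)))%E).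
  apply: ge0_le_integral => //.
  - by apply/measurable_EFinP; exact: mdiff.
  - by apply: emeasurable_funD; [exact: mdiffE|exact: emeasurable_funD].
  - move=> x _; rewrite -!EFinD lee_fin.
    have [xM|xM] := pselect (cube (k%:R + 1) x).
      have -> : \1_(cube (k%:R + 1)) x = 1 :> R by rewrite indicE mem_set.
      by rewrite mulr1 lerDl addr_ge0.
    have -> : \1_(cube (k%:R + 1)) x = 0 :> R by rewrite indicE memNset.
    rewrite mulr0 add0r /tail !indicE !memNset/= ?subr0 ?mulr1.
    + exact: ler_normB.
    + by apply: contra_not xM; apply: cube_le; rewrite lerDl.
    + apply: contra_not xM => xhM.
      by rewrite -(addrK h x); apply: cubeD => //; exact: cubeN.
rewrite ge0_integralD//; last 3 first.
- exact: mdiffE.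
- by move=> x _; rewrite adde_ge0// lee_fin.
- exact: emeasurable_funD.
rewrite ge0_integralD//; [|by move=> x _; rewrite lee_fin..].
rewrite (ge0_integral_shift h mtE); last by move=> x; rewrite lee_fin.
have -> : e%:E = ((e / 2)%:E + ((e / 4)%:E + (e / 4)%:E))%E.
  by rewrite -!EFinD; congr EFin; field.
by rewrite !leeD.
Qed.

(** The sign is lost in [|F|^p], so positive and negative parts are treated apart: their [p]-th
    powers are integrable, translate continuously in [L^1], and [powR_dist_le] brings the estimate
    back to [F]. *)
Lemma modulus_cvg0 (p : R) F e : 1 <= p -> measurable_fun setT F ->
  (\int[mu]_x (`|F x| `^ p)%:E < +oo)%E -> 0 < e ->
  exists2 d, 0 < d & forall h, cube d h -> (modulus p F h <= e%:E)%E.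
Proof.
move=> p1 mF Fp e0; have p0 : 0 <= p by lra.
pose P x := Num.max (F x) 0 `^ p; pose N x := Num.max (- F x) 0 `^ p.
have mP : measurable_fun setT P.
  by apply: measurable_fun_powR; apply: measurable_maxr.
have mN : measurable_fun setT N.
  apply: measurable_fun_powR; apply: measurable_maxr => //.
  exact: measurableT_comp.
have intFp : mu.-integrable setT (EFin \o (fun x => `|F x| `^ p)).
  apply: ge0_integrableR => //.
  by apply: measurable_fun_powR; exact: measurableT_comp.
have max0 (a : R) : 0 <= Num.max a 0 by rewrite le_max lexx orbT.
have intP : mu.-integrable setT (EFin \o P).
  apply: le_integrableR intFp => // x; rewrite ger0_norm ?powR_ge0//.
  apply: ge0_ler_powR; rewrite ?nnegrE//.
  by rewrite ge_max normr_ge0 ler_norm.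
have intN : mu.-integrable setT (EFin \o N).
  apply: le_integrableR intFp => // x; rewrite ger0_norm ?powR_ge0//.
  apply: ge0_ler_powR; rewrite ?nnegrE//.
  by rewrite ge_max normr_ge0 -normrN ler_norm.
have c0 : 0 < 2 `^ p :> R by rewrite powR_gt0.
have e' : 0 < e / (2 * 2 `^ p) by rewrite divr_gt0// mulr_gt0.
have [d1 d10 h1] := transl_cont_L1 intP e'.
have [d2 d20 h2] := transl_cont_L1 intN e'.
exists (Num.min d1 d2); first by rewrite lt_min d10.
move=> h dh.
have {}h1 : (\int[mu]_x `|P (x + h) - P x|%:E <= (e / (2 * 2 `^ p))%:E)%E.
  by apply: h1; apply: cube_le dh; rewrite ge_min lexx.
have {}h2 : (\int[mu]_x `|N (x + h) - N x|%:E <= (e / (2 * 2 `^ p))%:E)%E.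
  by apply: h2; apply: cube_le dh; rewrite ge_min lexx orbT.
have mPh : measurable_fun setT (fun x : E => `|P (x + h) - P x|%:E).
  by apply/measurable_EFinP; exact: mdiff.
have mNh : measurable_fun setT (fun x : E => `|N (x + h) - N x|%:E).
  by apply/measurable_EFinP; exact: mdiff.
rewrite /modulus.
apply: (@le_trans _ _ ((2 `^ p)%:E * (\int[mu]_x `|P (x + h) - P x|%:E +
    \int[mu]_x `|N (x + h) - N x|%:E))%E).
  rewrite -ge0_integralD// -ge0_integralZl//; last 2 first.
  - exact: emeasurable_funD.
  - by move=> x _; rewrite adde_ge0.
  apply: ge0_le_integral => //.
  - by apply/measurable_EFinP; apply: measurable_fun_powR; exact: mdiff.
  - by apply: measurable_funeM; exact: emeasurable_funD.
  - move=> x _; rewrite -EFinD -EFinM lee_fin.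
    have FE y : F y = Num.max (F y) 0 - Num.max (- F y) 0.
      by have [] := leP (F y) 0; have [] := leP (- F y) 0 => ? ?; lra.
    rewrite (FE (x + h)) (FE x).
    set a := Num.max (F (x + h)) 0; set b := Num.max (- F (x + h)) 0.
    set a' := Num.max (F x) 0; set b' := Num.max (- F x) 0.
    apply: (@le_trans _ _ ((`|a - a'| + `|b - b'|) `^ p)).
      apply: ge0_ler_powR; rewrite ?nnegrE ?addr_ge0//.
      by rewrite (_ : _ - _ = (a - a') - (b - b')) ?ler_normB//; ring.
    rewrite (le_trans (powRD_le _ _ _))// ler_wpM2l ?(ltW c0)// lerD//;
      by rewrite /P /N; apply: powR_dist_le => //; exact: max0.
have -> : e%:E = ((2 `^ p)%:E * ((e / (2 * 2 `^ p))%:E + (e / (2 * 2 `^ p))%:E))%E.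
  by rewrite -EFinD -EFinM; congr EFin; field; rewrite gt_eqF.
have c0E : (0 <= (2 `^ p)%:E :> \bar R)%E by rewrite lee_fin; exact: ltW.
have h12 := leeD h1 h2.
exact: (lee_wpmul2l c0E h12).
Qed.

End translation.

(** * Smooth functions and the fundamental lemma *)

Section derive_tools.
Context {R : realType}.

(** With its converse below, reduces directional derivatives to the real line, where the chain rule
    and the mean value theorem are at hand. *)
Lemma is_derive_line (V W : normedModType R) (F : V -> W) (x v : V) (df : W) :
  is_derive (0 : R) 1 (fun h : R => F (h *: v + x)) df -> is_derive x v F df.
Proof.
move=> [dF dFE]; split; first exact/derivable1P.
rewrite -dFE /derive; set g1 := fun h => h^-1 *: _; set g2 := fun h => h^-1 *: _.
suff -> : g1 = g2 by [].
by apply/funext => h; rewrite /g1 /g2/= addr0 scale0r add0r [_%:A]mulr1.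
Qed.

Lemma is_derive_line_inv (V W : normedModType R) (F : V -> W) (x v : V) (t : R) (df : W) :
  is_derive (t *: v + x) v F df -> is_derive t 1 (fun h : R => F (h *: v + x)) df.
Proof.
move=> [dF dFE].
have E : (fun h : R => h^-1 *: (((fun h : R => F (h *: v + x)) \o shift t) (h *: 1) - F (t *: v + x))) =
  (fun h => h^-1 *: ((F \o shift (t *: v + x)) (h *: v) - F (t *: v + x))).
  by apply/funext => h /=; rewrite [_%:A]mulr1 scalerDl addrA.
split; first by rewrite /derivable E.
by rewrite /derive E.
Qed.

Lemma is_derive_comp1 (f g : R -> R) (x df dg : R) :
  is_derive x 1 f df -> is_derive (f x) 1 g dg ->
  is_derive x 1 (g \o f) (dg * df).
Proof.
move=> [f1 fE] [g1 gE]; split; last first.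
  by rewrite -fE -gE -!derive1E derive1_comp.
apply/derivable1_diffP; apply: differentiable_comp; exact/derivable1_diffP.
Qed.

Lemma is_derive_continuous (f : R -> R) (x df : R) :
  is_derive x 1 f df -> {for x, continuous f}.
Proof. by move=> [/derivable1_diffP/differentiable_continuous]. Qed.

End derive_tools.

(* The functions x^-m exp(-1/x), extended by 0 to x <= 0: a family of flat
   functions whose span is closed under differentiation. *)
Section flat.
Context {R : realType}.

Definition flat (m : nat) (x : R) : R :=
  if 0 < x then x^-1 ^+ m * expR (- x^-1) else 0.

Lemma flat_ge0 m x : 0 <= flat m x.
Proof.
by rewrite /flat; case: ifPn => // x0; rewrite mulr_ge0 ?expR_ge0// exprn_ge0// invr_ge0 ltW.
Qed.

(** With [y = x^-1], one term of the exponential series gives [y^(m+1) <= (m+1)! * exp y]. This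
    linear decay is what the derivative at the origin requires. *)
Lemma flat_le m x : flat m x <= m.+1`!%:R * `|x|.
Proof.
rewrite /flat; case: ifPn => x0; last by rewrite mulr_ge0.
have y0 : 0 < x^-1 by rewrite invr_gt0.
have := @expR_ge1Dxn R x^-1 m (ltW y0); set y := x^-1 in y0 *.
have f0 : 0 < m.+1`!%:R :> R by rewrite ltr0n fact_gt0.
move=> h; have {}h : y ^+ m.+1 <= m.+1`!%:R * expR y.
  by rewrite -ler_pdivrMl// mulrC; lra.
rewrite expRN ler_pdivrMr ?expR_gt0// (gtr0_norm x0).
rewrite -[x]invrK -/y mulrAC ler_pdivlMr//.
by rewrite mulrC -exprS.
Qed.

Lemma flat0_le1 x : flat 0 x <= 1.
Proof.
rewrite /flat; case: ifPn => // x0; rewrite expr0 mul1r.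
by rewrite -expR0 ler_expR oppr_le0 invr_ge0 ltW.
Qed.

Lemma is_derive_flat m (x : R) :
  is_derive x 1 (flat m) (flat m.+2 x - m%:R * flat m.+1 x).
Proof.
have [x0|x0|->] := ltgtP x 0.
- have flat0 p : flat p x = 0 by rewrite /flat ltNge (ltW x0).
  rewrite !flat0 mulr0 subr0.
  apply: (@near_eq_is_derive _ _ _ (cst 0)).
  near=> y; rewrite /flat ltNge.
  by have /ltW -> : y < 0 by near: y; exact: lt_nbhsl.
- have xn0 : x != 0 by rewrite gt_eqF.
  suff : is_derive x 1 (fun y : R => y^-1 ^+ m * expR (- y^-1))
      (flat m.+2 x - m%:R * flat m.+1 x).
    apply: near_eq_is_derive; near=> y; rewrite /flat.
    by have -> : 0 < y by near: y; exact: lt_nbhsr.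
  have dV : is_derive x 1 (fun y : R => y^-1) (- x ^- 2).
    apply: is_derive_eq; first exact: is_deriveV.
    by rewrite /GRing.scale/= mulr1.
  have dE : is_derive x 1 (fun y : R => expR (- y^-1)) (expR (- x^-1) * x ^- 2).
    have -> : (fun y : R => expR (- y^-1)) = expR \o (fun y => - y^-1) by [].
    have h : is_derive x 1 (fun y : R => - y^-1) (x ^- 2).
      by have := @is_deriveN _ _ _ _ _ _ _ dV; rewrite opprK.
    exact: (is_derive_comp1 h (is_derive_expR _)).
  have dX : is_derive x 1 (fun y : R => y^-1 ^+ m) ((m%:R * x^-1 ^+ m.-1) *: - x ^- 2).
    have -> : (fun y : R => y^-1 ^+ m) = (fun y : R => y^-1) ^+ m.
      by apply/funext => y; rewrite fctE.
    exact: is_deriveX.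
  have dM := @is_deriveM _ _ _ _ _ _ _ _ dX dE.
  apply: is_derive_eq dM _.
  rewrite /flat x0 /GRing.scale/= -exprVn.
  case: m {dX} => [|m]; first by rewrite !mul0r !mulr0 subr0 addr0 expr0 mul1r mulrC.
  by rewrite -pred_Sn !exprS; ring.
(* At 0 the difference quotient is itself a member of the family, so its limit follows from
   [flat_le]. *)
- have E : (fun h => h^-1 *: ((flat m \o shift 0) (h *: 1) - flat m 0)) = flat m.+1.
    apply/funext => h; rewrite /= addr0 [_%:A]mulr1 {2}/flat ltxx subr0 /GRing.scale/=.
    by rewrite /flat; case: ifPn => h0; rewrite ?mulr0// mulrA exprS.
  have L : flat m.+1 h @[h --> (0:R)^'] --> (0 : R).
    apply/cvgr0Pnorm_le => e e0; near=> h.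
    rewrite (ger0_norm (flat_ge0 _ _)) (le_trans (flat_le _ _))//.
    rewrite -ler_pdivlMl ?ltr0n ?fact_gt0//.
    near: h; apply: dnbhs0_le.
    by rewrite mulr_gt0// invr_gt0 ltr0n fact_gt0.
  have -> : flat m.+2 0 - m%:R * flat m.+1 0 = 0 by rewrite /flat ltxx mulr0 subr0.
  split; first by rewrite /derivable E; apply/cvg_ex; exists 0.
  by rewrite /derive E; exact/cvg_lim.
Unshelve. all: by end_near. Qed.

Lemma continuous_flat m : continuous (flat m).
Proof. by move=> x; exact: (is_derive_continuous (is_derive_flat m x)). Qed.

End flat.

Section smooth_scalar.
Context {R : realType} (n : nat).
Local Notation E := 'rV[R]_n.
Implicit Types (F G : E -> R).

(** Partial derivatives are carried as witnesses, so sums, products and compositions with [flat] go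
    by induction on [k]; [smooth_scale] converts the result into the iterated partials of
    [smooth]. *)
Fixpoint Ck (k : nat) F : Prop := continuous F /\
  if k is k'.+1 then forall i : 'I_n, exists2 G : E -> R,
    forall x, is_derive x (delta_mx ord0 i) F (G x) & Ck k' G
  else True.

Lemma Ck_continuous k F : Ck k F -> continuous F.
Proof. by case: k => [|k] []. Qed.

Lemma CkS k F : Ck k.+1 F -> Ck k F.
Proof.
elim: k F => [|k IH] F; first by move=> [].
by move=> [cF dF]; split => // i; have [G dG /IH] := dF i; exists G.
Qed.

Lemma Ck_cst k (c : R) : Ck k (cst c).
Proof.
elim: k c => [|k IH] c; first by split => //; exact: cst_continuous.
split; first exact: cst_continuous.
move=> i; exists (cst 0) => // x; exact: is_derive_cst.
Qed.

Lemma Ck_add k F G : Ck k F -> Ck k G -> Ck k (fun x => F x + G x).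
Proof.
elim: k F G => [|k IH] F G [cF dF] [cG dG].
  by split => // x; exact: (cvgD (cF x) (cG x)).
split; first by move=> x; exact: (cvgD (cF x) (cG x)).
move=> i; have [F' dF' cF'] := dF i; have [G' dG' cG'] := dG i.
exists (fun x => F' x + G' x); last exact: IH.
by move=> x; exact: is_deriveD.
Qed.

Lemma Ck_mul k F G : Ck k F -> Ck k G -> Ck k (fun x => F x * G x).
Proof.
elim: k F G => [|k IH] F G kF kG; have [cF dF] := kF; have [cG dG] := kG.
  by split => // x; exact: (cvgM (cF x) (cG x)).
split; first by move=> x; exact: (cvgM (cF x) (cG x)).
move=> i; have [F' dF' cF'] := dF i; have [G' dG' cG'] := dG i.
exists (fun x => F x * G' x + G x * F' x).
  by move=> x; exact: is_deriveM.
by apply: Ck_add; apply: IH => //; exact: CkS.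
Qed.

Lemma Ck_prod k (s : seq 'I_n) (F : 'I_n -> E -> R) : (forall i, Ck k (F i)) ->
  Ck k (fun x => \prod_(i <- s) F i x).
Proof.
move=> kF; elim: s => [|i s IH].
  rewrite (_ : (fun _ => _) = cst 1); first exact: Ck_cst.
  by apply/funext => x; rewrite big_nil.
under eq_fun do rewrite big_cons.
exact: Ck_mul.
Qed.

Lemma is_derive_coord (i j : 'I_n) (c l : R) (x : E) :
  is_derive (0 : R) 1 (fun h : R => c + l * (h *: delta_mx ord0 j + x) ord0 i)
    (l * (i == j)%:R).
Proof.
have -> : (fun h : R => c + l * (h *: delta_mx ord0 j + x) ord0 i) =
    (cst (c + l * x ord0 i) + ((l * (i == j)%:R) \*: id)).
  apply/funext => h; rewrite !fctE !mxE eqxx /= /GRing.scale/=.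
  by ring.
apply: is_derive_eq.
by rewrite add0r /GRing.scale/= mulr1.
Qed.

Lemma Ck_flat k m (i : 'I_n) (c l : R) : Ck k (fun x => flat m (c + l * x ord0 i)).
Proof.
have cont p : continuous (fun x : E => flat p (c + l * x ord0 i)).
  move=> x; apply: (@continuous_comp _ _ _ (fun x : E => c + l * x ord0 i) (flat p)).
    have cx := @coord_continuous R 1 n ord0 i x.
    exact: (cvgD (@cst_continuous _ _ c x) (cvgM (@cst_continuous _ _ l x) cx)).
  exact: continuous_flat.
elim: k m => [|k IH] m; split => // j.
exists (fun x : E => (flat m.+2 (c + l * x ord0 i) +
    (- m%:R) * flat m.+1 (c + l * x ord0 i)) * (l * (i == j)%:R)).
  move=> x; apply: is_derive_line.
  have := is_derive_coord i j c l x.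
  set f := (fun h : R => c + _) => df.
  have -> : (fun h : R => flat m (c + l * (h *: delta_mx ord0 j + x) ord0 i)) = flat m \o f by [].
  apply: (is_derive_comp1 df).
  have -> : f 0 = c + l * x ord0 i by rewrite /f scale0r add0r.
  by rewrite mulNr; exact: is_derive_flat.
apply: (Ck_mul (G := cst _)); last exact: Ck_cst.
by apply: Ck_add => //; apply: (Ck_mul (F := cst _)) => //; exact: Ck_cst.
Qed.

Lemma smooth_scale F (v : E) : (forall k, Ck k F) -> smooth (fun x => F x *: v).
Proof.
move=> kF.
have iter s k H : Ck (size s + k) H -> exists2 G, Ck k G &
    iter_partial s (fun x => H x *: v) = (fun x => G x *: v).
  elim: s k => [|i s IH] k kH; first by exists H.
  have [G' kG' sG'] : exists2 G, Ck k.+1 G &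
      iter_partial s (fun x => H x *: v) = (fun x => G x *: v).
    by apply: IH; rewrite addnS.
  have [cG' /(_ i)[G dG kG]] := kG'.
  exists G => //=; rewrite sG'; apply/funext => x.
  have dv : derivable (fun x => G' x *: v) x (delta_mx ord0 i).
    apply/derivable_mxP => a b.
    rewrite (_ : (fun _ => _) = (fun x => G' x * cst (v a b) x)).
      by apply: derivableM; [case: (dG x)|exact: derivable_cst].
    by apply/funext => y; rewrite mxE.
  rewrite /partial derive_mx//; apply/matrixP => a b; rewrite !mxE.
  rewrite (_ : (fun _ => _) = (v a b \*: G')).
    by rewrite deriveZ; [case: (dG x) => _ ->; rewrite /GRing.scale/= mulrC|case: (dG x)].
  by apply/funext => y; rewrite mxE /GRing.scale/= mulrC.
(* One order beyond [size s] is reserved for the continuity and derivability of the last iterate. *)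
move=> s; have [G kG ->] := iter s 1%N F (kF _).
have [cG dG] := kG; split.
  by move=> x; exact: (cvgZ (cG x) (@cst_continuous _ _ v x)).
move=> i x; apply/derivable_mxP => a b.
rewrite (_ : (fun _ => _) = (fun x => G x * cst (v a b) x)).
  by have [G' dG' _] := dG i; apply: derivableM; [case: (dG' x)|exact: derivable_cst].
by apply/funext => y; rewrite mxE.
Qed.

End smooth_scalar.

(** * Smooth bumps supported in cubes *)

Section bump.
Context {R : realType} (n : nat).
Local Notation E := 'rV[R]_n.
Local Notation mu := (lebesgue_rV R n).
Implicit Types (l : R) (a x : E).

(** Tensor product of the classical profile [exp(-2 / (1 - t^2))] on [|t| < 1], taken at
    [t = l * (x_i - a_i)]: centred at [a], with half-side [l^-1]. *)
Definition bump l a x : R := \prod_(i < n)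
  (flat 0 (1 + l * (x ord0 i - a ord0 i)) * flat 0 (1 - l * (x ord0 i - a ord0 i))).

Lemma Ck_bump k l a : Ck k (bump l a).
Proof.
apply: Ck_prod => i.
apply: (@Ck_mul _ _ _ (fun x => flat 0 (1 + l * (x ord0 i - a ord0 i)))
  (fun x => flat 0 (1 - l * (x ord0 i - a ord0 i)))).
- rewrite (_ : (fun _ => _) = (fun x : E => flat 0 ((1 - l * a ord0 i) + l * x ord0 i))).
    exact: Ck_flat.
  by apply/funext => x; congr flat; ring.
- rewrite (_ : (fun _ => _) = (fun x : E => flat 0 ((1 + l * a ord0 i) + (- l) * x ord0 i))).
    exact: Ck_flat.
  by apply/funext => x; congr flat; ring.
Qed.

(** Evenness of the profile turns a mollification evaluated at [a] into a pairing with a test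
    function centred at [a]. *)
Lemma bump_sym l a x : bump l a x = bump l 0 (a - x).
Proof.
apply: eq_bigr => i _; rewrite !mxE subr0 mulrC.
by congr (flat _ _ * flat _ _); ring.
Qed.

Lemma bump_ge0 l a x : 0 <= bump l a x.
Proof. by apply: prodr_ge0 => i _; rewrite mulr_ge0 ?flat_ge0. Qed.

Lemma bump_le1 l a x : bump l a x <= 1.
Proof.
apply: prodr_ile1 => i _; rewrite mulr_ge0 ?flat_ge0//=.
by rewrite mulr_ile1 ?flat_ge0 ?flat0_le1.
Qed.

Lemma bump_support l x : 0 < l -> bump l 0 x != 0 -> cube l^-1 x.
Proof.
move=> l0 /prodf_neq0 h i; have := h i isT.
rewrite mulf_eq0 negb_or !mxE subr0 => /andP[]; rewrite /flat.
case: ifPn => [h1 _|_]; last by rewrite eqxx.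
case: ifPn => [h2 _|_]; last by rewrite eqxx.
by rewrite -div1r ler_pdivlMr// -[X in _ * X](gtr0_norm l0) -normrM ler_norml; apply/andP; split; lra.
Qed.

Lemma flat0_ge (y : R) : 1 / 2 <= y -> expR (- 2) <= flat 0 y.
Proof.
move=> hy; rewrite /flat; have y0 : 0 < y by lra.
rewrite y0 expr0 mul1r ler_expR lerN2 -[leRHS]invrK lef_pV2 ?posrE ?invr_gt0//.
by rewrite -div1r.
Qed.

Lemma bump_ge l x : 0 < l -> cube (l^-1 / 2) x ->
  (expR (- 2) * expR (- 2)) ^+ n <= bump l 0 x.
Proof.
move=> l0 hx; rewrite -[n in X in X <= _]card_ord -prodr_const.
apply: ler_prod => i _; rewrite mulr_ge0 ?expR_ge0//= !mxE subr0.
have := hx i; rewrite ler_norml => /andP[h1 h2].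
have l1 : l * (l^-1 / 2) = 1 / 2 by field; rewrite gt_eqF.
have h3 : l * x ord0 i <= 1 / 2 by rewrite -l1 ler_wpM2l// ltW.
have h4 : - (1 / 2) <= l * x ord0 i by rewrite -l1 -mulrN ler_wpM2l// ltW.
by apply: ler_pM; rewrite ?expR_ge0//; apply: flat0_ge; lra.
Qed.

Lemma measurable_bump l a : measurable_fun setT (bump l a).
Proof. by apply: continuous_measurable_rV; exact: Ck_continuous (Ck_bump 0 l a). Qed.

Lemma integrable_bump l : 0 < l -> mu.-integrable setT (EFin \o bump l 0).
Proof.
move=> l0; apply: (@le_integrableR _ _ _ _ _ (\1_(cube l^-1))).
- exact: measurable_bump.
- move=> x; rewrite ger0_norm ?bump_ge0//.
  have [->|/(bump_support l0) h] := eqVneq (bump l 0 x) 0; first by rewrite indicE.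
  by rewrite indicE mem_set// bump_le1.
- apply: ge0_integrableR => //.
    by apply: measurable_indic; exact: measurable_cube.
  by rewrite integral_indic ?setIT ?cube_lty//; exact: measurable_cube.
Qed.

Lemma cube_gt0 r : 0 < r -> (0 < mu (cube r : set E))%E.
Proof.
move=> r0; rewrite (_ : cube r = [set x : E | forall i, `[- r, r]%classic (x ord0 i)]).
  rewrite (@lebesgue_rV_box R n (fun=> `[(- r)%R, r]%classic))//.
  rewrite lebesgue_measure_itv/= lte_fin ifT; last lra.
  by rewrite -EFinB prodEFin lte_fin; apply: prodr_gt0 => i _; lra.
by apply/seteqP; split => x /= h i; have := h i; rewrite /= in_itv/= ler_norml.
Qed.

Lemma integral_bump_gt0 l : 0 < l -> 0 < \int[mu]_x bump l 0 x.
Proof.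
move=> l0; pose c : R := (expR (- 2) * expR (- 2)) ^+ n.
have c0 : 0 < c by rewrite exprn_gt0// mulr_gt0// expR_gt0.
have r0 : 0 < l^-1 / 2 by rewrite divr_gt0// invr_gt0.
rewrite -lte_fin EFin_Rintegral; last exact: integrable_bump.
apply: (@lt_le_trans _ _ (c%:E * mu (cube (l^-1 / 2) : set E))%E).
  by rewrite mule_gt0// ?lte_fin// cube_gt0.
rewrite -[X in (_ * mu X)%E](setIT (cube _)) -integral_indic//; last exact: measurable_cube.
have mi : measurable_fun setT (\1_(cube (l^-1 / 2)) : E -> R).
  by apply: measurable_indic; exact: measurable_cube.
rewrite -ge0_integralZl//; last 2 first.
- exact/measurable_EFinP.
- by rewrite lee_fin ltW.
apply: ge0_le_integral => //.
- by move=> x _; rewrite mule_ge0// lee_fin ltW.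
- by apply: measurable_funeM; exact/measurable_EFinP.
- by apply/measurable_EFinP; exact: measurable_bump.
- move=> x _; rewrite -EFinM lee_fin.
  have [xM|xM] := pselect (cube (l^-1 / 2) x).
    by rewrite indicE mem_set// mulr1; exact: bump_ge.
  by rewrite indicE memNset// mulr0 bump_ge0.
Qed.

Lemma compact_closure_cube (S : set E) M : S `<=` cube M -> compact (closure S).
Proof.
move=> SM; apply: (subclosed_compact _ (@compact_cube R n M)).
  exact: closed_closure.
by rewrite [X in _ `<=` X](closure_id _).1; [exact: closureS|exact: closed_cube].
Qed.

End bump.

(** * The fundamental lemma of the calculus of variations *)

Section fundamental_lemma.
Context {R : realType} (n : nat).
Local Notation E := 'rV[R]_n.
Local Notation mu := (lebesgue_rV R n).

Lemma measurable_modulus d (T : measurableType d) (v : T -> E) (p : R) (F : E -> R) :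
  measurable_fun setT v -> measurable_fun setT F ->
  measurable_fun setT (fun z => modulus p F (v z)).
Proof.
move=> mv mF.
apply: (measurable_fun_fubini_tonelli_G
  (fun xz : E * T => (`|F (xz.1 + v xz.2) - F xz.1| `^ p)%:E)).
  apply/measurable_EFinP; apply: measurable_fun_powR; apply: measurableT_comp => //.
  apply: measurable_funB; first exact: (measurable_shift2 mv mF).
  exact: (measurableT_comp mF measurable_fst).
by move=> xz; rewrite lee_fin powR_ge0.
Qed.

(** Truncate [u] to a cube and mollify. On a smaller cube the mollification is a pairing of [u] with
    a test function, hence 0, while by continuity of translations in [L^1] it is within [e] of the
    truncation. *)
Lemma fundamental_lemma (u : E -> R) : measurable_fun setT u ->
  (forall K, compact K -> (\int[mu]_(x in K) `|u x|%:E < +oo)%E) ->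
  (forall F, (forall k, Ck k F) -> compact (closure [set x | F x != 0]) ->
    \int[mu]_x (u x * F x) = 0) ->
  {ae mu, forall x, u x = 0}.
Proof.
move=> mu0 ulocint utest.
suff H (k : nat) : {ae mu, forall x, cube k%:R x -> u x = 0}.
  have /ae_foralln := H; apply: filterS => x hx.
  have [k _ xk] : (\bigcup_k cube k%:R) x by rewrite bigcup_cube.
  exact: hx xk.
suff : (\int[mu]_x `|(u x * \1_(cube k%:R) x)%:E| = 0)%E.
  move/ae_eq_integral_abs.
  have mc : measurable_fun setT (\1_(cube k%:R) : E -> R).
    by apply: measurable_indic; exact: measurable_cube.
  have m1 : measurable_fun setT (fun x => (u x * \1_(cube k%:R) x)%:E).
    by apply/measurable_EFinP; exact: measurable_funM.
  move=> /(_ measurableT m1); apply: filterS => x /= /(_ I)[].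
  by move=> h xk; move: h; rewrite indicE mem_set// mulr1.
apply/eqP; rewrite eq_le integral_ge0// andbT.
apply/lee_addgt0Pr => e e0; rewrite add0e.
pose M : R := k%:R + 1.
pose v (x : E) : R := u x * \1_(cube M) x.
have mC r : measurable_fun setT (\1_(cube r) : E -> R).
  by apply: measurable_indic; exact: measurable_cube.
have mv : measurable_fun setT v by exact: measurable_funM.
have intv : mu.-integrable setT (EFin \o v).
  apply/integrableP; split; first exact/measurable_EFinP.
  apply: le_lt_trans (ulocint _ (@compact_cube R n M)).
  rewrite [leRHS]integral_mkcond.
  apply: eqW; apply: eq_integral => x _.
  rewrite /v/= patchE indicE; case: (x \in cube M); first by rewrite mulr1.
  by rewrite mulr0 normr0.
have [d d0 hd] := transl_cont_L1 intv e0.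
(* The bound [d] serves the [L^1] estimate; the bound 1 keeps mollification on [cube k] within
   [cube M], where the truncation is invisible. *)
pose r := Num.min d 1; have r0 : 0 < r by rewrite lt_min d0/=.
pose l := r^-1; have l0 : 0 < l by rewrite invr_gt0.
pose c := \int[mu]_x bump l 0 x; have c0 : 0 < c by exact: integral_bump_gt0.
pose ka (z : E) : R := c^-1 * bump l 0 z.
have mka : measurable_fun setT ka by apply: measurable_funM => //; exact: measurable_bump.
have ka0 z : 0 <= ka z by rewrite mulr_ge0 ?bump_ge0// invr_ge0 ltW.
have ka1 : (\int[mu]_z (ka z)%:E = 1)%E.
  have intb := @integrable_bump R n l l0.
  have := @integralZl _ _ _ mu _ measurableT _ intb c^-1.
  rewrite -(EFin_Rintegral intb) -/c -EFinM mulVf ?gt_eqF// => <-.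
have kasupp z : ka z != 0 -> cube r z.
  by rewrite mulf_eq0 negb_or => /andP[_ /(bump_support l0)]; rewrite invrK.
have mopp := @measurable_rV_opp R n.
have := avg_sub_Lp mka mopp mv (lexx 1) ka0 ka1.
have -> : (\int[mu]_x (`|avg mu ka (fun z => - z) v x - v x| `^ 1)%:E =
    \int[mu]_x `|avg mu ka (fun z => - z) v x - v x|%:E)%E.
  by apply: eq_integral => x _; rewrite powRr1.
move=> hav.
have mavg := measurable_avg mu mka mopp mv.
apply: (@le_trans _ _ (\int[mu]_x `|avg mu ka (fun z => - z) v x - v x|%:E)%E).
  apply: ge0_le_integral => //.
  - by apply/measurable_EFinP; apply: measurableT_comp => //; exact: measurable_funM.
  - by apply/measurable_EFinP; apply: measurableT_comp => //; exact: measurable_funB.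
  - move=> x _ /=; rewrite lee_fin indicE.
    have [xk|xk] := pselect (cube k%:R x); last by rewrite memNset// mulr0 normr0.
    rewrite mem_set// mulr1.
    have vx : v x = u x.
      rewrite /v indicE mem_set ?mulr1//; apply: cube_le xk; by rewrite lerDl.
    suff -> : avg mu ka (fun z => - z) v x = 0 by rewrite sub0r normrN vx.
    transitivity (\int[mu]_z (ka z * u (x - z))).
      apply: eq_Rintegral => z _.
      have [->|/kasupp rz] := eqVneq (ka z) 0; first by rewrite !mul0r.
      congr (_ * _); rewrite /v indicE mem_set ?mulr1//.
      apply: cubeD => //; apply: cubeN; apply: cube_le rz.
      by rewrite ge_min lexx orbT.
    (* The substitution [z = x - y] is a reflection followed by a translation; measurability
       suffices for both. *)
    transitivity (\int[mu]_y (ka (x - y) * u y)).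
      have mG : measurable_fun setT (fun z => (ka z * u (x - z))%:E).
        apply/measurable_EFinP; apply: measurable_funM => //.
        apply: (measurableT_comp mu0).
        exact: (measurable_fun_rVD (@measurable_cst _ _ _ _ _ x) mopp).
      have mGo : measurable_fun setT (fun z : E => (ka (- z) * u (x - (- z)))%:E).
        exact: (measurableT_comp mG mopp).
      rewrite /Rintegral -(integral_rVN mG) -(integral_shift (- x) mGo).
      congr fine; apply: eq_integral => y _.
      by rewrite opprB opprB addrCA subrr addr0.
    transitivity (\int[mu]_y (c^-1 * (u y * bump l x y))).
      by apply: eq_Rintegral => y _; rewrite bump_sym /ka; ring.
    rewrite RintegralZl_total; last by apply: measurable_funM => //; exact: measurable_bump.
    rewrite utest ?mulr0// => [m|]; first exact: Ck_bump.
    apply: (@compact_closure_cube _ _ _ (k%:R + r)).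
    move=> y /=; rewrite bump_sym => /(bump_support l0); rewrite invrK => h.
    by rewrite -[y](subrK x) addrC -[_ - _]opprB; apply: cubeD => //; apply: cubeN; rewrite ?opprB//.
apply: (le_trans hav).
apply: (@le_trans _ _ (\int[mu]_z ((ka z)%:E * e%:E))%E).
  apply: ge0_le_integral => //.
  - by move=> z _; rewrite mule_ge0 ?lee_fin//; apply: integral_ge0 => x _; rewrite lee_fin powR_ge0.
  - apply: emeasurable_funM; first exact/measurable_EFinP.
    exact: measurable_modulus.
  - by apply: emeasurable_funM => //; exact/measurable_EFinP.
  - move=> z _; have [->|/kasupp rz] := eqVneq (ka z) 0; first by rewrite !mul0e.
    apply: lee_wpmul2l; first by rewrite lee_fin.
    have : cube d (- z) by apply: cubeN; apply: cube_le rz; rewrite ge_min lexx.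
    move=> /hd; apply: le_trans; rewrite /modulus.
    by apply: eqW; apply: eq_integral => x _; rewrite powRr1.
rewrite ge0_integralZr//; last 3 first.
- exact/measurable_EFinP.
- by move=> z _; rewrite lee_fin.
- by rewrite lee_fin ltW.
by rewrite ka1 mul1e.
Qed.

End fundamental_lemma.

(** * Gaussian integration by parts *)

Section compactly_supported.
Context {R : realType} (n : nat).
Local Notation E := 'rV[R]_n.
Local Notation mu := (lebesgue_rV R n).
Implicit Types (F psi : E -> R) (M B : R).

Lemma integrable_bounded_cube F B M : measurable_fun setT F ->
  (forall x, `|F x| <= B) -> (forall x, ~ cube M x -> F x = 0) ->
  mu.-integrable setT (EFin \o F).
Proof.
move=> mF FB F0; apply: (@le_integrableR _ _ _ _ _ (fun x => B * \1_(cube M) x)) => //.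
  move=> x; have [xM|xM] := pselect (cube M x).
    by rewrite indicE mem_set// mulr1.
  by rewrite F0// normr0 indicE memNset// mulr0.
have : mu.-integrable setT (EFin \o (\1_(cube M) : E -> R)).
  apply: ge0_integrableR => //.
    by apply: measurable_indic; exact: measurable_cube.
  by rewrite integral_indic ?setIT ?cube_lty//; exact: measurable_cube.
by move=> /(integrableZl measurableT B); apply: eq_integrable.
Qed.

Lemma continuous_cube_bounded F M : continuous F ->
  (forall x, ~ cube M x -> F x = 0) -> exists2 B, 0 <= B & forall x, `|F x| <= B.
Proof.
move=> cF F0.
have : compact (F @` cube M).
  apply: continuous_compact; last exact: compact_cube.
  exact: continuous_subspaceT.
move=> /compact_bounded[B [_ hB]]; exists (`|B| + 1); first by rewrite addr_ge0.
move=> x; have [xM|xM] := pselect (cube M x); last by rewrite F0// normr0 addr_ge0.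
by apply: (hB (`|B| + 1)); [rewrite ltr_pwDr// ler_norm|exists x].
Qed.

Lemma line_lipschitz (e : E) F (D : E -> R) L :
  (forall x, is_derive x e F (D x)) -> (forall x, `|D x| <= L) ->
  forall x t, `|F (x + t *: e) - F x| <= L * `|t|.
Proof.
move=> dF DL.
have pos (x : E) (t : R) : 0 < t -> `|F (x + t *: e) - F x| <= L * t.
  move=> t0; have dg (s : R) : is_derive s 1 (fun h : R => F (h *: e + x)) (D (s *: e + x)).
    exact: is_derive_line_inv.
  have [c _] := @MVT R (fun h : R => F (h *: e + x)) (fun s => D (s *: e + x)) 0 t t0
    (fun s _ => dg s)
    (continuous_subspaceT (fun s => is_derive_continuous (dg s))).
  rewrite scale0r add0r subr0 (addrC (t *: e)) => ->.
  by rewrite normrM (gtr0_norm t0) ler_wpM2r// ltW.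
move=> x t; have [t0|t0|->] := ltgtP t 0.
- have := pos (x + t *: e) (- t); rewrite oppr_gt0 => /(_ t0).
  by rewrite scaleNr addrK distrC (ltr0_norm t0).
- by rewrite (gtr0_norm t0); exact: pos.
- by rewrite scale0r addr0 subrr normr0 mulr0.
Qed.

(** Translation invariance makes every difference quotient integrate to 0, and dominated convergence
    passes to the derivative; no coordinate has to be integrated separately. *)
Lemma integral_derive0 (i : 'I_n) F (D : E -> R) L M : continuous F ->
  measurable_fun setT D ->
  (forall x, is_derive x (delta_mx ord0 i) F (D x)) -> (forall x, `|D x| <= L) ->
  (forall x, ~ cube M x -> F x = 0) ->
  \int[mu]_x D x = 0.
Proof.
move=> cF mD dF DL F0; set e := delta_mx ord0 i : E.
have lip := line_lipschitz dF DL.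
have mF := continuous_measurable_rV cF.
have [B B0 FB] := continuous_cube_bounded cF F0.
have intF := integrable_bounded_cube mF FB F0.
have e1 t : `|t| <= 1 -> cube 1 (t *: e).
  move=> t1 j; rewrite !mxE/= normrM (le_trans _ t1)// ler_piMr// normr_nat.
  by rewrite lern1 leq_b1.
(* Steps of length at most 1 keep all difference quotients supported in [cube (M + 1)], where the
   Lipschitz constant dominates them. *)
pose tau (k : nat) : R := k.+1%:R^-1.
have tau0 k : 0 < tau k by rewrite invr_gt0.
have tau1 k : tau k <= 1 by rewrite invf_le1// ler1n.
pose f k (x : E) : R := (tau k)^-1 * (F (x + tau k *: e) - F x).
have msh k : measurable_fun setT (fun x : E => F (x + tau k *: e)).
  by apply: (measurableT_comp mF); exact: measurable_rV_shift.
have mf k : measurable_fun setT (f k).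
  by apply: measurable_funM => //; exact: measurable_funB.
have intsh k : mu.-integrable setT (EFin \o (fun x : E => F (x + tau k *: e))).
  apply/integrableP; split; first exact/measurable_EFinP.
  have mFE : measurable_fun setT (fun x : E => `|F x|%:E).
    by apply/measurable_EFinP; exact: measurableT_comp.
  rewrite (ge0_integral_shift (tau k *: e) mFE)//.
  by case/integrableP: intF.
have intf0 k : (\int[mu]_x (f k x)%:E = 0)%E.
  under eq_integral do rewrite EFinM.
  rewrite integralZl//; last by have := integrableB measurableT (intsh k) intF; apply: eq_integrable.
  have mFE : measurable_fun setT (EFin \o F) by exact/measurable_EFinP.
  rewrite integralB_EFin// (integral_shift (tau k *: e) mFE).
  by rewrite subee ?mule0// integrable_fin_num.
have [] := @dominated_convergence _ _ _ mu _ measurableT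
    (fun k => EFin \o f k) (EFin \o D) (EFin \o (fun x => L * \1_(cube (M + 1)) x)).
- by move=> k; exact/measurable_EFinP.
- exact/measurable_EFinP.
- apply: aeW => x _; apply/cvg_EFin; first exact: nearW.
  have [/cvg_ex[/= l hl] Dl] := dF x.
  have Dx : h^-1 *: (F (h *: e + x) - F x) @[h --> (0 : R)^'] --> D x.
    by rewrite -Dl /derive; apply/cvg_ex; exists l.
  have Dtau : (tau k)^-1 *: (F (tau k *: e + x) - F x) @[k --> \oo] --> D x.
    apply: ((cvgr_dnbhsP _ _ _).1 Dx tau _); split => [k|]; first by rewrite gt_eqF.
    exact: cvg_harmonic.
  rewrite (_ : _ \o _ = (fun k => (tau k)^-1 *: (F (tau k *: e + x) - F x)))//.
  by apply/funext => k; rewrite /f/= (addrC x).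
- have := @integrable_bounded_cube (fun x => L * \1_(cube (M + 1)) x) L (M + 1).
  apply.
  + by apply: measurable_funM => //; apply: measurable_indic; exact: measurable_cube.
  + move=> x; rewrite indicE; have L0 := le_trans (normr_ge0 _) (DL 0).
    by case: (_ \in _); rewrite ?mulr1 ?mulr0 ?normr0 ?ger0_norm.
  + by move=> x xM; rewrite indicE memNset// mulr0.
- apply: aeW => x k _; rewrite /= lee_fin indicE.
  have [xM|xM] := pselect (cube (M + 1) x).
    rewrite mem_set// mulr1 normrM gtr0_norm ?invr_gt0// ler_pdivrMl//.
    by rewrite mulrC -{2}(gtr0_norm (tau0 k)).
  rewrite memNset// mulr0 /f !F0 ?subrr ?mulr0 ?normr0//.
    by apply: contra_not xM; apply: cube_le; rewrite lerDl.
  apply: contra_not xM => xM; rewrite -(addrK (tau k *: e) x).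
  by apply: cubeD => //; apply: cubeN; apply: e1; rewrite gtr0_norm.
move=> _ _ hcvg.
have : (\int[mu]_x (EFin \o D) x = 0)%E.
  apply/esym/(cvg_unique _ _ hcvg) => //=.
  by under eq_fun do rewrite intf0; exact: cvg_cst.
by rewrite /Rintegral => ->.
Qed.

End compactly_supported.
Section gaussian.
Context {R : realType} (n : nat).
Local Notation E := 'rV[R]_n.
Local Notation mu := (lebesgue_rV R n).

Definition gauss (k : E) : R := expR (- dotv k k).

Lemma dotv_ge0 (k : E) : 0 <= dotv k k.
Proof. by apply: sumr_ge0 => i _; rewrite -expr2 sqr_ge0. Qed.

Lemma gauss_ge0 (k : E) : 0 <= gauss k. Proof. exact: expR_ge0. Qed.

Lemma gauss_le1 (k : E) : gauss k <= 1.
Proof. by rewrite -expR0 ler_expR oppr_le0 dotv_ge0. Qed.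

Lemma gaussN (k : E) : gauss (- k) = gauss k.
Proof. by congr (expR (- _)); apply: eq_bigr => i _; rewrite !mxE mulrNN. Qed.

Lemma continuous_dotvv : continuous (fun k : E => dotv k k).
Proof.
rewrite /dotv; elim: (index_enum _) => [|i s IH].
  rewrite (_ : (fun _ => _) = cst 0); first exact: cst_continuous.
  by apply/funext => x; rewrite big_nil.
under eq_fun do rewrite big_cons.
move=> x; have cx := @coord_continuous R 1 n ord0 i x.
exact: (cvgD (cvgM cx cx) (IH x)).
Qed.

Lemma continuous_gauss : continuous gauss.
Proof.
move=> x; apply: (@continuous_comp _ _ _ (fun k : E => - dotv k k) expR).
  exact: (cvgN (@continuous_dotvv x)).
exact: continuous_expR.
Qed.

Lemma measurable_gauss : measurable_fun setT gauss.
Proof. by apply: continuous_measurable_rV; exact: continuous_gauss. Qed.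

Lemma is_derive_gauss (i : 'I_n) (x : E) :
  is_derive x (delta_mx ord0 i) gauss (- 2 * x ord0 i * gauss x).
Proof.
apply: is_derive_line.
pose g (h : R) : R := - (dotv x x + 2 * x ord0 i * h + h ^+ 2).
rewrite (_ : (fun h : R => gauss _) = expR \o g); last first.
  apply/funext => h; congr expR; congr (- _).
  rewrite /dotv (bigD1 i)//= [in RHS](bigD1 i)//= !mxE !eqxx /=.
  have -> : \sum_(j < n | j != i) (h *: delta_mx ord0 i + x) ord0 j * (h *: delta_mx ord0 i + x) ord0 j =
      \sum_(j < n | j != i) x ord0 j * x ord0 j.
    by apply: eq_bigr => j ji; rewrite !mxE (negbTE ji) andbF mulr0 add0r.
  by ring.
have dg : is_derive (0 : R) 1 g (- (2 * x ord0 i)).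
  rewrite (_ : g = - ((cst (dotv x x) + ((2 * x ord0 i) \*: id)) + id ^+ 2)); last first.
    by apply/funext => h; rewrite !fctE.
  apply: is_derive_eq.
  by rewrite /GRing.scale/= !mulr1 add0r expr1 mulr0 addr0.
have := is_derive_comp1 dg (is_derive_expR (g 0)).
rewrite /g mulr0 expr0n !addr0 -/(gauss x).
by move=> h; apply: is_derive_eq h _; ring.
Qed.

End gaussian.

(** * Components of test fields *)

Section test_fields.
Context {R : realType} (n : nat).
Local Notation E := 'rV[R]_n.
Local Notation mu := (lebesgue_rV R n).

(** First-order information is all that the kernel computation takes from a component of a test
    field; the partials are named because they occur in the divergence. *)
Definition C1c (psi : E -> R) (dpsi : 'I_n -> E -> R) : Prop :=
  [/\ continuous psi, forall j, continuous (dpsi j),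
    forall j x, is_derive x (delta_mx ord0 j) psi (dpsi j x) &
    exists M, forall x, ~ cube M x -> psi x = 0 /\ forall j, dpsi j x = 0].

Lemma test_field_C1c (phi : E -> E) (i : 'I_n) : test_field phi ->
  C1c (fun x => phi x ord0 i) (fun j x => partial j phi x ord0 i).
Proof.
move=> [sphi cphi].
have [c0 d0] := sphi [::].
have dphi (j : 'I_n) x : is_derive x (delta_mx ord0 j) (fun x => phi x ord0 i) (partial j phi x ord0 i).
  have dj : derivable phi x (delta_mx ord0 j) by exact: d0.
  rewrite /partial derive_mx// mxE.
  by apply: DeriveDef => //; exact: (derivable_mxP phi x _).1 dj ord0 i.
split => //.
- move=> x; apply: (@continuous_comp _ _ _ phi (fun v : E => v ord0 i)).
    exact: c0.
  exact: coord_continuous.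
- move=> j x; apply: (@continuous_comp _ _ _ (partial j phi) (fun v : E => v ord0 i)).
    by have [c1 _] := sphi [:: j]; exact: c1.
  exact: coord_continuous.
- have [M _ hM] := compact_sub_cube cphi.
  have phi0 x : ~ cube M x -> phi x = 0.
    move=> xM; apply/eqP/negPn/negP => px; apply: xM; apply: hM.
    exact: subset_closure.
  exists M => x xM; split; first by rewrite phi0// mxE.
  move=> j; have : is_derive x (delta_mx ord0 j) (fun x => phi x ord0 i) 0.
    apply: (@near_eq_is_derive _ _ _ (cst 0 : E -> R)).
    have : nbhs x (~` cube M).
      by apply: open_nbhs_nbhs; split => //; apply: closed_openC; exact: closed_cube.
    by apply: filterS => y yM; rewrite phi0// mxE.
  by move=> h; have [_ <-] := dphi j x; have [_ ->] := h.
Qed.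

Lemma C1c_bounded psi dpsi : C1c psi dpsi -> exists2 B, 0 <= B &
  [/\ forall x, `|psi x| <= B, forall j x, `|dpsi j x| <= B &
    forall x h, `|psi (x + h) - psi x| <= B * \sum_j `|h ord0 j|].
Proof.
move=> [cpsi cdpsi dp [M hM]].
have [B0 B00 hB0] := continuous_cube_bounded cpsi (fun x xM => (hM x xM).1).
have hBj j : exists B, 0 <= B /\ forall x, `|dpsi j x| <= B.
  have [B ? ?] := continuous_cube_bounded (cdpsi j) (fun x xM => (hM x xM).2 j).
  by exists B.
have [Bj HBj] := choice hBj.
pose B := B0 + \sum_j Bj j.
have sum0 : 0 <= \sum_j Bj j by apply: sumr_ge0 => j _; have [] := HBj j.
have BjB j : Bj j <= B.
  rewrite /B (bigD1 j)//= addrCA lerDl addr_ge0// sumr_ge0// => k _.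
  by have [] := HBj k.
have dB j x : `|dpsi j x| <= B by have [_ /(_ x)/le_trans] := HBj j; apply.
exists B; first by rewrite addr_ge0.
split => //; first by move=> x; rewrite (le_trans (hB0 x))// lerDl.
move=> x h; have hE : h = \sum_j h ord0 j *: delta_mx ord0 j by exact: row_sum_delta.
(* Moving one coordinate at a time keeps each increment on a line parallel to an axis, where
   [line_lipschitz] applies. *)
rewrite [in X in psi (_ + X)]hE.
elim: (index_enum _) x => [|j s IH] x.
  by rewrite !big_nil addr0 subrr normr0 mulr0.
rewrite !big_cons addrA.
set y := \sum_(_ <- s) _ *: _; set z := x + _.
rewrite (_ : _ - _ = (psi (z + y) - psi z) + (psi z - psi x)); last by ring.
rewrite (le_trans (ler_normD _ _))// mulrDr addrC lerD//.
exact: (line_lipschitz (dp j) (dB j)).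
Qed.

Lemma C1c_integrable psi dpsi : C1c psi dpsi ->
  mu.-integrable setT (EFin \o psi) /\ forall j, mu.-integrable setT (EFin \o dpsi j).
Proof.
move=> C1; have [B _ [pB dB _]] := C1c_bounded C1.
have [cpsi cdpsi _ [M hM]] := C1; split.
  apply: (integrable_bounded_cube (continuous_measurable_rV cpsi) pB (M := M)).
  by move=> x /hM[].
move=> j; apply: (integrable_bounded_cube (continuous_measurable_rV (cdpsi j)) (dB j) (M := M)).
by move=> x /hM[].
Qed.

(** The derivative of [gauss k * psi (x + r *: k)] has integral 0; the Gaussian contributes
    [-2 * k_i] and the chain rule [r], whence the factor [r / 2]. *)
Lemma gauss_by_parts psi dpsi (i : 'I_n) (x : E) (r : R) : C1c psi dpsi -> 0 < r ->
  \int[mu]_k (gauss k * k ord0 i * psi (x + r *: k)) =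
  r / 2 * \int[mu]_k (gauss k * dpsi i (x + r *: k)).
Proof.
move=> C1 r0; have [B B0 [pB dB _]] := C1c_bounded C1.
have [cpsi cdpsi dp [M hM]] := C1.
have [N _ xN] : (\bigcup_k cube k%:R) x by rewrite bigcup_cube.
(* Since [N] bounds the coordinates of [x], a point [x + r *: k] of the support cube forces [r *: k]
   into the cube of half-side [M + N]. *)
pose M' := (M + N%:R) / r.
have out k : ~ cube M' k -> ~ cube M (x + r *: k).
  apply: contra_not => h.
  have : cube (M + N%:R) (r *: k).
    by rewrite -(addKr x (r *: k)) addrC; apply: cubeD => //; exact: cubeN.
  move=> h' j; have := h' j; rewrite mxE normrM (gtr0_norm r0).
  by rewrite /M' ler_pdivlMr// mulrC.
clearbody M'.
have caff : continuous (fun k : E => x + r *: k).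
  move=> k; apply: (cvgD (@cst_continuous _ _ x k)).
  exact: (cvgZ (@cst_continuous _ _ r k) cvg_id).
have cpsi' : continuous (fun k : E => psi (x + r *: k)).
  by move=> k; apply: (@continuous_comp _ _ _ (fun k : E => x + r *: k) psi); [exact: caff|exact: cpsi].
have cdpsi' : continuous (fun k : E => dpsi i (x + r *: k)).
  by move=> k; apply: (@continuous_comp _ _ _ (fun k : E => x + r *: k) (dpsi i)); [exact: caff|exact: cdpsi].
have mG := @measurable_gauss R n.
have mp := continuous_measurable_rV cpsi'.
have md := continuous_measurable_rV cdpsi'.
have G1 (k : E) : `|gauss k| <= 1 by rewrite (ger0_norm (@gauss_ge0 R n k)) gauss_le1.
pose F1 (k : E) : R := gauss k * k ord0 i * psi (x + r *: k).
pose F2 (k : E) : R := gauss k * dpsi i (x + r *: k).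
have mF1 : measurable_fun setT F1.
  by apply: measurable_funM => //; apply: measurable_funM => //; exact: measurable_rV_coord.
have mF2 : measurable_fun setT F2 by exact: measurable_funM.
have F10 k : ~ cube M' k -> F1 k = 0 by move=> /out/hM[h _]; rewrite /F1 h mulr0.
have F20 k : ~ cube M' k -> F2 k = 0 by move=> /out/hM[_ h]; rewrite /F2 h mulr0.
have F1B k : `|F1 k| <= `|M'| * B.
  have [kM|/F10 ->] := pselect (cube M' k); last by rewrite normr0 mulr_ge0.
  rewrite !normrM ler_pM// -[leRHS]mul1r ler_pM//.
  by rewrite (le_trans (kM i))// ler_norm.
have F2B k : `|F2 k| <= B by rewrite normrM -[leRHS]mul1r ler_pM.
have i1 := integrable_bounded_cube mF1 F1B F10.
have i2 := integrable_bounded_cube mF2 F2B F20.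
have : \int[mu]_k (- 2 * F1 k + r * F2 k) = 0.
  apply: (@integral_derive0 R n i (fun k => gauss k * psi (x + r *: k)) _
    (2 * (`|M'| * B) + r * B) M').
  - by move=> k; exact: (cvgM (@continuous_gauss R n k) (cpsi' k)).
  - by apply: measurable_funD; exact: measurable_funM.
  - move=> k; have dG := is_derive_gauss i k.
    have dP : is_derive k (delta_mx ord0 i) (fun k : E => psi (x + r *: k)) (r * dpsi i (x + r *: k)).
      apply: is_derive_line.
      have l1 : is_derive (0 : R) 1 (fun h : R => r * h) r.
        have := @is_deriveZ _ _ _ id r (0 : R) 1 1 (is_derive_id _ _).
        by rewrite /GRing.scale/= mulr1.
      have l2 : is_derive (r * 0) 1 (fun h : R => psi (h *: delta_mx ord0 i + (x + r *: k))) (dpsi i (x + r *: k)).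
        by apply: is_derive_line_inv; rewrite mulr0 scale0r add0r.
      have := is_derive_comp1 l1 l2; rewrite mulrC.
      rewrite (_ : _ \o _ = (fun h : R => psi (x + r *: (h *: delta_mx ord0 i + k))))//.
      by apply/funext => h /=; congr psi; rewrite scalerDr scalerA addrCA.
    have := @is_deriveM _ _ _ _ _ _ _ _ dG dP.
    by move=> h; apply: (is_derive_eq h); rewrite /F1 /F2 /GRing.scale/=; ring.
  - move=> k; rewrite (le_trans (ler_normD _ _))// (normrM (- 2)) (normrM r) normrN normr_nat (gtr0_norm r0).
    by rewrite lerD// ler_wpM2l// ltW.
  - by move=> k /out/hM[h _]; rewrite h mulr0.
have j1 := @integrableZl _ _ _ mu _ measurableT (- 2) _ i1.
have j2 := @integrableZl _ _ _ mu _ measurableT r _ i2.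
rewrite RintegralD// !RintegralZl// /F1 /F2 => h; lra.
Qed.

(** Allows the weak gradient identity of [f] to be applied to every translate of [phi] under an
    average. *)
Lemma test_field_shift (phi : E -> E) (h : E) : test_field phi ->
  test_field (fun x => phi (x + h)) /\
  (forall i x, partial i (fun x => phi (x + h)) x = partial i phi (x + h)).
Proof.
move=> [sphi cphi].
have pshift (f : E -> E) i : partial i (fun x => f (x + h)) = (fun x => partial i f (x + h)).
  apply/funext => x; rewrite /partial /derive.
  by under eq_fun do rewrite /= -addrA.
have iter s : iter_partial s (fun x => phi (x + h)) = (fun x => iter_partial s phi (x + h)).
  by elim: s => //= i s ->; exact: pshift.
split; last by move=> i x; rewrite pshift.
split.
  move=> s; rewrite iter; have [cs ds] := sphi s; split.
    move=> x; apply: (@continuous_comp _ _ _ (fun x : E => x + h) (iter_partial s phi)).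
      exact: (cvgD cvg_id (@cst_continuous _ _ h x)).
    exact: cs.
  move=> i x; have := ds i (x + h); rewrite /derivable.
  by under [in X in _ -> X]eq_fun do rewrite /= -addrA.
have [M _ hM] := compact_sub_cube cphi.
have [N _ hN] : (\bigcup_k cube k%:R) h by rewrite bigcup_cube.
apply: (@compact_closure_cube _ _ _ (M + N%:R)) => x /= px.
rewrite -(addrK h x); apply: cubeD; last exact: cubeN.
by apply: hM; exact: subset_closure.
Qed.

End test_fields.

(** * Gamma integrals *)

Section power_integrals.
Context {R : realType}.
Local Notation leb := (@lebesgue_measure R).
Implicit Types (a b e s t x y : R) (f g : R -> R).

Lemma ge_bound_natr x k : 0 <= x -> (Num.bound x <= k)%N -> x <= k%:R.
Proof.
by move=> x0 xk; rewrite (le_trans (ltW (archi_boundP x0)))// ler_nat.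
Qed.

Lemma continuous_powR_pos a x : 0 < x -> {for x, continuous (@powR R ^~ a)}.
Proof. by move=> x0; exact: (is_derive_continuous (is_derive1_powR a x0)). Qed.

Lemma integral_powR x y a : 0 < x -> x < y -> a != 0 ->
  (\int[leb]_(t in `[x, y]) (t `^ (a - 1))%:E = ((y `^ a - x `^ a) / a)%:E)%E.
Proof.
move=> x0 xy a0.
pose F t := a^-1 * t `^ a.
have dF t : 0 < t -> is_derive t 1 F (t `^ (a - 1)).
  move=> t0; have := @is_deriveZ _ _ _ _ a^-1 t 1 _ (is_derive1_powR a t0).
  by rewrite /GRing.scale/= mulKf.
have cF t : 0 < t -> F z @[z --> t] --> F t.
  by move=> t0; exact: (is_derive_continuous (dF t t0)).
rewrite (@continuous_FTC2 _ _ F)//.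
- by rewrite -EFinB; congr EFin; rewrite /F; ring.
- apply: continuous_in_subspaceT => t; rewrite inE/= in_itv/= => /andP[xt _].
  by apply: continuous_powR_pos; exact: lt_le_trans xt.
- split.
  + by move=> t; rewrite in_itv/= => /andP[xt _]; have [] := dF t (lt_trans x0 xt).
  + by apply: cvg_at_right_filter; exact: cF.
  + by apply: cvg_at_left_filter; apply: cF; exact: lt_trans xy.
- move=> t; rewrite in_itv/= => /andP[xt _].
  by rewrite derive1E; have [_ ->] := dF t (lt_trans x0 xt).
Qed.

Lemma measurable_powR_itv a (D : set R) : measurable_fun D (@powR R ^~ a).
Proof. by apply: measurable_funTS; exact: measurable_powR. Qed.

(** Carries bounds from compact intervals, where the fundamental theorem of calculus is available,
    to improper integrals. *)
Lemma exhaustion_le (F : (set R)^nat) f (C : \bar R) :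
  nondecreasing_seq F -> (forall k, measurable (F k)) -> measurable_fun setT f ->
  (forall t, (\bigcup_k F k) t -> 0 <= f t) ->
  (forall k, (\int[leb]_(t in F k) (f t)%:E <= C)%E) ->
  (\int[leb]_(t in \bigcup_k F k) (f t)%:E <= C)%E.
Proof.
move=> ndF mF mf f0 h.
have hc : (\int[leb]_(t in F k) (f t)%:E)%E @[k --> \oo] -->
    (\int[leb]_(t in \bigcup_k F k) (f t)%:E)%E.
  apply: ge0_nondecreasing_set_cvg_integral => //.
  - by move=> k; apply: measurable_funTS; exact/measurable_EFinP.
  - by move=> k t Fkt; rewrite lee_fin f0//; exists k.
rewrite -(cvg_lim _ hc)//; apply: lime_le; first by apply/cvg_ex; eexists; exact: hc.
exact: nearW.
Qed.

Lemma integral_powR01 a : 0 < a ->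
  (\int[leb]_(t in `]0%R, 1%R]) (t `^ (a - 1))%:E <= (a^-1)%:E)%E.
Proof.
move=> a0.
(* Starting at 2 keeps every interval nondegenerate, as [integral_powR] demands. *)
have -> : `]0, 1]%classic = \bigcup_k `[k.+2%:R^-1, 1]%classic :> set R.
  apply/seteqP; split => t.
    rewrite /= in_itv/= => /andP[t0 t1]; exists (Num.bound t^-1) => //=.
    rewrite in_itv/= t1 andbT -[leRHS]invrK lef_pV2 ?posrE ?invr_gt0//.
    by apply: ge_bound_natr; [rewrite invr_ge0 ltW|lia].
  by move=> [k _]; rewrite /= !in_itv/= => /andP[h ->]; rewrite andbT (lt_le_trans _ h)// invr_gt0.
apply: exhaustion_le => //.
- move=> k l kl; apply/subsetPset => t /=; rewrite !in_itv/= => /andP[h ->].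
  by rewrite andbT (le_trans _ h)// lef_pV2 ?posrE// ler_nat; lia.
- by move=> t _; exact: powR_ge0.
- move=> k; rewrite integral_powR ?gt_eqF ?invr_gt0//; last first.
    by rewrite invf_lt1// ltr1n.
  by rewrite lee_fin powR1 mulrBl mul1r gerBl mulr_ge0 ?powR_ge0// invr_ge0 ltW.
Qed.

Lemma integral_powR1y b : 0 < b ->
  (\int[leb]_(t in `]1%R, +oo[) (t `^ (- b - 1))%:E <= (b^-1)%:E)%E.
Proof.
move=> b0.
apply: (@le_trans _ _ (\int[leb]_(t in `[1%R, +oo[) (t `^ (- b - 1))%:E)%E).
  apply: ge0_subset_integral => //.
  - by apply/measurable_EFinP; exact: measurable_powR_itv.
  - by move=> t _; rewrite lee_fin powR_ge0.
  - by move=> t /=; rewrite !in_itv/= !andbT; exact: ltW.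
have -> : `[1%R, +oo[%classic = \bigcup_k `[1%R, k.+2%:R]%classic :> set R.
  apply/seteqP; split => t.
    rewrite /= in_itv/= andbT => t1; exists (Num.bound t) => //=.
    rewrite in_itv/= t1/=.
    by apply: ge_bound_natr; [lra|lia].
  by move=> [k _]; rewrite /= !in_itv/= => /andP[-> _].
apply: exhaustion_le => //.
- move=> k l kl; apply/subsetPset => t /=; rewrite !in_itv/= => /andP[-> h]/=.
  by rewrite (le_trans h)// ler_nat; lia.
- by move=> t _; exact: powR_ge0.
- move=> k; rewrite integral_powR// ?oppr_eq0 ?gt_eqF// ?ltr1n//.
  by rewrite lee_fin powR1 invrN mulrN -mulNr opprB mulrBl mul1r gerBl mulr_ge0 ?powR_ge0// invr_ge0 ltW.
Qed.

Lemma integral_split01_le f g1 g2 : measurable_fun setT f ->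
  measurable_fun setT g1 -> measurable_fun setT g2 ->
  (forall t, 0 < t -> 0 <= f t) ->
  (forall t, 0 < t <= 1 -> f t <= g1 t) -> (forall t, 1 < t -> f t <= g2 t) ->
  (\int[leb]_(t in `]0%R, +oo[) (f t)%:E <=
   \int[leb]_(t in `]0%R, 1%R]) (g1 t)%:E + \int[leb]_(t in `]1%R, +oo[) (g2 t)%:E)%E.
Proof.
move=> mf m1 m2 f0 f1 f2.
have E : `]0, +oo[%classic = `]0, 1]%classic `|` `]1, +oo[%classic :> set R.
  apply/seteqP; split => t /=; rewrite !in_itv/= ?andbT.
    by move=> t0; have [t1|t1] := leP t 1; [left; rewrite t0|right].
  by move=> [/andP[]//|]; exact: lt_trans.
have mE (h : R -> R) D : measurable_fun setT h -> measurable_fun D (EFin \o h).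
  by move=> mh; apply: measurable_funTS; exact/measurable_EFinP.
rewrite E ge0_integral_setU//=; last 3 first.
- exact: mE.
- by move=> t; rewrite !in_itv/= andbT lee_fin => -[/andP[t0 _]|t1]; rewrite f0// (lt_trans _ t1).
- apply/disj_setPS => t [/=]; rewrite !in_itv/= andbT => /andP[_ t1].
  by rewrite ltNge t1.
apply: leeD; apply: ge0_le_integral => //; try exact: mE.
- by move=> t; rewrite /= in_itv/= => /andP[t0 _]; rewrite lee_fin; exact: f0.
- by move=> t; rewrite /= in_itv/= andbT => t1; rewrite lee_fin f0// (lt_trans _ t1).
- by move=> t; rewrite /= in_itv/= andbT lee_fin; exact: f2.
Qed.

End power_integrals.

Section gamma.
Context {R : realType}.
Local Notation leb := (@lebesgue_measure R).
Implicit Types (a b e s t x y q : R).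

Definition gamma_fun a t := t `^ (a - 1) * expR (- t).

Lemma measurable_gamma_fun a : measurable_fun setT (gamma_fun a).
Proof.
apply: measurable_funM; first exact: measurable_powR.
apply: (measurableT_comp (@measurable_expR R)).
exact: oppr_measurable.
Qed.

Lemma gamma_fun_ge0 a t : 0 <= gamma_fun a t.
Proof. by rewrite mulr_ge0 ?powR_ge0 ?expR_ge0. Qed.

Lemma powR_le_expR a : exists2 C, 0 <= C & forall t, 1 <= t -> t `^ a <= C * expR t.
Proof.
pose m := (Num.bound `|a|).+1; exists (m`!%:R) => // t t1.
have t0 : 0 <= t by lra.
have h := @expR_ge1Dxn R t m.-1 t0.
have f0 : 0 < m`!%:R :> R by rewrite ltr0n fact_gt0.
apply: (@le_trans _ _ (t ^+ m)).
  rewrite -powR_mulrn// ler_powR// (le_trans (ler_norm _))//.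
  by apply/ltW/(lt_trans (archi_boundP _)) => //; rewrite ltr_nat.
by rewrite -ler_pdivrMl// mulrC; have := h; rewrite /m -pred_Sn; lra.
Qed.

Lemma Gamma_lty a : 0 < a ->
  (\int[leb]_(t in `]0%R, +oo[) (gamma_fun a t)%:E < +oo)%E.
Proof.
(* The exponent is chosen so that [t^(a-1) = t^(a+1) * t^-2] leaves the integrable tail [t^-2] after
   the exponential is absorbed. *)
move=> a0; have [C C0 hC] := @powR_le_expR (a + 1).
apply: (@le_lt_trans _ _ (\int[leb]_(t in `]0%R, 1%R]) (t `^ (a - 1))%:E +
  \int[leb]_(t in `]1%R, +oo[) (C * t `^ (- 1 - 1))%:E)%E).
  apply: integral_split01_le.
  - exact: measurable_gamma_fun.
  - exact: measurable_powR.
  - by apply: measurable_funM => //; exact: measurable_powR.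
  - by move=> t _; exact: gamma_fun_ge0.
  - move=> t /andP[t0 _]; rewrite /gamma_fun ler_piMr ?powR_ge0//.
    by rewrite -expR0 ler_expR oppr_le0 ltW.
  - move=> t t1; have t0 : 0 < t by lra.
    rewrite /gamma_fun expRN ler_pdivrMr ?expR_gt0//.
    rewrite (_ : a - 1 = (a + 1) + (- 1 - 1)); last by ring.
    rewrite powRD; last by apply/implyP => _; rewrite gt_eqF.
    by rewrite mulrAC ler_wpM2r ?powR_ge0// hC// ltW.
apply: lte_add_pinfty.
  by apply: le_lt_trans (integral_powR01 a0) _; exact: ltry.
under eq_integral do rewrite EFinM.
rewrite ge0_integralZl//; last 2 first.
- by apply/measurable_EFinP; exact: measurable_powR_itv.
- by move=> t _; rewrite lee_fin powR_ge0.
apply: (@le_lt_trans _ _ (C%:E * (1^-1)%:E)%E).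
  by apply: lee_wpmul2l; [rewrite lee_fin|exact: integral_powR1y].
by rewrite -EFinM ltry.
Qed.

Lemma EFin_Gamma a : 0 < a ->
  ((Gamma a)%:E = \int[leb]_(t in `]0%R, +oo[) (gamma_fun a t)%:E)%E.
Proof.
move=> a0; rewrite /Gamma /Rintegral fineK//.
rewrite ge0_fin_numE; first exact: Gamma_lty.
by apply: integral_ge0 => t _; rewrite lee_fin gamma_fun_ge0.
Qed.

(** The integral of [t^(a-1)] over the unit interval is [1 / a]; cutting at [x = 2^(-1/a)] retains
    exactly half of it, and [exp(-t) >= exp(-1)] there. The resulting blow-up at 0 drives every
    limit below. *)
Lemma Gamma_ge a : 0 < a -> expR (- 1) / (2 * a) <= Gamma a.
Proof.
move=> a0; rewrite -lee_fin EFin_Gamma//.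
pose x : R := (2^-1) `^ (a^-1).
have x0 : 0 < x by rewrite powR_gt0// invr_gt0.
have x1 : x < 1.
  have <- : 1 `^ a^-1 = 1 :> R by rewrite powR1.
  rewrite /x gt0_ltr_powR ?nnegrE ?invr_gt0 ?invr_ge0//.
  by rewrite invf_lt1// ltr1n.
apply: (@le_trans _ _ (\int[leb]_(t in `[x, 1%R]) (expR (- 1) * t `^ (a - 1))%:E)%E).
  under eq_integral do rewrite EFinM.
  rewrite ge0_integralZl//; last 2 first.
  - by apply/measurable_EFinP; exact: measurable_powR_itv.
  - by move=> t _; rewrite lee_fin powR_ge0.
  rewrite integral_powR ?gt_eqF// -EFinM lee_fin powR1 /x -powRrM mulVf ?gt_eqF//.
  rewrite powRr1 ?invr_ge0//.
  by apply: eqW; field; rewrite gt_eqF.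
apply: (@le_trans _ _ (\int[leb]_(t in `[x, 1%R]) (gamma_fun a t)%:E)%E).
  apply: ge0_le_integral => //.
  - by move=> t _; rewrite lee_fin mulr_ge0 ?expR_ge0 ?powR_ge0.
  - by apply/measurable_EFinP; apply: measurable_funM => //; exact: measurable_powR_itv.
  - by apply/measurable_EFinP; apply: measurable_funTS; exact: measurable_gamma_fun.
  - move=> t; rewrite /= in_itv/= => /andP[_ t1]; rewrite lee_fin /gamma_fun mulrC.
    by rewrite ler_wpM2l ?powR_ge0// ler_expR lerN2.
apply: ge0_subset_integral => //.
- by apply/measurable_EFinP; apply: measurable_funTS; exact: measurable_gamma_fun.
- by move=> t _; rewrite lee_fin gamma_fun_ge0.
- by move=> t /=; rewrite !in_itv/= andbT => /andP[xt _]; exact: lt_le_trans xt.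
Qed.

Lemma Gamma_gt0 a : 0 < a -> 0 < Gamma a.
Proof.
move=> a0; apply: lt_le_trans (Gamma_ge a0).
by rewrite divr_gt0 ?expR_gt0 ?mulr_gt0.
Qed.

(** The compact intervals [J k] are invariant under [t -> t^-1], so the substitution holds on each
    of them and monotone convergence exhausts the half-line on both sides. *)
Lemma integral_inversion (g : R -> R) : (forall t, 0 < t -> {for t, continuous g}) ->
  measurable_fun setT g -> (forall t, 0 < t -> 0 <= g t) ->
  (\int[leb]_(t in `]0%R, +oo[) (g t)%:E =
   \int[leb]_(s in `]0%R, +oo[) (g (s `^ (- 1)) * s `^ (- 2))%:E)%E.
Proof.
move=> cg mg g0.
pose J k : set R := `[k.+2%:R^-1, k.+2%:R]%classic.
have JE : `]0, +oo[%classic = \bigcup_k J k.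
  apply/seteqP; split => t.
    rewrite /= in_itv/= andbT => t0.
    exists (maxn (Num.bound t) (Num.bound t^-1)) => //=.
    rewrite /J /= in_itv/=; apply/andP; split.
      rewrite -[leRHS]invrK lef_pV2 ?posrE ?invr_gt0//.
      by apply: ge_bound_natr; [rewrite invr_ge0 ltW|lia].
    by apply: ge_bound_natr; [exact: ltW|lia].
  by move=> [k _]; rewrite /J /= !in_itv/= andbT => /andP[h _]; rewrite (lt_le_trans _ h)// invr_gt0.
have ndJ : nondecreasing_seq J.
  move=> k l kl; apply/subsetPset => t; rewrite /J /= !in_itv/= => /andP[h1 h2].
  rewrite (le_trans _ h1) ?(le_trans h2)// ?lef_pV2 ?posrE// ler_nat; lia.
have mJ k : measurable (J k) by exact: measurable_itv.
have J0 k t : J k t -> 0 < t.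
  by rewrite /J /= in_itv/= => /andP[h _]; rewrite (lt_le_trans _ h)// invr_gt0.
have mV b : measurable_fun setT (fun s : R => (s `^ b : R)) by exact: measurable_powR.
have mh : measurable_fun setT (fun s => g (s `^ (- 1)) * s `^ (- 2)).
  by apply: measurable_funM => //; exact: (measurableT_comp mg (mV _)).
have lim (f : R -> R) : measurable_fun setT f -> (forall t, 0 < t -> 0 <= f t) ->
    (\int[leb]_(t in J k) (f t)%:E)%E @[k --> \oo] --> (\int[leb]_(t in `]0%R, +oo[) (f t)%:E)%E.
  move=> mf f0; rewrite JE.
  apply: ge0_nondecreasing_set_cvg_integral => //.
  - by move=> k; apply: measurable_funTS; exact/measurable_EFinP.
  - by move=> k t /J0 t0; rewrite lee_fin f0.
have h1 := lim _ mg g0.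
have h2 : (\int[leb]_(t in J k) (g (t `^ (- 1)) * t `^ (- 2))%:E)%E @[k --> \oo] -->
    (\int[leb]_(t in `]0%R, +oo[) (g (t `^ (- 1)) * t `^ (- 2))%:E)%E.
  by apply: lim => // t t0; rewrite mulr_ge0 ?g0 ?powR_gt0 ?powR_ge0.
apply: (cvg_unique _ h1) => //.
suff -> : (fun k => \int[leb]_(t in J k) (g t)%:E)%E =
    (fun k => \int[leb]_(t in J k) (g (t `^ (- 1)) * t `^ (- 2))%R%:E)%E by [].
apply/funext => k.
have dV (t : R) : 0 < t -> is_derive t 1 (fun y : R => y^-1) (- t ^- 2).
  move=> t0; apply: is_derive_eq; first by apply: is_deriveV; rewrite gt_eqF.
  by rewrite /GRing.scale/= mulr1.
have dV1 (t : R) : 0 < t -> derive1 (fun y : R => y^-1) t = - t ^- 2.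
  by move=> t0; rewrite derive1E; have [_ ->] := dV t t0.
have k0 : 0 < k.+2%:R^-1 :> R by rewrite invr_gt0.
have k1 : k.+2%:R^-1 < k.+2%:R :> R.
  by rewrite (@lt_trans _ _ 1)// ?invf_lt1// ltr1n.
have cD (t : R) : 0 < t -> {for t, continuous (fun y : R => - y ^- 2)}.
  move=> t0; apply: cvgN; apply: cvgV; first by rewrite expf_neq0// gt_eqF.
  exact: exprn_continuous.
have near_pos (t : R) : 0 < t -> \forall y \near t, derive1 (fun y : R => y^-1) y = - y ^- 2.
  move=> t0; near=> y; apply: dV1; near: y; exact: lt_nbhsr.
have cdV (t : R) : 0 < t -> {for t, continuous (derive1 (fun y : R => y^-1))}.
  move=> t0; rewrite /prop_for /continuous_at dV1//.
  apply: cvg_trans (cD t t0); apply: near_eq_cvg.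
  by have := near_pos t t0; apply: filterS => y ->.
have cgJ : {within `[(k.+2%:R^-1)%R, ((k.+2%:R^-1)^-1)%R], continuous g}.
  apply: continuous_in_subspaceT => t; rewrite inE/= in_itv/= => /andP[h _].
  by apply: cg; exact: lt_le_trans h.
have := @integration_by_substitution_decreasing R (fun y => y^-1) g
  (k.+2%:R^-1) (k.+2%:R) (ltW k1).
rewrite invrK => -> //.
- apply: eq_integral => t; rewrite inE => /J0 t0.
  by congr EFin; rewrite /= !fctE dV1// opprK powR_inv1 ?ltW// powRN -[2]/(2%:R) powR_mulrn ?ltW.
- move=> x y; rewrite !in_itv/= => /andP[hx _] /andP[hy _] xy.
  by rewrite ltf_pV2 ?posrE// (lt_le_trans k0).
- by move=> t; rewrite in_itv/= => /andP[h _]; apply: cdV; exact: lt_trans h.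
- apply/cvg_ex; exists (- (k.+2%:R^-1) ^- 2); apply: cvg_at_right_filter.
  by have := cdV _ k0; rewrite /prop_for /continuous_at dV1.
- apply/cvg_ex; exists (- (k.+2%:R) ^- 2); apply: cvg_at_left_filter.
  by have := cdV _ (lt_trans k0 k1); rewrite /prop_for /continuous_at dV1// (lt_trans k0).
- split.
  + by move=> t; rewrite in_itv/= => /andP[h _]; have [] := dV t (lt_trans k0 h).
  + by apply: cvg_at_right_filter; exact: (is_derive_continuous (dV _ k0)).
  + by apply: cvg_at_left_filter; exact: (is_derive_continuous (dV _ (lt_trans k0 k1))).
- by move: cgJ; rewrite invrK.
Unshelve. all: by end_near. Qed.

End gamma.

(** * Time weights on the half-line and subordination *)

Section halfline.
Context {R : realType}.
Local Notation leb := (@lebesgue_measure R).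
Implicit Types (a b e q s t x y : R) (f g : R -> R).

(** Extension by zero lets times range over the whole line, so that product measures and Fubini
    apply without restricted domains. *)
Definition halfline f s : R := if 0 < s then f s else 0.

Lemma halflineE f s : halfline f s = \1_`]0, +oo[ s * f s.
Proof.
rewrite /halfline indicE; case: ifPn => s0.
  by rewrite mem_set ?mul1r//= in_itv/= s0.
by rewrite memNset ?mul0r//= in_itv/= andbT; exact/negP.
Qed.

Lemma measurable_halfline f : measurable_fun setT f -> measurable_fun setT (halfline f).
Proof.
move=> mf; rewrite (_ : halfline f = (fun s => \1_`]0, +oo[ s * f s)).
  by apply: measurable_funM => //; exact: measurable_indic.
by apply/funext => s; exact: halflineE.
Qed.

Lemma halfline_ge0 f s : (forall t, 0 < t -> 0 <= f t) -> 0 <= halfline f s.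
Proof. by rewrite /halfline => f0; case: ifPn => // /f0. Qed.

Lemma integral_halfline f :
  (\int[leb]_s (halfline f s)%:E = \int[leb]_(s in `]0%R, +oo[) (f s)%:E)%E.
Proof.
rewrite [RHS]integral_mkcond; apply: eq_integral => s _.
rewrite patchE /halfline; case: ifPn => s0.
  by rewrite mem_set//= in_itv/= s0.
by rewrite memNset//= in_itv/= andbT; exact/negP.
Qed.


Lemma Gamma_scale a q : 0 < a -> 0 < q ->
  (\int[leb]_(t in `]0%R, +oo[) (t `^ (a - 1) * expR (- (q * t)))%:E =
   (Gamma a * q `^ (- a))%:E)%E.
Proof.
move=> a0 q0; have q0' : q != 0 by rewrite gt_eqF.
have mg : measurable_fun setT (EFin \o halfline (@gamma_fun R a)).
  by apply/measurable_EFinP; apply: measurable_halfline; exact: measurable_gamma_fun.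
have g0 s : (0 <= (EFin \o halfline (@gamma_fun R a)) s)%E.
  by rewrite lee_fin; apply: halfline_ge0 => t _; exact: gamma_fun_ge0.
pose F t := t `^ (a - 1) * expR (- (q * t)).
have mF : measurable_fun setT F.
  apply: measurable_funM; first exact: measurable_powR.
  apply: (measurableT_comp (@measurable_expR R)).
  apply: (measurableT_comp (@oppr_measurable R setT)).
  exact: measurable_funM.
have F0 s : (0 <= (EFin \o halfline F) s)%E.
  by rewrite lee_fin; apply: halfline_ge0 => t _; rewrite mulr_ge0 ?powR_ge0 ?expR_ge0.
have := ge0_integral_affine1 0 q0' mg g0.
rewrite integral_halfline -EFin_Gamma// gtr0_norm// => GE.
have {}GE : ((Gamma a)%:E = (q `^ a)%:E * \int[leb]_t (halfline F t)%:E)%E.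
  rewrite GE (_ : q `^ a = q * q `^ (a - 1)); last by rewrite mulr_powRB1// ltW.
  rewrite EFinM -muleA; congr (_ * _)%E; rewrite -ge0_integralZl//; last 3 first.
  - by apply/measurable_EFinP; exact: measurable_halfline.
  - by move=> t _; exact: F0.
  - by rewrite lee_fin powR_ge0.
  apply: eq_integral => t _; rewrite add0r -EFinM /halfline/=.
  rewrite pmulr_rgt0//; case: ifPn => t0; last by rewrite mulr0.
  by rewrite /gamma_fun /F powRM ?ltW// mulrA.
rewrite -integral_halfline mulrC EFinM GE muleA -EFinM -powRD; last by rewrite q0' implybT.
by rewrite addNr powRr0 mul1e.
Qed.

(** The substitution [t = s^-1] in [Gamma_scale]. With [q] a quarter of a squared length,
    [exp(-q / s)] is the heat kernel profile at time [s], and a negative power becomes a mixture of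
    Gaussians. *)
Lemma subordination a q : 0 < a -> 0 < q ->
  (\int[leb]_s (halfline (fun s => s `^ (- a - 1) * expR (- (q * s `^ (- 1)))) s)%:E =
   (Gamma a * q `^ (- a))%:E)%E.
Proof.
move=> a0 q0; rewrite integral_halfline -Gamma_scale// [RHS]integral_inversion.
- apply: eq_integral => s; rewrite inE/= in_itv/= andbT => s0; congr EFin.
  rewrite -powRrM mulrAC -powRD; last by rewrite (gt_eqF s0) implybT.
  by congr (_ `^ _ * _); ring.
- move=> t t0; apply: cvgM; first exact: continuous_powR_pos.
  apply: (@continuous_comp _ _ _ (fun t => - (q * t)) expR); last exact: continuous_expR.
  exact: (cvgN (cvgM (@cst_continuous _ _ q t) cvg_id)).
- apply: measurable_funM; first exact: measurable_powR.
  apply: (measurableT_comp (@measurable_expR R)).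
  apply: (measurableT_comp (@oppr_measurable R setT)).
  exact: measurable_funM.
- by move=> t _; rewrite mulr_ge0 ?powR_ge0 ?expR_ge0.
Qed.

Lemma halfline_split01_le f C e b : 0 <= C -> 0 < e -> 0 < b ->
  measurable_fun setT f -> (forall t, 0 < t -> 0 <= f t) ->
  (forall t, 0 < t <= 1 -> f t <= t `^ (e - 1)) ->
  (forall t, 1 < t -> f t <= C * t `^ (- b - 1)) ->
  (\int[leb]_t (halfline f t)%:E <= (e^-1 + C * b^-1)%:E)%E.
Proof.
move=> C0 e0 b0 mf f0 f1 f2; rewrite integral_halfline.
have m2 : measurable_fun setT (fun t => C * t `^ (- b - 1)).
  by apply: measurable_funM => //; exact: measurable_powR.
apply: (le_trans (integral_split01_le mf (measurable_powR _) m2 f0 f1 f2)).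
rewrite EFinD; apply: leeD; first exact: integral_powR01.
under eq_integral do rewrite EFinM.
rewrite ge0_integralZl//.
- by rewrite EFinM; apply: lee_wpmul2l; [rewrite lee_fin|exact: integral_powR1y].
- by apply/measurable_EFinP; exact: measurable_powR_itv.
- by move=> t _; rewrite lee_fin powR_ge0.
Qed.

(** What matters is uniformity in [e]: divided by [Gamma e], this first moment is a mean time that
    tends to 0 with [e]. *)
Lemma gamma_moment : exists2 C : R, 0 <= C & forall e, 0 < e <= 1 ->
  (\int[leb]_s (halfline (fun s => gamma_fun e s * s) s)%:E <= C%:E)%E.
Proof.
(* For [t > 1] and [e <= 1], [t^e <= t = t^3 * t^-2]; the cube is absorbed by the exponential. *)
have [C C0 hC] := @powR_le_expR R 3.
exists (1 + C) => [|e /andP[e0 e1]]; first by rewrite addr_ge0.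
rewrite -[X in (X + _)%:E]invr1 -[X in (_ + X)%:E]mulr1 -[X in (_ + _ * X)%:E]invr1.
have ge t : 0 < t -> gamma_fun e t * t = t `^ e * expR (- t).
  by move=> t0; rewrite /gamma_fun mulrAC mulrC -[in RHS](mulr_powRB1 (ltW t0) e0) mulrC (mulrC t).
apply: halfline_split01_le => //.
- by apply: measurable_funM => //; exact: measurable_gamma_fun.
- by move=> t t0; rewrite mulr_ge0 ?gamma_fun_ge0// ltW.
- move=> t /andP[t0 t1]; rewrite ge// subrr powRr0 mulr_ile1 ?powR_ge0 ?expR_ge0//.
    by rewrite -[leRHS](powRr0 t) ger_powR ?t0// ltW.
  by rewrite -expR0 ler_expR oppr_le0 ltW.
- move=> t t1; have t0 : 0 < t by lra.
  rewrite ge// expRN ler_pdivrMr ?expR_gt0//.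
  apply: (@le_trans _ _ (t `^ 1)); first by rewrite ler_powR// ltW.
  rewrite (_ : t `^ 1 = t `^ (3 + (- 1 - 1))); last by congr (_ `^ _); ring.
  rewrite powRD; last by rewrite (gt_eqF t0) implybT.
  by rewrite mulrAC ler_wpM2r ?powR_ge0// hC// ltW.
Qed.

Definition far_weight e s : R := s `^ (e - 1 - 2^-1) * (1 - expR (- s)).

Lemma measurable_far_weight e : measurable_fun setT (far_weight e).
Proof.
apply: measurable_funM; first exact: measurable_powR.
apply: measurable_funB => //; apply: (measurableT_comp (@measurable_expR R)).
exact: oppr_measurable.
Qed.

Lemma far_weight_ge0 e t : 0 < t -> 0 <= far_weight e t.
Proof.
move=> t0; rewrite mulr_ge0 ?powR_ge0// subr_ge0 -expR0 ler_expR oppr_le0 ltW//.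
Qed.

(** Near 0, [1 - exp(-s) <= s] raises the exponent to [e - 1/2]; at infinity it stays at [e - 3/2].
    For [e <= 1/4] the two pieces are at most 2 and 4. *)
Lemma far_weight_le e : 0 < e <= 4^-1 ->
  (\int[leb]_t (halfline (far_weight e) t)%:E <= 6%:E)%E.
Proof.
move=> /andP[e0 e1].
have E0 : (e + 2^-1)^-1 <= 2 by rewrite -[leRHS]invrK lef_pV2 ?posrE//; lra.
have E1 : (2^-1 - e)^-1 <= 4 by rewrite -[leRHS]invrK lef_pV2 ?posrE//; lra.
apply: (@le_trans _ _ ((e + 2^-1)^-1 + 1 * (2^-1 - e)^-1)%:E); last by rewrite lee_fin; lra.
apply: halfline_split01_le => //; try lra.
- exact: measurable_far_weight.
- by move=> t; exact: far_weight_ge0.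
- move=> t /andP[t0 t1]; rewrite /far_weight.
  rewrite (_ : e + 2^-1 - 1 = (e - 1 - 2^-1) + 1); last by field.
  rewrite [leRHS]powRD; last by rewrite (gt_eqF t0) implybT.
  rewrite (powRr1 (ltW t0)); apply: ler_wpM2l; first exact: powR_ge0.
  by have := expR_ge1Dx (- t); lra.
- move=> t t1; rewrite /far_weight mul1r (_ : - (2^-1 - e) - 1 = e - 1 - 2^-1); last by ring.
  by rewrite ler_piMr ?powR_ge0//; have := expR_ge0 (- t); lra.
Qed.

(** The minimum is the size in [s] of an increment of a test function over a distance of order
    [s^(1/2)]; this majorant justifies Fubini before the weight is split. *)
Lemma min_weight_le e : 0 < e <= 4^-1 ->
  (\int[leb]_t (halfline (fun t => t `^ (e - 1 - 2^-1) * Num.min (t `^ 2^-1) 1) t)%:E < +oo)%E.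
Proof.
move=> /andP[e0 e1].
apply: (@le_lt_trans _ _ (e^-1 + 1 * (2^-1 - e)^-1)%:E); last exact: ltry.
apply: halfline_split01_le => //; try lra.
- apply: measurable_funM; first exact: measurable_powR.
  by apply: measurable_minr => //; exact: measurable_powR.
- by move=> t t0; rewrite mulr_ge0 ?powR_ge0// le_min powR_ge0/=.
- move=> t /andP[t0 t1].
  rewrite (_ : t `^ (e - 1) = t `^ (e - 1 - 2^-1) * t `^ 2^-1).
    by rewrite ler_wpM2l ?powR_ge0// ge_min lexx.
  by rewrite -powRD ?subrK// (gt_eqF t0) implybT.
- move=> t t1; rewrite mul1r (_ : - (2^-1 - e) - 1 = e - 1 - 2^-1); last by ring.
  by rewrite ler_piMr ?powR_ge0// ge_min lexx orbT.
Qed.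

End halfline.

(** * Gaussian integrals on R^n *)

Section gauss_integral.
Context {R : realType}.

Lemma gauss_rV_cons n t (y : 'rV[R]_n) : gauss (rV_cons (t, y)) = gauss_fun t * gauss y.
Proof.
rewrite /gauss /gauss_fun -expRD -opprD; congr (expR (- _)).
rewrite /dotv big_ord_recl rV_cons0 expr2; congr (_ + _).
by apply: eq_bigr => i _; rewrite rV_consS.
Qed.

Lemma integral_gauss n :
  (\int[lebesgue_rV R n]_k (gauss k)%:E = (pi `^ (n%:R / 2))%:E)%E.
Proof.
have mG m : measurable_fun setT (EFin \o @gauss R m).
  by apply/measurable_EFinP; exact: measurable_gauss.
elim: n => [|n IH].
  rewrite /= integral_dirac//; last exact: (mG 0%N).
  by rewrite diracT mul1e mul0r powRr0 /gauss /dotv big_ord0 oppr0 expR0.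
rewrite ge0_integral_rVS//; last by move=> x; rewrite lee_fin gauss_ge0.
under eq_integral => t _.
  under eq_integral do rewrite gauss_rV_cons EFinM.
  rewrite ge0_integralZl//; last 3 first.
  - exact: (mG n).
  - by move=> y _; rewrite lee_fin gauss_ge0.
  - by rewrite lee_fin gauss_fun_ge0.
  rewrite IH; over.
rewrite ge0_integralZr//; last 3 first.
- by apply/measurable_EFinP; exact: measurable_gauss_fun.
- by move=> t _; rewrite lee_fin gauss_fun_ge0.
- by rewrite lee_fin powR_ge0.
rewrite integralT_gauss -EFinM -powR12_sqrt ?pi_ge0// -powRD; last by rewrite gt_eqF ?pi_gt0// implybT.
by congr (_ `^ _)%:E; rewrite -natr1; field.
Qed.

(** From [1 + q <= 2 * exp(q / 2)], half of the exponent absorbs the polynomial; the other half is a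
    dilation of [gauss] by the square root of 2. *)
Lemma gauss_moment n :
  (lebesgue_rV R n).-integrable setT (EFin \o (fun k => gauss k * (1 + dotv k k))).
Proof.
have md : measurable_fun setT (fun k : 'rV[R]_n => dotv k k).
  by apply: continuous_measurable_rV; exact: continuous_dotvv.
pose F (k : 'rV[R]_n) := 2 * expR (- (dotv k k / 2)).
have mF : measurable_fun setT F.
  apply: measurable_funM => //; apply: (measurableT_comp (@measurable_expR R)).
  apply: (measurableT_comp (@oppr_measurable R setT)); exact: measurable_funM.
apply: (@le_integrableR _ _ _ _ _ F).
- by apply: measurable_funM; [exact: measurable_gauss|exact: measurable_funD].
- move=> k; have d0 := dotv_ge0 k.
  rewrite ger0_norm ?mulr_ge0 ?gauss_ge0//; last by rewrite addr_ge0.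
  rewrite /gauss /F (_ : - dotv k k = - (dotv k k / 2) + - (dotv k k / 2)); last by field.
  rewrite expRD -mulrA [leLHS]mulrC; apply: ler_wpM2r; first exact: expR_ge0.
  rewrite expRN ler_pdivrMl ?expR_gt0//.
  by have := expR_ge1Dx (dotv k k / 2); lra.
- apply: ge0_integrableR => //; first by move=> k; rewrite mulr_ge0 ?expR_ge0.
  have s2 : Num.sqrt 2 != 0 :> R by rewrite gt_eqF// sqrtr_gt0.
  rewrite (@ge0_integral_affine _ _ 0 (Num.sqrt 2))//; last 2 first.
  - exact/measurable_EFinP.
  - by move=> x; rewrite lee_fin mulr_ge0 ?expR_ge0.
  rewrite (_ : (\int[_]_x _ = \int[lebesgue_rV R n]_x (2%:E * (gauss x)%:E))%E); last first.
    apply: eq_integral => x _; rewrite /F -EFinM; congr (_ * expR (- _))%:E.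
    rewrite /dotv mulr_suml; apply: eq_bigr => i _; rewrite !mxE !add0r.
    rewrite mulrACA -expr2 sqr_sqrtr//; by field.
  rewrite ge0_integralZl//; last 2 first.
  - by apply/measurable_EFinP; exact: measurable_gauss.
  - by move=> x _; rewrite lee_fin gauss_ge0.
  by rewrite integral_gauss -!EFinM ltry.
Qed.

End gauss_integral.

(** * The near and far kernels *)

(* The library's sigma-finite instance for product measures is shadowed by the
   one for subprobabilities, hence the new constant. *)
Section space_time.
Context {R : realType} (n : nat).

Definition space_time : set (measurableTypeR R * 'rV[R]_n) -> \bar R :=
  (@lebesgue_measure R \x lebesgue_rV R n)%E.

HB.instance Definition _ := Measure.on space_time.

Let space_time_sigma_finite : sigma_finite setT space_time.
Proof.
have /sigma_finiteP[F [TF ndF Foo]] := sigma_finiteT (@lebesgue_measure R).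
have /sigma_finiteP[G [TG ndG Goo]] := sigma_finiteT (lebesgue_rV R n).
exists (fun k => F k `*` G k).
  apply/esym; rewrite -subTset => -[x y] _ /=.
  have [i _ Fi] : (\bigcup_i F i) x by rewrite -TF.
  have [j _ Gj] : (\bigcup_i G i) y by rewrite -TG.
  exists (maxn i j) => //; split => /=.
    by move: Fi; exact/subsetPset/ndF/leq_maxl.
  by move: Gj; exact/subsetPset/ndG/leq_maxr.
move=> k; have [mFk Fkoo] := Foo k; have [mGk Gkoo] := Goo k; split.
  exact: measurableX.
by rewrite [space_time _]product_measure1E// lte_mul_pinfty// ge0_fin_numE.
Qed.

HB.instance Definition _ := Measure_isSigmaFinite.Build _ _ _ space_time
  space_time_sigma_finite.

End space_time.

Section product_kernels.
Context {R : realType} (n : nat).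
Local Notation E := 'rV[R]_n.
Local Notation mu := (lebesgue_rV R n).
Local Notation leb := (@lebesgue_measure R).
Local Notation m := (leb \x mu)%E.
Implicit Types (w : R -> R) (g : E -> R).

Lemma Rintegral_sum d (T : measurableType d) (nu : {measure set T -> \bar R}) k
    (f : 'I_k -> T -> R) : (forall i, nu.-integrable setT (EFin \o f i)) ->
  \int[nu]_x \sum_i f i x = \sum_i \int[nu]_x f i x.
Proof.
move=> intf; apply: EFin_inj; rewrite -sumEFin EFin_Rintegral.
  under eq_integral do rewrite -sumEFin.
  rewrite integral_sum//.
  by apply: eq_bigr => i _; rewrite EFin_Rintegral.
have := @integrable_sum _ _ _ nu _ measurableT _ (index_enum 'I_k) xpredT (fun i => EFin \o f i) (fun i _ => intf i).
by apply: eq_integrable => // x _ /=; rewrite sumEFin.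
Qed.

Lemma measurable_prodM w g : measurable_fun setT w -> measurable_fun setT g ->
  measurable_fun setT (fun z : R * E => w z.1 * g z.2).
Proof.
move=> mw mg; apply: measurable_funM.
  exact: (measurableT_comp mw measurable_fst).
exact: (measurableT_comp mg measurable_snd).
Qed.

Lemma ge0_integral_prodM w g : measurable_fun setT w -> measurable_fun setT g ->
  (forall s, 0 <= w s) -> (forall x, 0 <= g x) ->
  (\int[m]_z (w z.1 * g z.2)%:E = \int[leb]_s (w s)%:E * \int[mu]_k (g k)%:E)%E.
Proof.
move=> mw mg w0 g0.
have mwg := measurable_prodM mw mg.
rewrite (fubini_tonelli1 (m1 := leb) (m2 := mu)); last 2 first.
- exact/measurable_EFinP.
- by move=> z; rewrite lee_fin mulr_ge0.
rewrite /fubini_F/=.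
under eq_integral => s _.
  under eq_integral do rewrite EFinM.
  rewrite ge0_integralZl//; last 3 first.
  - exact/measurable_EFinP.
  - by move=> x _; rewrite lee_fin.
  - by rewrite lee_fin.
  over.
rewrite ge0_integralZr//.
- exact/measurable_EFinP.
- by move=> x _; rewrite lee_fin.
- by apply: integral_ge0 => x _; rewrite lee_fin.
Qed.

End product_kernels.

Section kernels.
Context {R : realType} (n : nat).
Local Notation E := 'rV[R]_n.
Local Notation mu := (lebesgue_rV R n).
Local Notation leb := (@lebesgue_measure R).
Local Notation m := (leb \x mu)%E.
Local Notation T := (measurableTypeR R * E)%type.
Implicit Types (e s : R) (z : R * E).

(** Normalises the product of the Gamma weight in time, of mass [Gamma e], and the Gaussian in
    space, of mass [pi ^ (n / 2)]. *)
Definition kernel_const e : R := pi `^ (- (n%:R / 2)) / Gamma e.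

(* Under [near_kernel], [heat_shift] is the position of a diffusion with
   generator the Laplacian at an independent Gamma distributed time. *)
Definition heat_shift z : E := (2 * z.1 `^ 2^-1) *: z.2.

(* The two kernels come from splitting the weight s^(e - 3/2) of the heat
   superposition by 1 = exp(-s) + (1 - exp(-s)). *)
Definition near_kernel e z : R :=
  kernel_const e * (halfline (gamma_fun e) z.1 * gauss z.2).

Definition far_kernel e (i : 'I_n) z : R :=
  kernel_const e * (halfline (far_weight e) z.1 * (gauss z.2 * z.2 ord0 i)).

Lemma kernel_const_gt0 e : 0 < e -> 0 < kernel_const e.
Proof. by move=> e0; rewrite divr_gt0 ?Gamma_gt0// powR_gt0// pi_gt0. Qed.

Lemma measurable_heat_shift : measurable_fun [set: T] heat_shift.
Proof.
apply: measurable_fun_rVZ; last exact: measurable_snd.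
apply: measurable_funM => //.
exact: (measurableT_comp (measurable_powR _) measurable_fst).
Qed.

Lemma measurable_opp_heat_shift : measurable_fun [set: T] (fun z => - heat_shift z).
Proof. exact: (measurableT_comp (@measurable_rV_opp R n) measurable_heat_shift). Qed.

Lemma measurable_near_kernel e : measurable_fun [set: T] (near_kernel e).
Proof.
apply: measurable_funM => //; apply: measurable_prodM; last exact: measurable_gauss.
by apply: measurable_halfline; exact: measurable_gamma_fun.
Qed.

Lemma measurable_gauss_coord (i : 'I_n) : measurable_fun setT (fun k : E => gauss k * k ord0 i).
Proof. by apply: measurable_funM; [exact: measurable_gauss|exact: measurable_rV_coord]. Qed.

Lemma measurable_far_kernel e i : measurable_fun [set: T] (far_kernel e i).
Proof.
apply: measurable_funM => //.
apply: (@measurable_prodM _ _ _ (fun k : E => gauss k * k ord0 i)); last exact: measurable_gauss_coord.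
by apply: measurable_halfline; exact: measurable_far_weight.
Qed.

Lemma near_kernel_ge0 e z : 0 < e -> 0 <= near_kernel e z.
Proof.
move=> e0; rewrite mulr_ge0 ?(ltW (kernel_const_gt0 e0))// mulr_ge0 ?gauss_ge0//.
by apply: halfline_ge0 => t _; exact: gamma_fun_ge0.
Qed.

Let halfline_gamma_ge0 e s : 0 <= halfline (gamma_fun e) s.
Proof. by apply: halfline_ge0 => t _; exact: gamma_fun_ge0. Qed.

Let halfline_far_ge0 e s : 0 <= halfline (far_weight e) s.
Proof. by apply: halfline_ge0 => t; exact: far_weight_ge0. Qed.

Let mhg e : measurable_fun setT (halfline (gamma_fun e) : R -> R).
Proof. by apply: measurable_halfline; exact: measurable_gamma_fun. Qed.

Let mhf e : measurable_fun setT (halfline (far_weight e) : R -> R).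
Proof. by apply: measurable_halfline; exact: measurable_far_weight. Qed.

Lemma integral_near_kernel e : 0 < e -> (\int[m]_z (near_kernel e z)%:E = 1)%E.
Proof.
move=> e0; under eq_integral do rewrite EFinM.
rewrite ge0_integralZl//; last 3 first.
- by apply/measurable_EFinP; apply: measurable_prodM => //; exact: measurable_gauss.
- by move=> z _; rewrite lee_fin mulr_ge0 ?gauss_ge0.
- by rewrite lee_fin ltW// kernel_const_gt0.
rewrite (@ge0_integral_prodM _ _ (halfline (gamma_fun e)) (@gauss R n))//; last 2 first.
- exact: measurable_gauss.
- exact: gauss_ge0.
rewrite integral_halfline -EFin_Gamma// integral_gauss -!EFinM; congr EFin.
rewrite /kernel_const powRN; field.
by rewrite gt_eqF ?Gamma_gt0//= gt_eqF// powR_gt0// pi_gt0.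
Qed.

Lemma integrable_near_kernel e : 0 < e -> m.-integrable setT (EFin \o near_kernel e).
Proof.
move=> e0; apply: ge0_integrableR.
- exact: measurable_near_kernel.
- by move=> z; exact: near_kernel_ge0.
- by rewrite integral_near_kernel// ltry.
Qed.

(** One moment that dominates both [|k_i|], needed for the far kernel, and the squared length,
    needed for the near one. *)
Definition gauss_second : R := \int[mu]_k (gauss k * (1 + dotv k k)).

Lemma EFin_gauss_second : (\int[mu]_k (gauss k * (1 + dotv k k))%:E = gauss_second%:E)%E.
Proof. by rewrite -EFin_Rintegral//; exact: gauss_moment. Qed.

Lemma gauss_second_ge0 : 0 <= gauss_second.
Proof.
by apply: Rintegral_ge0 => k _; rewrite mulr_ge0 ?gauss_ge0// addr_ge0// dotv_ge0.
Qed.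

Let mg2 : measurable_fun setT (fun k : E => gauss k * (1 + dotv k k)).
Proof. by have /integrableP[/measurable_EFinP] := @gauss_moment R n. Qed.

Let g20 (k : E) : 0 <= gauss k * (1 + dotv k k).
Proof. by rewrite mulr_ge0 ?gauss_ge0// addr_ge0// dotv_ge0. Qed.

Let integral_kernel_second (c : R) (w : R -> R) : 0 <= c -> measurable_fun setT w -> (forall s, 0 <= w s) ->
  (\int[m]_z (c * (w z.1 * (gauss z.2 * (1 + dotv z.2 z.2))))%:E =
   c%:E * (\int[leb]_s (w s)%:E * gauss_second%:E))%E.
Proof.
move=> c0 mw w0; under eq_integral do rewrite EFinM.
rewrite ge0_integralZl//; last 2 first.
- apply/measurable_EFinP.
  exact: (@measurable_prodM _ _ w (fun k : E => gauss k * (1 + dotv k k))).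
- by move=> z _; rewrite lee_fin mulr_ge0.
by rewrite (@ge0_integral_prodM _ _ w (fun k : E => gauss k * (1 + dotv k k)))// EFin_gauss_second.
Qed.

Lemma sqr_coord_le (k : E) i : (k ord0 i) ^+ 2 <= dotv k k.
Proof.
rewrite /dotv (bigD1 i)//= -expr2 lerDl sumr_ge0// => j _.
by rewrite -expr2 sqr_ge0.
Qed.

Lemma coord_le_dotv (k : E) i : `|k ord0 i| <= 1 + dotv k k.
Proof.
apply: le_trans (_ : 1 + (k ord0 i) ^+ 2 <= _); last by rewrite lerD2l sqr_coord_le.
by rewrite -(real_normK (num_real (k ord0 i))); have := sqr_ge0 (`|k ord0 i| - 1); nra.
Qed.

Lemma integral_far_kernel e i : 0 < e <= 4^-1 ->
  (\int[m]_z `|far_kernel e i z|%:E <= (kernel_const e * (6 * gauss_second))%:E)%E.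
Proof.
move=> e01; have e0 : 0 < e by case/andP: e01.
have c0 := ltW (kernel_const_gt0 e0).
apply: (@le_trans _ _ (\int[m]_z (kernel_const e *
    (halfline (far_weight e) z.1 * (gauss z.2 * (1 + dotv z.2 z.2))))%:E)%E).
  apply: ge0_le_integral => //.
  - apply/measurable_EFinP; apply: measurableT_comp => //; exact: measurable_far_kernel.
  - apply/measurable_EFinP; apply: measurable_funM => //.
    exact: (@measurable_prodM _ _ (halfline (far_weight e)) (fun k : E => gauss k * (1 + dotv k k))).
  - move=> z _; rewrite lee_fin /far_kernel normrM (ger0_norm c0) normrM (ger0_norm (halfline_far_ge0 _ _)).
    rewrite normrM (ger0_norm (gauss_ge0 _)) ler_wpM2l// ler_wpM2l// ler_wpM2l ?gauss_ge0//.
    exact: coord_le_dotv.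
rewrite integral_kernel_second// [leRHS]EFinM lee_wpmul2l ?lee_fin//.
by rewrite EFinM lee_wpmul2r ?lee_fin ?gauss_second_ge0// far_weight_le.
Qed.

Lemma integrable_far_kernel e i : 0 < e <= 4^-1 -> m.-integrable setT (EFin \o far_kernel e i).
Proof.
move=> e01; apply/integrableP; split.
  by apply/measurable_EFinP; exact: measurable_far_kernel.
by apply: le_lt_trans (integral_far_kernel i e01) _; rewrite ltry.
Qed.

(** Up to a factor 4, the mean squared displacement under the near kernel; it feeds the Chebyshev
    estimate of [near_kernel_modulus]. *)
Lemma near_kernel_moment : exists2 C : R, 0 <= C & forall e, 0 < e <= 1 ->
  (\int[m]_z (near_kernel e z * (z.1 * dotv z.2 z.2))%:E <= (C / Gamma e)%:E)%E.
Proof.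
have [C C0 hC] := @gamma_moment R.
exists (pi `^ (- (n%:R / 2)) * (C * gauss_second)).
  by rewrite !mulr_ge0 ?powR_ge0 ?gauss_second_ge0.
move=> e e01; have e0 : 0 < e by case/andP: e01.
have c0 := ltW (kernel_const_gt0 e0).
pose w := halfline (fun s : R => gamma_fun e s * s).
have w0 s : 0 <= w s.
  by apply: halfline_ge0 => t t0; rewrite mulr_ge0 ?gamma_fun_ge0// ltW.
have mw : measurable_fun setT w.
  by apply: measurable_halfline; apply: measurable_funM => //; exact: measurable_gamma_fun.
apply: (@le_trans _ _ (\int[m]_z (kernel_const e *
    (w z.1 * (gauss z.2 * (1 + dotv z.2 z.2))))%:E)%E).
  have mwg := @measurable_prodM _ _ w (fun k : E => gauss k * (1 + dotv k k)) mw mg2.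
  have E1 z : near_kernel e z * (z.1 * dotv z.2 z.2) = kernel_const e *
      (w z.1 * (gauss z.2 * dotv z.2 z.2)).
    by rewrite /near_kernel /w /halfline; case: ifPn => _; ring.
  apply: ge0_le_integral => //.
  - by move=> z _; rewrite E1 lee_fin mulr_ge0// mulr_ge0// mulr_ge0 ?gauss_ge0 ?dotv_ge0.
  - apply/measurable_EFinP; under eq_fun do rewrite E1; apply: measurable_funM => //.
    apply: (@measurable_prodM _ _ w (fun k : E => gauss k * dotv k k)) => //.
    apply: measurable_funM; first exact: measurable_gauss.
    by apply: continuous_measurable_rV; exact: continuous_dotvv.
  - by apply/measurable_EFinP; exact: measurable_funM.
  - move=> z _; rewrite E1 lee_fin ler_wpM2l// ler_wpM2l// ler_wpM2l ?gauss_ge0//.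
    by rewrite lerDr.
rewrite integral_kernel_second//.
rewrite (_ : _ / Gamma e = kernel_const e * (C * gauss_second)); last by rewrite /kernel_const; ring.
rewrite [leRHS]EFinM lee_wpmul2l ?lee_fin//.
by rewrite EFinM lee_wpmul2r ?lee_fin ?gauss_second_ge0// hC.
Qed.

End kernels.

(** * The fractional divergence as a heat superposition *)

(** Checking the infinite values too, including a difference of two infinities, lets
    [Rintegral_affine] hold for every measurable function. *)
Lemma fine_mulBr (R : realType) (r : R) (P N : \bar R) : 0 < r ->
  fine (r%:E * P - r%:E * N)%E = r * fine (P - N)%E.
Proof.
move=> r0; have ry : (r%:E * +oo = +oo)%E by rewrite gt0_muley// lte_fin.
have rNy : (r%:E * -oo = -oo)%E by rewrite gt0_muleNy// lte_fin.
case: P => [P| |]; case: N => [N| |]; rewrite ?ry ?rNy /= ?mulr0//.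
by rewrite mulrBr.
Qed.

Lemma Rintegral_affine (R : realType) n (b : 'rV[R]_n) c (f : 'rV[R]_n -> R) :
  c != 0 -> measurable_fun setT f ->
  \int[lebesgue_rV R n]_x f x = `|c| ^+ n * \int[lebesgue_rV R n]_x f (b + c *: x).
Proof.
move=> c0 /measurable_EFinP mf.
have Ep := ge0_integral_affine b c0 (measurable_funepos mf) (funepos_ge0 _).
have En := ge0_integral_affine b c0 (measurable_funeneg mf) (funeneg_ge0 _).
rewrite /Rintegral integralE Ep En [in RHS]integralE.
have -> : (\int[lebesgue_rV R n]_x (fun y => (f (b + c *: y))%:E)^\+ x =
    \int[lebesgue_rV R n]_x (EFin \o f)^\+ (b + c *: x)%R)%E.
  by apply: eq_integral => x _; rewrite !funeposE.
have -> : (\int[lebesgue_rV R n]_x (fun y => (f (b + c *: y))%:E)^\- x =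
    \int[lebesgue_rV R n]_x (EFin \o f)^\- (b + c *: x)%R)%E.
  by apply: eq_integral => x _; rewrite !funenegE.
have r0 : 0 < `|c| ^+ n by rewrite exprn_gt0// normr_gt0.
move: r0; set r := _ ^+ n => r0.
exact: fine_mulBr.
Qed.
Lemma integrable_kernel_bounded (R : realType) n (k : R * 'rV[R]_n -> R)
    (f : 'rV[R]_n -> R) B x : (@lebesgue_measure R \x lebesgue_rV R n)%E.-integrable setT (EFin \o k) ->
  measurable_fun setT f -> (forall y, `|f y| <= B) ->
  (@lebesgue_measure R \x lebesgue_rV R n)%E.-integrable setT
    (EFin \o (fun z => k z * f (x + heat_shift z))).
Proof.
move=> ik mf fB; have /measurable_EFinP mk := measurable_int _ ik.
have h : (@lebesgue_measure R \x lebesgue_rV R n)%E.-integrable setT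
    (EFin \o (fun z : R * 'rV[R]_n => B * `|k z|)).
  exact: (integrableZl measurableT B (integrable_norm ik)).
apply: le_integrableR h.
  apply: measurable_funM => //.
  exact: (measurable_shift1 x (@measurable_heat_shift R n) mf).
by move=> z; rewrite normrM mulrC ler_wpM2r.
Qed.

(** Only orders near 1 enter the limit; starting at 1/2 places [(1 - a) / 2] in the range where the
    far weight is uniformly bounded. *)
Lemma half_gap_itv (R : realType) (a : R) : 2^-1 <= a -> a < 1 ->
  0 < (1 - a) / 2 <= 4^-1.
Proof.
move=> a2 a1; apply/andP; split; first by rewrite divr_gt0// subr_gt0.
lra.
Qed.

Section frac_kernel.
Context {R : realType} (n : nat).
Local Notation E := 'rV[R]_n.
Local Notation mu := (lebesgue_rV R n).
Local Notation leb := (@lebesgue_measure R).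
Variable alpha : R.
Hypotheses (alpha_ge : 2^-1 <= alpha) (alpha_lt : alpha < 1).

Let e : R := (1 - alpha) / 2.
Let a : R := (n%:R + alpha + 1) / 2.

Let e01 : 0 < e <= 4^-1. Proof. exact: half_gap_itv. Qed.

Let e0 : 0 < e. Proof. by case/andP: e01. Qed.

Let a0 : 0 < a.
Proof.
by rewrite divr_gt0// addr_gt0// ltr_wpDl//; move: alpha_ge => h; lra.
Qed.

Definition frac_kernel (h : E) : R := mu_const n alpha / enorm h `^ (n%:R + alpha + 1).

(* The factor 2^-(n+1) compensates the Jacobian (2 sqrt s)^n of [heat_shift]
   and its extra factor in [heat_scaling]. *)
Definition heat (z : R * E) : R := kernel_const n e / 2 ^+ n.+1 *
  halfline (fun s => s `^ (- a - 1) * expR (- (dotv z.2 z.2 / 4 * s `^ (- 1)))) z.1.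

Lemma dotv_eq0 (h : E) : dotv h h = 0 -> h = 0.
Proof.
move=> h0; apply/rowP => i; rewrite mxE; apply/eqP; rewrite -sqrf_eq0 eq_le sqr_ge0 andbT.
by rewrite -h0 sqr_coord_le.
Qed.

Lemma integral_heat (h : E) : h != 0 ->
  (\int[leb]_s (heat (s, h))%:E = (frac_kernel h)%:E)%E.
Proof.
move=> h0; have d0 : 0 < dotv h h.
  by rewrite lt_neqAle dotv_ge0 andbT eq_sym; apply: contra h0 => /eqP/dotv_eq0 ->.
rewrite /heat; under eq_integral do rewrite EFinM.
have d40 : 0 < dotv h h / 4 by rewrite divr_gt0.
have mf : measurable_fun setT (halfline (fun s => s `^ (- a - 1) * expR (- (dotv h h / 4 * s `^ (- 1)))) : R -> R).
  apply: measurable_halfline; apply: measurable_funM; first exact: measurable_powR.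
  apply: (measurableT_comp (@measurable_expR R)).
  apply: (measurableT_comp (@oppr_measurable R setT)).
  by apply: measurable_funM => //; exact: measurable_powR.
rewrite ge0_integralZl//; last 3 first.
- exact/measurable_EFinP.
- move=> s _; rewrite lee_fin; apply: halfline_ge0 => t _.
  by rewrite mulr_ge0 ?powR_ge0 ?expR_ge0.
- by rewrite lee_fin divr_ge0// ltW// kernel_const_gt0.
have /= -> := subordination a0 d40.
rewrite -EFinM; congr EFin.
rewrite /frac_kernel /mu_const /kernel_const -/e -/a /enorm.
rewrite -powR12_sqrt ?dotv_ge0// -powRrM (_ : 2^-1 * _ = a); last by rewrite /a; ring.
rewrite powRM ?dotv_ge0// !powRN.
(* As [2 * a = n + 1 + alpha], this power cancels the normalisation [2 ^ (n + 1)] of [heat] and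
   leaves the [2 ^ alpha] of [mu_const]. *)
have -> : 4^-1 `^ a = (2 ^+ n.+1 * 2 `^ alpha)^-1.
  rewrite -[4^-1]powR_inv1// -powRrM mulN1r powRN; congr (_^-1).
  rewrite (_ : 4 = 2 `^ 2%:R); last by rewrite powR_mulrn//; ring.
  rewrite -powRrM -powR_mulrn// -powRD ?pnatr_eq0 ?implybT//.
  by congr (_ `^ _); rewrite /a -natr1; field.
have := powR_gt0 alpha (ltr0n R 2 : 0 < 2%:R); have := powR_gt0 a d0.
have := Gamma_gt0 e0; have : 0 < 2 ^+ n.+1 :> R by rewrite exprn_gt0.
have := powR_gt0 (n%:R / 2) (pi_gt0 R).
by move=> *; field; rewrite !gt_eqF.
Qed.

(** At [h = 2 * s^(1/2) * k] the Gaussian is freed of [s]; the remaining exponents add up to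
    [n/2 - a - 1 + 1/2 = e - 3/2]. *)
Lemma heat_scaling s (k : E) i : 0 < s ->
  (2 * s `^ 2^-1) ^+ n * heat (s, (2 * s `^ 2^-1) *: k) * (2 * s `^ 2^-1 * k ord0 i) =
  kernel_const n e * s `^ (e - 1 - 2^-1) * (gauss k * k ord0 i).
Proof.
move=> s0; have s0' : s != 0 by rewrite gt_eqF.
have sE b c : s `^ b * s `^ c = s `^ (b + c) by rewrite powRD// s0' implybT.
rewrite /heat/= /halfline s0.
have -> : dotv ((2 * s `^ 2^-1) *: k) ((2 * s `^ 2^-1) *: k) / 4 * s `^ (- 1) = dotv k k.
  rewrite {1}/dotv !mulr_suml; apply: eq_bigr => j _; rewrite !mxE.
  rewrite powR_inv1 ?ltW//.
  have h : s `^ 2^-1 * s `^ 2^-1 = s by rewrite sE (_ : 2^-1 + 2^-1 = 1) ?powRr1 ?ltW//; field.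
  by rewrite -[X in _ / X]h; field; rewrite gt_eqF// powR_gt0.
rewrite -/(gauss k) exprMn -(powR_mulrn n (powR_ge0 _ _)) -powRrM.
rewrite (_ : s `^ (e - 1 - 2^-1) = s `^ (2^-1 * n%:R) * s `^ (- a - 1) * s `^ 2^-1); last first.
  by rewrite !sE; congr (_ `^ _); rewrite /e /a; field.
rewrite exprS; field.
by rewrite expf_neq0.
Qed.


Lemma measurable_heat : measurable_fun setT heat.
Proof.
rewrite (_ : heat = fun z => kernel_const n e / 2 ^+ n.+1 * (\1_`]0, +oo[ z.1 *
    (z.1 `^ (- a - 1) * expR (- (dotv z.2 z.2 / 4 * z.1 `^ (- 1)))))); last first.
  by apply/funext => z; rewrite /heat halflineE.
apply: measurable_funM => //; apply: measurable_funM.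
  exact: (measurableT_comp (@measurable_indic _ (measurableTypeR R) R _ _ _) measurable_fst).
have mp c : measurable_fun setT (fun z : R * E => z.1 `^ c).
  exact: (measurableT_comp (measurable_powR c) measurable_fst).
apply: measurable_funM => //; apply: (measurableT_comp (@measurable_expR R)).
apply: (measurableT_comp (@oppr_measurable R setT)); apply: measurable_funM => //.
apply: measurable_funM => //.
exact: (measurableT_comp (continuous_measurable_rV (@continuous_dotvv R n)) measurable_snd).
Qed.

Section component.
Variables (psi : E -> R) (dpsi : 'I_n -> E -> R) (i : 'I_n) (x : E).
Hypothesis C1 : C1c psi dpsi.

Let D (h : E) : R := h ord0 i * (psi (x + h) - psi x).
Let F (z : R * E) : R := heat z * D z.2.
Let rho (s : R) : R := 2 * s `^ 2^-1.

Let rho_gt0 s : 0 < s -> 0 < rho s.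
Proof. by move=> s0; rewrite mulr_gt0 ?powR_gt0. Qed.

Let mpsi : measurable_fun setT psi.
Proof. by have [cpsi _ _ _] := C1; exact: continuous_measurable_rV. Qed.

Let mpsix : measurable_fun setT (fun h : E => psi (x + h)).
Proof.
apply: (measurableT_comp mpsi); rewrite (_ : +%R x = (fun h => h + x)); last first.
  by apply/funext => h; rewrite addrC.
exact: measurable_rV_shift.
Qed.

Let mD : measurable_fun setT D.
Proof.
apply: measurable_funM; first exact: measurable_rV_coord.
exact: measurable_funB.
Qed.

Let mF : measurable_fun setT F.
Proof.
apply: measurable_funM; first exact: measurable_heat.
exact: (measurableT_comp mD measurable_snd).
Qed.

(** The Lipschitz bound serves short times and boundedness long ones; their minimum makes the
    unsplit weight integrable at both ends. *)
Let increment_le : exists2 B, 0 <= B & forall s (k : E), 0 < s ->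
  `|k ord0 i * (psi (x + rho s *: k) - psi x)| <=
  B * Num.min (s `^ 2^-1) 1 * (1 + dotv k k).
Proof.
have [B B0 [pB _ lip]] := C1c_bounded C1.
exists (2 * B * n.+1%:R) => [|s k s0]; first by rewrite !mulr_ge0.
have d0 := dotv_ge0 k; rewrite normrM.
have n1 : 1 <= n.+1%:R :> R by rewrite ler1n.
rewrite /Num.min; case: ifPn => _.
  apply: (@le_trans _ _ (`|k ord0 i| * (B * (rho s * \sum_j `|k ord0 j|)))).
    rewrite ler_wpM2l// (le_trans (lip _ _))// ler_wpM2l// mulr_sumr.
    by apply: ler_sum => j _; rewrite mxE normrM gtr0_norm// rho_gt0.
  rewrite (_ : _ * (B * _) = 2 * B * s `^ 2^-1 * (`|k ord0 i| * \sum_j `|k ord0 j|)); last first.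
    by rewrite /rho; ring.
  rewrite (_ : 2 * B * n.+1%:R * _ * _ = 2 * B * s `^ 2^-1 * (n.+1%:R * (1 + dotv k k))); last by ring.
  apply: ler_wpM2l; first by rewrite !mulr_ge0 ?powR_ge0.
  apply: (@le_trans _ _ (\sum_(j < n) (dotv k k + k ord0 j * k ord0 j))).
    rewrite mulr_sumr; apply: ler_sum => j _.
    apply: le_trans (_ : `|k ord0 i| ^+ 2 + `|k ord0 j| ^+ 2 <= _).
      by have := sqr_ge0 (`|k ord0 i| - `|k ord0 j|); have := sqr_ge0 (`|k ord0 i| + `|k ord0 j|); nra.
    by rewrite !real_normK ?num_real// lerD ?sqr_coord_le// expr2.
  rewrite big_split/= sumr_const card_ord -/(dotv k k) -mulr_natl -natr1.
  have : 0 <= n%:R :> R by []; nra.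
rewrite mulr1 mulrC; apply: ler_pM => //; last exact: coord_le_dotv.
rewrite (le_trans (ler_normB _ _))// (@le_trans _ _ (2 * B))//.
  by have := pB x; have := pB (x + rho s *: k); lra.
by rewrite ler_peMr// mulr_ge0.
Qed.

Let scaled s (k : E) : 0 < s -> rho s ^+ n * F (s, 0 + rho s *: k) =
  kernel_const n e * s `^ (e - 1 - 2^-1) * gauss k *
  (k ord0 i * (psi (x + rho s *: k) - psi x)).
Proof.
move=> s0; rewrite add0r /F /D /= mxE.
have := heat_scaling k i s0; rewrite -/(rho s) => h.
transitivity (rho s ^+ n * heat (s, rho s *: k) * (rho s * k ord0 i) *
  (psi (x + rho s *: k) - psi x)); first by ring.
by rewrite h; ring.
Qed.

Let F0 s (h : E) : ~~ (0 < s) -> F (s, h) = 0.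
Proof. by move=> /negbTE s0; rewrite /F /heat/= /halfline s0 mulr0 mul0r. Qed.

Let int_absF : exists C : R, forall s, (\int[mu]_h `|F (s, h)|%:E <= (C *
  halfline (fun s => s `^ (e - 1 - 2^-1) * Num.min (s `^ 2^-1) 1) s)%:E)%E.
Proof.
have [B B0 hB] := increment_le.
exists (kernel_const n e * B * gauss_second n) => s.
have [s0|s0] := boolP (0 < s); last first.
  rewrite /halfline (negbTE s0) mulr0; under eq_integral do rewrite F0// normr0.
  by rewrite integral0.
have r0 := rho_gt0 s0; have c0 := ltW (kernel_const_gt0 n e0).
have mFs : measurable_fun setT (fun h => F (s, h)) by exact: (measurable_fun_pair2 s mF).
have mFr : measurable_fun setT (fun h : E => F (s, 0 + rho s *: h)).
  exact: (measurableT_comp mFs (measurable_rV_affine 0 (rho s))).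
rewrite (@ge0_integral_affine _ _ 0 (rho s))//; last 2 first.
- by rewrite gt_eqF.
- by apply/measurable_EFinP; exact: (measurableT_comp (@normr_measurable R setT) mFs).
rewrite (ger0_norm (ltW r0)) -ge0_integralZl//; last 2 first.
- by apply/measurable_EFinP; exact: (measurableT_comp (@normr_measurable R setT) mFr).
- by rewrite lee_fin exprn_ge0// ltW.
set K := kernel_const n e * B * (s `^ (e - 1 - 2^-1) * Num.min (s `^ 2^-1) 1).
have m0 : 0 <= Num.min (s `^ 2^-1) 1 by rewrite le_min powR_ge0/=.
have K0 : 0 <= K := mulr_ge0 (mulr_ge0 c0 B0) (mulr_ge0 (powR_ge0 _ _) m0).
have g0 (k : E) : 0 <= kernel_const n e * s `^ (e - 1 - 2^-1) * gauss k.
  exact: (mulr_ge0 (mulr_ge0 c0 (powR_ge0 _ _)) (gauss_ge0 _)).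
apply: (@le_trans _ _ (\int[mu]_k (K * (gauss k * (1 + dotv k k)))%:E)%E).
  apply: ge0_le_integral => //.
  - by move=> k _; rewrite -EFinM lee_fin mulr_ge0// exprn_ge0// ltW.
  - apply/measurable_EFinP; apply: measurable_funM => //.
    exact: (measurableT_comp (@normr_measurable R setT) mFr).
  - apply/measurable_EFinP; apply: measurable_funM => //.
    by have /integrableP[/measurable_EFinP] := @gauss_moment R n.
  - move=> k _; rewrite -EFinM lee_fin.
    rewrite -[X in X * _](ger0_norm (exprn_ge0 n (ltW r0))) -normrM scaled//.
    rewrite normrM (ger0_norm (g0 k)); apply: le_trans (ler_wpM2l (g0 k) (hB s k s0)) _.
    by rewrite /K; apply: eqW; ring.
under eq_integral do rewrite EFinM.
rewrite ge0_integralZl//; last 2 first.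
- by apply/measurable_EFinP; have /integrableP[/measurable_EFinP] := @gauss_moment R n.
- by move=> k _; rewrite lee_fin mulr_ge0 ?gauss_ge0// addr_ge0// dotv_ge0.
rewrite EFin_gauss_second -EFinM lee_fin /halfline s0 /K.
by apply: eqW; ring.
Qed.

Let intF : (leb \x mu)%E.-integrable setT (EFin \o F).
Proof.
have [C hC] := int_absF.
apply/integrable12ltyP; first exact/measurable_EFinP.
have mw : measurable_fun setT (halfline (fun s : R => s `^ (e - 1 - 2^-1) * Num.min (s `^ 2^-1) 1)).
  apply: measurable_halfline; apply: measurable_funM; first exact: measurable_powR.
  by apply: measurable_minr => //; exact: measurable_powR.
have w0 s : 0 <= halfline (fun s : R => s `^ (e - 1 - 2^-1) * Num.min (s `^ 2^-1) 1) s.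
  by apply: halfline_ge0 => t t0; rewrite mulr_ge0 ?powR_ge0// le_min powR_ge0/=.
apply: (@le_lt_trans _ _ (\int[leb]_s (`|C|%:E *
   (halfline (fun s : R => s `^ (e - 1 - 2^-1) * Num.min (s `^ 2^-1) 1) s)%:E))%E).
  apply: ge0_le_integral => //.
  - by move=> s _; exact: integral_ge0.
  - apply: (measurable_fun_fubini_tonelli_F (abse \o (EFin \o F))) => //=.
    by apply: measurableT_comp => //; exact/measurable_EFinP.
  - by apply: emeasurable_funM => //; exact/measurable_EFinP.
  - move=> s _ /=; apply: le_trans (hC s) _.
    by rewrite -EFinM lee_fin ler_wpM2r// ler_norm.
rewrite ge0_integralZl//; last 2 first.
- exact/measurable_EFinP.
- by move=> s _; rewrite lee_fin.
by apply: lte_mul_pinfty => //; exact: min_weight_le.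
Qed.

Let int_gauss_coord : mu.-integrable setT (EFin \o (fun k => gauss k * k ord0 i)).
Proof.
apply: le_integrableR (@gauss_moment R n); first exact: measurable_gauss_coord.
by move=> k; rewrite normrM ger0_norm ?gauss_ge0// ler_wpM2l ?gauss_ge0// coord_le_dotv.
Qed.

(** By oddness. At a fixed time the subtracted value [psi x], indispensable for convergence near the
    origin, therefore drops out. *)
Let int_gauss_coord0 : \int[mu]_k (gauss k * k ord0 i) = 0.
Proof.
have /measurable_EFinP mg := @measurable_gauss_coord R n i.
have := integral_rVN mg; rewrite -(EFin_Rintegral int_gauss_coord).
rewrite (_ : (\int[mu]_k _)%E = \int[mu]_k (-1 * (gauss k * k ord0 i))%:E)%E; last first.
  by apply: eq_integral => k _ /=; rewrite gaussN mxE; congr EFin; ring.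
under eq_integral do rewrite EFinM.
rewrite integralZl// -(EFin_Rintegral int_gauss_coord) -EFinM => -[h].
by move: h; lra.
Qed.

(** [F] is integrated in both orders: time first gives the singular kernel, space first gives a
    Gaussian average at each time, which can be integrated by parts. *)
Lemma frac_kernel_component :
  mu.-integrable setT (EFin \o (fun h => frac_kernel h * D h)) /\
  \int[mu]_h (frac_kernel h * D h) =
  avg (@space_time R n) (near_kernel e) (@heat_shift R n) (dpsi i) x +
  avg (@space_time R n) (far_kernel e i) (@heat_shift R n) psi x.
Proof.
have EF h : \int[leb]_s F (s, h) = frac_kernel h * D h.
  (* [integral_heat] excludes the origin, but there both sides vanish with the coordinate factor of
     [D]. *)
  have [->|h0] := eqVneq h 0.
    have D0 : D 0 = 0 by rewrite /D mxE mul0r.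
    rewrite D0 mulr0; under eq_Rintegral do rewrite /F/= D0 mulr0.
    by rewrite Rintegral_cst// mul0r.
  under eq_Rintegral do rewrite /F/= mulrC.
  rewrite RintegralZl_total; last exact: (measurable_fun_pair1 h measurable_heat).
  by rewrite mulrC /Rintegral integral_heat.
split.
  rewrite (_ : (fun h => _) = (fun h => \int[leb]_s F (s, h))).
    exact: (integrable_Rintegral2 intF).
  by apply/funext => h; rewrite EF.
under eq_Rintegral do rewrite -EF.
rewrite -(Rfubini intF).
have [B B0 [pB dB _]] := C1c_bounded C1; have [_ cdpsi _ _] := C1.
have mdpsi := continuous_measurable_rV (cdpsi i).
pose N (z : R * E) := near_kernel e z * dpsi i (x + heat_shift z).
pose Fa (z : R * E) := far_kernel e i z * psi (x + heat_shift z).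
have iN : (leb \x mu)%E.-integrable setT (EFin \o N).
  exact: (integrable_kernel_bounded x (integrable_near_kernel n e0) mdpsi (dB i)).
have iFa : (leb \x mu)%E.-integrable setT (EFin \o Fa).
  exact: (integrable_kernel_bounded x (integrable_far_kernel i e01) mpsi pB).
transitivity (\int[(leb \x mu)%E]_z N z + \int[(leb \x mu)%E]_z Fa z) => //.
rewrite -(Rintegral_prod1 iN) -(Rintegral_prod1 iFa).
rewrite -RintegralD//; last 2 first.
- exact: integrable_Rintegral1.
- exact: integrable_Rintegral1.
apply: eq_Rintegral => s _.
have [s0|s0] := boolP (0 < s); last first.
  have z0 (f : E -> R) : (forall k, f k = 0) -> \int[mu]_k f k = 0.
    by move=> f0; under eq_Rintegral do rewrite f0; rewrite Rintegral_cst// mul0r.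
  rewrite !z0 ?addr0// => k; first by rewrite /Fa /far_kernel/= /halfline (negbTE s0) mul0r mulr0 mul0r.
    by rewrite /N /near_kernel/= /halfline (negbTE s0) mul0r mulr0 mul0r.
  exact: F0.
have r0 := rho_gt0 s0.
have shE (k : E) : heat_shift (s, k) = rho s *: k by [].
have mpr : measurable_fun setT (fun k : E => psi (x + rho s *: k)).
  exact: (measurableT_comp mpsi (measurable_rV_affine x (rho s))).
have mdr : measurable_fun setT (fun k : E => dpsi i (x + rho s *: k)).
  exact: (measurableT_comp mdpsi (measurable_rV_affine x (rho s))).
have mG := @measurable_gauss R n; have mGi := @measurable_gauss_coord R n i.
set J := \int[mu]_k (gauss k * k ord0 i * psi (x + rho s *: k)).
set I := \int[mu]_k (gauss k * dpsi i (x + rho s *: k)).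
(* With [r = 2 * s^(1/2)], the factor [r / 2] raises the time exponent from [e - 3/2] to [e - 1],
   that of the Gamma density. *)
have JI : J = s `^ 2^-1 * I.
  by rewrite /J (gauss_by_parts i x C1 r0) /rho; congr (_ * _); field.
have -> : \int[mu]_k N (s, k) = kernel_const n e * gamma_fun e s * I.
  rewrite /I -RintegralZl_total; last exact: measurable_funM.
  by apply: eq_Rintegral => k _; rewrite /N /near_kernel shE/= /halfline s0; ring.
have -> : \int[mu]_k Fa (s, k) = kernel_const n e * far_weight e s * J.
  rewrite /J -RintegralZl_total; last exact: measurable_funM.
  by apply: eq_Rintegral => k _; rewrite /Fa /far_kernel shE/= /halfline s0; ring.
rewrite (@Rintegral_affine R n 0 (rho s)) ?gt_eqF//; last exact: (measurable_fun_pair2 s mF).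
rewrite gtr0_norm// -RintegralZl_total; last first.
  exact: (measurableT_comp (measurable_fun_pair2 s mF) (measurable_rV_affine 0 (rho s))).
under eq_Rintegral do rewrite scaled//.
(* The near and far weights recombine here: [I] is turned back into [J], and the two complementary
   factors add up to 1. *)
transitivity (kernel_const n e * s `^ (e - 1 - 2^-1) * J); last first.
  have -> : gamma_fun e s = s `^ (e - 1 - 2^-1) * s `^ 2^-1 * expR (- s).
    by rewrite -powRD ?subrK// (gt_eqF s0) implybT.
  by rewrite JI /far_weight; ring.
pose Jf (k : E) := gauss k * k ord0 i * psi (x + rho s *: k).
have iJ : mu.-integrable setT (EFin \o Jf).
  apply: (@le_integrableR _ _ _ _ _ (fun k => B * `|gauss k * k ord0 i|)).
  - exact: measurable_funM.
  - by move=> k; rewrite normrM mulrC ler_wpM2r.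
  - exact: (integrableZl measurableT B (integrable_norm int_gauss_coord)).
transitivity (\int[mu]_k (kernel_const n e * s `^ (e - 1 - 2^-1) *
    (Jf k - psi x * (gauss k * k ord0 i)))).
  by apply: eq_Rintegral => k _; rewrite /Jf; ring.
rewrite RintegralZl_total; last first.
  by apply: measurable_funB; exact: measurable_funM.
rewrite RintegralB//; last exact: (integrableZl measurableT (psi x) int_gauss_coord).
by rewrite RintegralZl_total// int_gauss_coord0 mulr0 subr0.
Qed.

End component.

Lemma frac_div_avg (phi : E -> E) x : test_field phi ->
  frac_div alpha phi x =
  avg (@space_time R n) (near_kernel e) (@heat_shift R n) (divergence phi) x +
  \sum_i avg (@space_time R n) (far_kernel e i) (@heat_shift R n) (fun y => phi y ord0 i) x.
Proof.
move=> tphi; have C i := test_field_C1c i tphi.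
pose H (h : E) := \sum_i frac_kernel h * (h ord0 i * (phi (x + h) ord0 i - phi x ord0 i)).
have iH i := (frac_kernel_component i x (C i)).1.
have mH : measurable_fun setT (EFin \o H).
  apply/measurable_EFinP; apply: measurable_sum => i.
  by have /measurable_EFinP := measurable_int _ (iH i).
have HE y : H (y - x) = mu_const n alpha *
    (dotv (y - x) (phi y - phi x) / enorm (y - x) `^ (n%:R + alpha + 1)).
  rewrite /H /dotv mulr_suml mulr_sumr; apply: eq_bigr => i _.
  by rewrite subrKC !mxE /frac_kernel; ring.
have intH : \int[mu]_h H h =
    avg (@space_time R n) (near_kernel e) (@heat_shift R n) (divergence phi) x +
    \sum_i avg (@space_time R n) (far_kernel e i) (@heat_shift R n) (fun y => phi y ord0 i) x.
  rewrite Rintegral_sum//.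
  under eq_bigr do rewrite (frac_kernel_component _ x (C _)).2.
  rewrite big_split/=; congr (_ + _).
  transitivity (\int[(leb \x mu)%E]_z \sum_i
      near_kernel e z * partial i phi (x + heat_shift z) ord0 i).
    rewrite Rintegral_sum// => i.
    have [B _ [_ dB _]] := C1c_bounded (C i); have [_ cd _ _] := C i.
    exact: (integrable_kernel_bounded x (integrable_near_kernel n e0)
      (continuous_measurable_rV (cd i)) (dB i)).
  by apply: eq_Rintegral => z _; rewrite /divergence mulr_sumr.
rewrite -intH /frac_div -RintegralZl_total.
  rewrite /Rintegral -(integral_shift (- x) mH).
  by congr fine; apply: eq_integral => y _ /=; rewrite HE.
(* Dividing by this constant writes the original integrand as a multiple of a shift of [H], whose
   measurability is known. *)
have c0 : mu_const n alpha != 0.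
  rewrite /mu_const -/e -/a gt_eqF// divr_gt0 ?Gamma_gt0// mulr_gt0 ?Gamma_gt0//.
  by rewrite mulr_gt0 ?powR_gt0// pi_gt0.
rewrite (_ : (fun y => _) = fun y => (mu_const n alpha)^-1 * H (y - x)).
  move/measurable_EFinP : mH => mH; apply: measurable_funM => //.
  exact: (measurableT_comp mH (measurable_rV_shift (- x))).
by apply/funext => y; rewrite HE mulKf.
Qed.

End frac_kernel.

(** * Weak fractional gradients *)

Section uniqueness.
Context {R : realType} (n : nat).
Local Notation E := 'rV[R]_n.
Local Notation mu := (lebesgue_rV R n).
Implicit Types (v : E) (g : E -> E).

Lemma enorm_ge0 v : 0 <= enorm v. Proof. exact: sqrtr_ge0. Qed.

Lemma enorm_le_sum v : enorm v <= \sum_i `|v ord0 i|.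
Proof.
have s0 : 0 <= \sum_i `|v ord0 i| by apply: sumr_ge0.
rewrite -[leRHS]ger0_norm// -sqrtr_sqr ler_sqrt ?sqr_ge0//.
rewrite expr2 mulr_suml; apply: ler_sum => i _.
rewrite (le_trans (ler_norm _))// normrM ler_wpM2l// (bigD1 i)//= lerDl.
exact: sumr_ge0.
Qed.

Lemma coord_le_enorm v i : `|v ord0 i| <= enorm v.
Proof. by rewrite -sqrtr_sqr ler_sqrt ?sqr_coord_le ?dotv_ge0. Qed.

Lemma measurable_enorm : measurable_fun setT (@enorm R n).
Proof.
apply: continuous_measurable_rV => h.
apply: (@continuous_comp _ _ _ (fun h : E => dotv h h) Num.sqrt).
  exact: continuous_dotvv.
exact: sqrt_continuous.
Qed.

Lemma measurable_coord_field g i : measurable_fun setT g ->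
  measurable_fun setT (fun x => g x ord0 i).
Proof. by move=> mg; exact: (measurableT_comp (measurable_rV_coord i) mg). Qed.

Lemma loc_integrable_mul g i (F : E -> R) M : loc_integrable g -> continuous F ->
  (forall x, ~ cube M x -> F x = 0) ->
  mu.-integrable setT (EFin \o (fun x => g x ord0 i * F x)).
Proof.
move=> [mg lg] cF F0.
have [B B0 FB] := continuous_cube_bounded cF F0.
have mF := continuous_measurable_rV cF.
have me : measurable_fun setT (fun x => enorm (g x)).
  exact: (measurableT_comp measurable_enorm mg).
have m1 : measurable_fun setT (fun x => \1_(cube M) x * enorm (g x)).
  by apply: measurable_funM => //; apply: measurable_indic; exact: measurable_cube.
have i1 : mu.-integrable setT (EFin \o (fun x => \1_(cube M) x * enorm (g x))).
  apply: ge0_integrableR => //; first by move=> x; rewrite mulr_ge0 ?enorm_ge0.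
  apply: le_lt_trans (lg _ (@compact_cube R n M)).
  rewrite [leRHS]integral_mkcond; apply: eqW; apply: eq_integral => x _; rewrite patchE indicE.
  by case: (x \in cube M); rewrite ?mul1r ?mul0r.
have := @integrableZl _ _ _ mu _ measurableT B _ i1 => i2.
apply: (@le_integrableR _ _ _ _ _ (fun x => B * (\1_(cube M) x * enorm (g x)))) i2.
  by apply: measurable_funM => //; exact: measurable_coord_field.
move=> x; have [xM|/F0 ->] := pselect (cube M x); last first.
  by rewrite mulr0 normr0 !mulr_ge0 ?enorm_ge0.
by rewrite indicE mem_set// mul1r normrM mulrC ler_pM// coord_le_enorm.
Qed.

Lemma test_field_scale (F : E -> R) (i : 'I_n) : (forall k, Ck k F) ->
  compact (closure [set x | F x != 0]) ->
  test_field (fun x => F x *: (delta_mx ord0 i : E)).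
Proof.
move=> kF cF; split; first exact: smooth_scale.
rewrite (_ : [set x | _] = [set x | F x != 0])//.
apply/seteqP; split => x /=; first by apply: contra => /eqP ->; rewrite scale0r.
apply: contra => /eqP/rowP/(_ i); rewrite !mxE !eqxx mulr1 => ->//.
Qed.

(** Fields with a single nonzero component isolate one coordinate of the difference, to which
    [fundamental_lemma] applies. *)
Lemma weak_unique g1 g2 : loc_integrable g1 -> loc_integrable g2 ->
  (forall phi, test_field phi ->
    \int[mu]_x dotv (g1 x) (phi x) = \int[mu]_x dotv (g2 x) (phi x)) ->
  {ae mu, forall x, g1 x = g2 x}.
Proof.
move=> l1 l2 h; have [m1 i1] := l1; have [m2 i2] := l2.
have dE (g : E -> E) i (F : E -> R) :
    \int[mu]_x dotv (g x) (F x *: delta_mx ord0 i) = \int[mu]_x (g x ord0 i * F x).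
  apply: eq_Rintegral => x _; rewrite /dotv (bigD1 i)//= big1 ?addr0.
    by rewrite !mxE !eqxx mulr1.
  by move=> j ji; rewrite !mxE (negbTE ji) andbF !mulr0.
have me (g : E -> E) : measurable_fun setT g -> measurable_fun setT (fun x => enorm (g x)).
  by move=> mg; exact: (measurableT_comp measurable_enorm mg).
suff H i : {ae mu, forall x, g1 x ord0 i - g2 x ord0 i = 0}.
  have : {ae mu, forall x, forall i, g1 x ord0 i - g2 x ord0 i = 0} by exact: filter_forall.
  by apply: filterS => x hx; apply/rowP => i; apply/eqP; rewrite -subr_eq0 hx.
apply: fundamental_lemma.
- by apply: measurable_funB; exact: measurable_coord_field.
- move=> K cK; have mK := compact_measurable_rV cK.
  apply: (@le_lt_trans _ _ (\int[mu]_(x in K) ((enorm (g1 x))%:E + (enorm (g2 x))%:E))%E).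
    apply: ge0_le_integral => //.
    + apply/measurable_EFinP; apply: measurable_funTS; apply: measurableT_comp => //.
      by apply: measurable_funB; exact: measurable_coord_field.
    + by apply: emeasurable_funD; apply/measurable_EFinP; apply: measurable_funTS; exact: me.
    + move=> x _; rewrite -EFinD lee_fin (le_trans (ler_normB _ _))//.
      by rewrite lerD ?coord_le_enorm.
  rewrite ge0_integralD//.
  + by rewrite lte_add_pinfty ?i1 ?i2.
  + by move=> x _; rewrite lee_fin enorm_ge0.
  + by apply/measurable_EFinP; apply: measurable_funTS; exact: me.
  + by move=> x _; rewrite lee_fin enorm_ge0.
  + by apply/measurable_EFinP; apply: measurable_funTS; exact: me.
- move=> F kF cF; have cF' := Ck_continuous (kF 0%N).
  have [M _ hM] := compact_sub_cube cF.
  have F0 x : ~ cube M x -> F x = 0.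
    move=> xM; apply/eqP/negPn/negP => Fx; apply: xM; apply: hM.
    exact: subset_closure.
  under eq_Rintegral do rewrite mulrBl.
  rewrite RintegralB//; last 2 first.
  + exact: loc_integrable_mul F0.
  + exact: loc_integrable_mul F0.
  by rewrite -!dE (h _ (test_field_scale i kF cF)) subrr.
Qed.

End uniqueness.

(** * Construction of a weak fractional gradient *)

Section frac_gradient.
Context {R : realType} (n : nat).
Local Notation E := 'rV[R]_n.
Local Notation mu := (lebesgue_rV R n).
Local Notation m := (@space_time R n).
Local Notation sh := (@heat_shift R n).
Variables (alpha p : R) (f : E -> R) (g : E -> E).
Hypotheses (alpha_ge : 2^-1 <= alpha) (alpha_lt : alpha < 1) (p1 : 1 <= p)
  (mf : measurable_fun setT f) (fp : (\int[mu]_x (`|f x| `^ p)%:E < +oo)%E)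
  (wg : is_weak_grad f g)
  (gp : forall i, (\int[mu]_x (`|g x ord0 i| `^ p)%:E < +oo)%E).

Let e : R := (1 - alpha) / 2.

Let e01 : 0 < e <= 4^-1. Proof. exact: half_gap_itv. Qed.

Let e0 : 0 < e. Proof. by case/andP: e01. Qed.

Let mg i : measurable_fun setT (fun x => g x ord0 i).
Proof. by case: wg => -[mg _] _; exact: measurable_coord_field. Qed.

Definition near_part i : E -> R :=
  avg m (near_kernel e) (fun z => - sh z) (fun x => g x ord0 i).

Definition far_part i : E -> R := avg m (far_kernel e i) (fun z => - sh z) f.

(** The far part is negative because of the minus sign in the weak formulation; in the near part
    that sign is used up by passing from [f] to its weak gradient. *)
Definition frac_grad (x : E) : E := \row_i (near_part i x - far_part i x).

Lemma measurable_near_part i : measurable_fun setT (fun x => g x ord0 i) ->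
  measurable_fun setT (near_part i).
Proof.
exact: (measurable_avg m (@measurable_near_kernel R n e) (@measurable_opp_heat_shift R n)).
Qed.

Lemma measurable_far_part i : measurable_fun setT (far_part i).
Proof. exact: (measurable_avg m (@measurable_far_kernel R n e i) (@measurable_opp_heat_shift R n) mf). Qed.

Lemma near_part_Lp i : (\int[mu]_x (`|near_part i x| `^ p)%:E < +oo)%E.
Proof.
apply: le_lt_trans (_ : (1 `^ p)%:E * \int[mu]_x (`|g x ord0 i| `^ p)%:E < +oo)%E.
  apply: (avg_Lp (m := m)) => //.
- exact: measurable_near_kernel.
- exact: measurable_opp_heat_shift.
- rewrite -(integral_near_kernel n e0); apply: eqW.
  by apply: eq_integral => z _; rewrite ger0_norm// near_kernel_ge0.
by rewrite powR1 mul1e; exact: gp.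
Qed.

(** Adding 1 makes the constant positive, as [avg_Lp] requires of a mass bound. *)
Lemma far_part_le i : (\int[mu]_x (`|far_part i x| `^ p)%:E <=
  ((kernel_const n e * (6 * gauss_second n + 1)) `^ p)%:E * \int[mu]_x (`|f x| `^ p)%:E)%E.
Proof.
apply: (avg_Lp (m := m)) => //.
- exact: measurable_far_kernel.
- exact: measurable_opp_heat_shift.
- apply: mulr_gt0; first exact: kernel_const_gt0.
  by rewrite ltr_wpDl// mulr_ge0// gauss_second_ge0.
- apply: le_trans (integral_far_kernel i e01) _.
  by rewrite lee_fin; apply: ler_wpM2l; [rewrite ltW// kernel_const_gt0|rewrite lerDl].
Qed.

Lemma far_part_Lp i : (\int[mu]_x (`|far_part i x| `^ p)%:E < +oo)%E.
Proof.
apply: le_lt_trans (far_part_le i) _.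
by apply: lte_mul_pinfty; rewrite ?lee_fin ?powR_ge0.
Qed.

Lemma loc_integrable_frac_grad : loc_integrable frac_grad.
Proof.
have mh : measurable_fun setT frac_grad.
  apply: measurable_fun_rV => i; under eq_fun do rewrite mxE.
  by apply: measurable_funB; [exact: measurable_near_part (mg i)|exact: measurable_far_part].
split => // K cK; have mK := compact_measurable_rV cK.
have mnp i : measurable_fun setT (fun x => `|near_part i x| `^ p).
  by apply: measurable_fun_powR; apply: measurableT_comp => //; exact: measurable_near_part (mg i).
have mfp i : measurable_fun setT (fun x => `|far_part i x| `^ p).
  by apply: measurable_fun_powR; apply: measurableT_comp => //; exact: measurable_far_part.
pose b i x := 2 + (`|near_part i x| `^ p + `|far_part i x| `^ p).
have mb i : measurable_fun setT (b i).
  by apply: measurable_funD => //; exact: measurable_funD.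
have b0 i x : 0 <= b i x by rewrite !addr_ge0 ?powR_ge0.
apply: (@le_lt_trans _ _ (\int[mu]_(x in K) \sum_i (b i x)%:E)%E).
  apply: ge0_le_integral => //.
  - by move=> x _; rewrite lee_fin enorm_ge0.
  - apply/measurable_EFinP; apply: measurable_funTS.
    exact: (measurableT_comp (@measurable_enorm R n) mh).
  - by apply: measurable_funTS; apply: emeasurable_sum => i; exact/measurable_EFinP.
  - move=> x _; rewrite sumEFin lee_fin (le_trans (enorm_le_sum _))//.
    apply: ler_sum => i _; rewrite mxE (le_trans (ler_normB _ _))//.
    have h1 := le1D_powR p1 (normr_ge0 (near_part i x)).
    have h2 := le1D_powR p1 (normr_ge0 (far_part i x)).
    by move: h1 h2; rewrite /b; set u := _ `^ p; set v := _ `^ p; lra.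
rewrite ge0_integral_sum//; last 2 first.
- by move=> i; apply: measurable_funTS; exact/measurable_EFinP.
- by move=> i x _; rewrite lee_fin.
apply: lte_sum_pinfty => i _.
have mE (u : E -> R) D : measurable_fun setT u -> measurable_fun D (EFin \o u).
  by move=> mu'; apply: measurable_funTS; exact/measurable_EFinP.
have p0 (u : E -> R) x : (0 <= (`|u x| `^ p)%:E)%E by rewrite lee_fin powR_ge0.
rewrite (_ : (\int[mu]_(x in K) _)%E = (\int[mu]_(x in K) (2%:E +
    ((`|near_part i x| `^ p)%:E + (`|far_part i x| `^ p)%:E)))%E); last first.
  by apply: eq_integral => x _; rewrite -!EFinD.
rewrite ge0_integralD//; last 2 first.
- by move=> x _; rewrite adde_ge0.
- by apply: emeasurable_funD; exact: mE.
rewrite ge0_integralD//; last 2 first.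
- exact: mE.
- exact: mE.
rewrite integral_cst//; apply: lte_add_pinfty; last apply: lte_add_pinfty.
- by apply: lte_mul_pinfty => //; exact: compact_lty.
- apply: le_lt_trans (near_part_Lp i); apply: ge0_subset_integral => //.
  exact: mE.
- apply: le_lt_trans (far_part_Lp i); apply: ge0_subset_integral => //.
  exact: mE.
Qed.

Lemma is_weak_frac_grad_frac_grad : is_weak_frac_grad alpha f frac_grad.
Proof.
split; first exact: loc_integrable_frac_grad.
move=> phi tphi; have C i := test_field_C1c i tphi.
have B i : exists B, 0 <= B /\ [/\ forall x, `|phi x ord0 i| <= B &
    forall j x, `|partial j phi x ord0 i| <= B].
  by have [B B0 [pB dB _]] := C1c_bounded (C i); exists B.
have [M hM] := choice B.
have pM i x : `|phi x ord0 i| <= M i by have [_ []] := hM i.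
have dM i x : `|partial i phi x ord0 i| <= M i by have [_ []] := hM i.
have mphi i : measurable_fun setT (fun x => phi x ord0 i).
  by have [c _ _ _] := C i; exact: continuous_measurable_rV.
have iphi i := (C1c_integrable (C i)).1.
have mdiv : measurable_fun setT (divergence phi).
  by apply: measurable_sum => i; have [_ c _ _] := C i; exact: continuous_measurable_rV.
have idiv : mu.-integrable setT (EFin \o divergence phi).
  have := @integrable_sum _ _ _ mu _ measurableT _ (index_enum 'I_n) xpredT
    (fun i => EFin \o (fun x => partial i phi x ord0 i)) (fun i _ => (C1c_integrable (C i)).2 i).
  by apply: eq_integrable => // x _ /=; rewrite sumEFin.
have divM x : `|divergence phi x| <= \sum_i M i.
  by rewrite (le_trans (ler_norm_sum _ _ _))// ler_sum.
have mnk := @measurable_near_kernel R n e.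
have mfk i := @measurable_far_kernel R n e i.
have ms := @measurable_heat_shift R n.
have ink : m.-integrable setT (EFin \o near_kernel e) := integrable_near_kernel n e0.
have ifk i : m.-integrable setT (EFin \o far_kernel e i) := integrable_far_kernel i e01.
have inear : mu.-integrable setT (EFin \o (fun x => f x * avg m (near_kernel e) sh (divergence phi) x)).
  exact: (integrable_mul_avg mnk ms mf mdiv p1 ink fp divM idiv).
have ifar i : mu.-integrable setT (EFin \o (fun x => f x * avg m (far_kernel e i) sh (fun y => phi y ord0 i) x)).
  exact: (integrable_mul_avg (mfk i) ms mf (mphi i) p1 (ifk i) fp (pM i) (iphi i)).
have iN i : mu.-integrable setT (EFin \o (fun x => near_part i x * phi x ord0 i)).
  exact: (integrable_avg_mul mnk ms (mg i) (mphi i) p1 ink (gp i) (pM i) (iphi i)).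
have iF i : mu.-integrable setT (EFin \o (fun x => far_part i x * phi x ord0 i)).
  exact: (integrable_avg_mul (mfk i) ms mf (mphi i) p1 (ifk i) fp (pM i) (iphi i)).
have L : \int[mu]_x (f x * frac_div alpha phi x) =
    \int[mu]_x (f x * avg m (near_kernel e) sh (divergence phi) x) +
    \sum_i \int[mu]_x (f x * avg m (far_kernel e i) sh (fun y => phi y ord0 i) x).
  rewrite -Rintegral_sum// -RintegralD//.
    by apply: eq_Rintegral => x _; rewrite frac_div_avg// mulrDr mulr_sumr.
  have := @integrable_sum _ _ _ mu _ measurableT _ (index_enum 'I_n) xpredT _ (fun i _ => ifar i).
  by apply: eq_integrable => // x _ /=; rewrite sumEFin.
have near_eq : \int[mu]_x (f x * avg m (near_kernel e) sh (divergence phi) x) =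
    - \sum_i \int[mu]_x (near_part i x * phi x ord0 i).
  rewrite (Rintegral_mul_avg mnk ms mf mdiv p1 ink fp divM idiv).
  (* With [z] fixed, [f] is paired with the divergence of a translated test field, so its weak
     gradient identity applies inside the average. *)
  have pair z : near_kernel e z * \int[mu]_x (f x * divergence phi (x + sh z)) =
      -1 * \sum_i (near_kernel e z * \int[mu]_x (g x ord0 i * phi (x + sh z) ord0 i)).
    have [tz dz] := test_field_shift (sh z) tphi.
    have <- : \int[mu]_x (f x * divergence (fun y => phi (y + sh z)) x) =
        \int[mu]_x (f x * divergence phi (x + sh z)).
      by apply: eq_Rintegral => x _; congr (_ * _); apply: eq_bigr => i _; rewrite dz.
    rewrite wg.2// -mulr_sumr -Rintegral_sum; last first.
      move=> i; have [cs _ _ [N hN]] := test_field_C1c i tz.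
      by apply: (loc_integrable_mul i wg.1 cs) => x /hN[].
    by rewrite mulN1r mulrN.
  under eq_Rintegral do rewrite pair.
  have ipair i := integrable_kernel_pairing mnk ms (mg i) (mphi i) p1 ink (gp i) (pM i) (iphi i).
  rewrite RintegralZl//; last first.
    have := @integrable_sum _ _ _ m _ measurableT _ (index_enum 'I_n) xpredT _ (fun i _ => ipair i).
    by apply: eq_integrable => // z _ /=; rewrite sumEFin.
  rewrite mulN1r (Rintegral_sum ipair); congr (- _); apply: eq_bigr => i _.
  rewrite -(Rintegral_mul_avg mnk ms (mg i) (mphi i) p1 ink (gp i) (pM i) (iphi i)).
  exact: (Rintegral_avg_adjoint mnk ms (mg i) (mphi i) p1 ink (gp i) (pM i) (iphi i)).
rewrite L near_eq.
have -> : \int[mu]_x dotv (frac_grad x) (phi x) =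
    \sum_i \int[mu]_x (near_part i x * phi x ord0 i) -
    \sum_i \int[mu]_x (far_part i x * phi x ord0 i).
  rewrite -sumrB.
  under eq_bigr do rewrite -RintegralB//.
  rewrite -Rintegral_sum => [|i].
    by apply: eq_Rintegral => x _; apply: eq_bigr => i _; rewrite mxE mulrBl.
  have := integrableB measurableT (iN i) (iF i).
  by apply: eq_integrable => // x _ /=; rewrite EFinB.
rewrite opprB addrC; congr (_ - _); apply: eq_bigr => i _.
exact: (Rintegral_avg_adjoint (mfk i) ms mf (mphi i) p1 (ifk i) fp (pM i) (iphi i)).
Qed.

End frac_gradient.

(** * Convergence *)

Section convergence.
Context {R : realType} (n : nat).
Local Notation E := 'rV[R]_n.
Local Notation mu := (lebesgue_rV R n).
Local Notation m := (@space_time R n).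
Local Notation sh := (@heat_shift R n).
Implicit Types (p d e : R) (G : E -> R).

Lemma modulus_bounded G p : 1 <= p -> measurable_fun setT G ->
  (\int[mu]_x (`|G x| `^ p)%:E < +oo)%E ->
  exists2 M, 0 <= M & forall h, (modulus p G h <= M%:E)%E.
Proof.
move=> p1 mG Gp; have p0 : 0 <= p by lra.
have mGp : measurable_fun setT (fun x => (`|G x| `^ p)%:E).
  exact: measurable_norm_powR.
have i0 : (0 <= \int[mu]_x (`|G x| `^ p)%:E)%E.
  by apply: integral_ge0 => x _; rewrite lee_fin powR_ge0.
pose I := fine (\int[mu]_x (`|G x| `^ p)%:E)%E.
have IE : (\int[mu]_x (`|G x| `^ p)%:E = I%:E)%E by rewrite fineK// ge0_fin_numE.
exists (2 `^ p * (I + I)) => [|h].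
  by rewrite mulr_ge0 ?powR_ge0// addr_ge0// fine_ge0.
have mGh : measurable_fun setT (fun x : E => (`|G (x + h)| `^ p)%:E).
  exact: (measurableT_comp mGp (measurable_rV_shift h)).
apply: (@le_trans _ _ (\int[mu]_x ((2 `^ p)%:E *
    ((`|G (x + h)| `^ p)%:E + (`|G x| `^ p)%:E)))%E).
  apply: ge0_le_integral => //.
  - apply: measurable_norm_powR.
    by apply: measurable_funB => //; exact: (measurableT_comp mG (measurable_rV_shift h)).
  - by apply: measurable_funeM; exact: emeasurable_funD.
  - move=> x _; rewrite -EFinD -EFinM lee_fin (le_trans _ (powRD_le p0 _ _))//.
    by apply: ge0_ler_powR; rewrite ?nnegrE ?addr_ge0// ler_normB.
rewrite ge0_integralZl//; last 2 first.
- exact: emeasurable_funD.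
- by move=> x _; rewrite -EFinD lee_fin addr_ge0 ?powR_ge0.
rewrite ge0_integralD//.
rewrite (ge0_integral_shift h mGp); last by move=> x; rewrite lee_fin powR_ge0.
by rewrite IE -EFinD -EFinM.
Qed.

Lemma dotv_heat_shift s (k : E) : 0 < s -> dotv (sh (s, k)) (sh (s, k)) = 4 * (s * dotv k k).
Proof.
move=> s0; rewrite /dotv !mulr_sumr; apply: eq_bigr => i _; rewrite /heat_shift !mxE /=.
have h : s `^ 2^-1 * s `^ 2^-1 = s.
  by rewrite -powRD ?(gt_eqF s0) ?implybT// (_ : 2^-1 + 2^-1 = 1) ?powRr1 ?ltW//; field.
by rewrite -[in RHS]h; ring.
Qed.

(** Chebyshev's argument: for displacements within [cube r] the modulus is at most [d]; beyond, its
    bound [M] is multiplied by the squared displacement over [r^2], whose mean is small. [C] depends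
    on [d] but not on [e]. *)
Lemma near_kernel_modulus G p d : 1 <= p -> measurable_fun setT G ->
  (\int[mu]_x (`|G x| `^ p)%:E < +oo)%E -> 0 < d ->
  exists2 C, 0 <= C & forall e, 0 < e <= 1 ->
  (\int[m]_z ((near_kernel e z)%:E * modulus p G (- sh z)) <= (d + C / Gamma e)%:E)%E.
Proof.
move=> p1 mG Gp d0.
have [r r0 hr] := modulus_cvg0 p1 mG Gp d0.
have [M M0 hM] := modulus_bounded p1 mG Gp.
have [C C0 hC] := @near_kernel_moment R n.
(* The 4 is that of [dotv_heat_shift]: the squared displacement is 4 times the time times the
   squared Gaussian variable. *)
pose c := 4 * M / r ^+ 2.
have c0 : 0 <= c by rewrite divr_ge0 ?sqr_ge0 ?mulr_ge0.
exists (c * C) => [|e e01]; first by rewrite mulr_ge0.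
have e0 : 0 < e by case/andP: e01.
pose T := (measurableTypeR R * E)%type.
have mnk := @measurable_near_kernel R n e.
have ms := @measurable_opp_heat_shift R n.
have msd : measurable_fun [set: T] (fun z : T => z.1 * dotv z.2 z.2).
  apply: (@measurable_prodM _ _ (@id R) (fun k : E => dotv k k)) => //.
  by apply: continuous_measurable_rV; exact: continuous_dotvv.
have k0 (z : T) : 0 <= near_kernel e z by exact: near_kernel_ge0.
have kd0 (z : T) : 0 <= near_kernel e z * (z.1 * dotv z.2 z.2).
  rewrite {1}/near_kernel /halfline; case: ifPn => z1; last by rewrite mul0r mulr0 mul0r.
  have := k0 z; rewrite /near_kernel /halfline z1 => k0z.
  by rewrite mulr_ge0// mulr_ge0 ?dotv_ge0// ltW.
have bound (z : T) : ((near_kernel e z)%:E * modulus p G (- sh z) <=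
    d%:E * (near_kernel e z)%:E + c%:E * (near_kernel e z * (z.1 * dotv z.2 z.2))%:E)%E.
  have [z1|z1] := boolP (0 < z.1); last first.
    by rewrite /near_kernel /halfline (negbTE z1) !(mul0r, mulr0) mul0e !mule0 adde0.
  rewrite -!EFinM -EFinD; have [hz|hz] := pselect (cube r (- sh z)).
    apply: (@le_trans _ _ ((near_kernel e z)%:E * d%:E)%E).
      by apply: lee_wpmul2l; [rewrite lee_fin|exact: hr].
    by rewrite -EFinM lee_fin mulrC lerDl mulr_ge0.
  apply: (@le_trans _ _ ((near_kernel e z)%:E * M%:E)%E).
    by apply: lee_wpmul2l; [rewrite lee_fin|exact: hM].
  rewrite -EFinM lee_fin (_ : c * _ = near_kernel e z * (c * (z.1 * dotv z.2 z.2))); last by ring.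
  apply: (@le_trans _ _ (near_kernel e z * (c * (z.1 * dotv z.2 z.2)))); last first.
    by rewrite lerDr mulr_ge0// ltW.
  apply: ler_wpM2l => //.
  have : exists i, r < `|sh z ord0 i|.
    apply: contrapT => hi; apply: hz => i; rewrite mxE normrN leNgt; apply/negP => ri.
    by apply: hi; exists i.
  move=> [i ri].
  have h1 : r ^+ 2 <= 4 * (z.1 * dotv z.2 z.2).
    rewrite -(dotv_heat_shift z.2 z1) -surjective_pairing.
    apply: le_trans (sqr_coord_le (sh z) i).
    by rewrite -[leRHS]real_normK ?num_real// ler_pXn2r ?nnegrE// ltW.
  rewrite (_ : c * _ = M * (4 * (z.1 * dotv z.2 z.2) / r ^+ 2)); last by rewrite /c; ring.
  by rewrite ler_peMr// ler_pdivlMr ?exprn_gt0// mul1r.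
apply: (@le_trans _ _ (\int[m]_z (d%:E * (near_kernel e z)%:E +
    c%:E * (near_kernel e z * (z.1 * dotv z.2 z.2))%:E))%E).
  apply: ge0_le_integral => //.
  - move=> z _; rewrite mule_ge0 ?lee_fin//.
    by apply: integral_ge0 => x _; rewrite lee_fin powR_ge0.
  - apply: emeasurable_funM; first exact/measurable_EFinP.
    exact: measurable_modulus.
  - apply: emeasurable_funD; apply: measurable_funeM; apply/measurable_EFinP => //.
    exact: measurable_funM.
rewrite ge0_integralD//; last 4 first.
- by move=> z _; rewrite -EFinM lee_fin mulr_ge0// ltW.
- by apply: measurable_funeM; exact/measurable_EFinP.
- by move=> z _; rewrite -EFinM lee_fin mulr_ge0.
- by apply: measurable_funeM; apply/measurable_EFinP; exact: measurable_funM.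
rewrite ge0_integralZl//; last 3 first.
- exact/measurable_EFinP.
- by move=> z _; rewrite lee_fin.
- by rewrite lee_fin ltW.
rewrite ge0_integralZl//; last 2 first.
- by apply/measurable_EFinP; exact: measurable_funM.
- by move=> z _; rewrite lee_fin.
rewrite EFinD; apply: leeD.
  by have := integral_near_kernel n e0 => /= ->; rewrite mule1.
by rewrite -mulrA [leRHS]EFinM; apply: lee_wpmul2l; [rewrite lee_fin|exact: hC].
Qed.

Lemma inv_Gamma_near (d : R) : 0 < d ->
  \forall a \near 1^'-, 2^-1 <= a /\ a < 1 /\ (Gamma ((1 - a) / 2))^-1 <= d.
Proof.
(* By [Gamma_ge], the inverse of Gamma at [(1 - a) / 2] is at most [(1 - a) * exp 1], hence at most
   [d] once [1 - a <= d * exp(-1)]. *)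
move=> d0; pose r : R := Num.min 2^-1 (d * expR (- 1)).
have r0 : 0 < r by rewrite lt_min invr_gt0 ltr0n mulr_gt0 ?expR_gt0.
near=> a.
have a1 : a < 1 by near: a; exact: nbhs_left_lt.
have ar : 1 - r < a by near: a; apply: nbhs_left_gt; rewrite ltrBlDr ltrDl.
have r2 : r <= 2^-1 by rewrite ge_min lexx.
have rd : r <= d * expR (- 1) by rewrite ge_min lexx orbT.
split; [lra|split => //].
have e0 : 0 < (1 - a) / 2 by rewrite divr_gt0// subr_gt0.
rewrite -[leRHS]invrK lef_pV2 ?posrE ?Gamma_gt0 ?invr_gt0//.
apply: le_trans (Gamma_ge e0).
have a1' : 0 < 1 - a by rewrite subr_gt0.
rewrite (_ : 2 * ((1 - a) / 2) = 1 - a); last by field.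
rewrite ler_pdivlMr// mulrC ler_pdivrMr// mulrC; lra.
Unshelve. all: by end_near. Qed.

Section limits.
Variables (p : R) (f : E -> R) (g : E -> E).
Hypotheses (p1 : 1 <= p)
  (mf : measurable_fun setT f) (fp : (\int[mu]_x (`|f x| `^ p)%:E < +oo)%E)
  (mg : forall i, measurable_fun setT (fun x => g x ord0 i))
  (gp : forall i, (\int[mu]_x (`|g x ord0 i| `^ p)%:E < +oo)%E).

Let p0 : 0 <= p. Proof. by move: p1 => h; lra. Qed.

Lemma near_part_cvg i d : 0 < d -> \forall a \near 1^'-,
  (\int[mu]_x (`|near_part a g i x - g x ord0 i| `^ p)%:E <= d%:E)%E.
Proof.
move=> d0; have d20 : 0 < d / 2 by rewrite divr_gt0.
have [C C0 hC] := near_kernel_modulus p1 (mg i) (gp i) d20.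
have r0 : 0 < d / 2 / (C + 1) by rewrite divr_gt0// ltr_wpDl.
apply: filterS (inv_Gamma_near r0) => a [a2 [a1 hG]].
have e0 : 0 < (1 - a) / 2 by rewrite divr_gt0// subr_gt0.
have e01 : 0 < (1 - a) / 2 <= 1 by rewrite e0/=; lra.
apply: le_trans (avg_sub_Lp (m := m) (@measurable_near_kernel R n _)
  (@measurable_opp_heat_shift R n) (mg i) p1 _ (integral_near_kernel n e0)) _.
  by move=> z; exact: near_kernel_ge0.
apply: le_trans (hC _ e01) _.
rewrite lee_fin -lerBrDl (_ : d - d / 2 = d / 2); last by field.
apply: (@le_trans _ _ (C * (d / 2 / (C + 1)))); first exact: ler_wpM2l.
rewrite mulrA ler_pdivrMr ?ltr_wpDl//; nra.
Qed.

Lemma far_part_cvg i d : 0 < d -> \forall a \near 1^'-,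
  (\int[mu]_x (`|far_part a f i x| `^ p)%:E <= d%:E)%E.
Proof.
move=> d0.
have i0 : (0 <= \int[mu]_x (`|f x| `^ p)%:E)%E.
  by apply: integral_ge0 => x _; rewrite lee_fin powR_ge0.
pose I := fine (\int[mu]_x (`|f x| `^ p)%:E)%E.
have IE : (\int[mu]_x (`|f x| `^ p)%:E = I%:E)%E by rewrite fineK// ge0_fin_numE.
have I0 : 0 <= I by rewrite fine_ge0.
pose c : R := pi `^ (- (n%:R / 2)) * (6 * gauss_second n + 1).
have c0 : 0 < c.
  by rewrite mulr_gt0 ?powR_gt0 ?pi_gt0// ltr_wpDl// mulr_ge0// gauss_second_ge0.
(* The bound 1 gives [K ^ p <= K], since [1 <= p]; the other bound then gives [K * I <= d]. *)
pose t := Num.min 1 (d / (I + 1)).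
have t0 : 0 < t by rewrite lt_min ltr01 divr_gt0// ltr_wpDl.
have r0 : 0 < t / c by rewrite divr_gt0.
apply: filterS (inv_Gamma_near r0) => a [a2 [a1 hG]].
apply: le_trans (far_part_le a2 a1 p1 mf i) _.
rewrite IE -EFinM lee_fin.
have e0 : 0 < (1 - a) / 2 by rewrite divr_gt0// subr_gt0.
have KE : kernel_const n ((1 - a) / 2) * (6 * gauss_second n + 1) = c * (Gamma ((1 - a) / 2))^-1.
  by rewrite /kernel_const /c; ring.
rewrite KE; set K := c * _.
have K0 : 0 < K by rewrite mulr_gt0// invr_gt0 Gamma_gt0.
have Kt : K <= t.
  by apply: le_trans (ler_wpM2l (ltW c0) hG) _; rewrite mulrC divfK// gt_eqF.
have K1 : K <= 1 by rewrite (le_trans Kt)// ge_min lexx.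
apply: (@le_trans _ _ (K * I)).
  apply: ler_wpM2r => //; rewrite -[leRHS](powRr1 (ltW K0)).
  by rewrite ger_powR// K0.
have Kd : K <= d / (I + 1) by rewrite (le_trans Kt)// ge_min lexx orbT.
apply: le_trans (ler_wpM2r I0 Kd) _.
by rewrite mulrAC ler_pdivrMr ?ltr_wpDl//; nra.
Qed.

Lemma frac_grad_cvg d : 0 < d -> \forall a \near 1^'-,
  (\int[mu]_x (enorm (frac_grad a f g x - g x) `^ p)%:E <= d%:E)%E.
Proof.
move=> d0; have [C C0 hC] := @sum_powR_le R n p (lt_le_trans ltr01 p1).
(* [C] separates the coordinates, [2 ^ p] separates the near and far contributions, and there are
   [n] coordinates with two contributions each. *)
pose c := C * 2 `^ p * n%:R * 2.
have c0 : 0 <= c by rewrite !mulr_ge0 ?powR_ge0.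
have t0 : 0 < d / (c + 1) by rewrite divr_gt0// ltr_wpDl.
set t := d / (c + 1) in t0.
have hn : \forall a \near 1^'-, forall i,
    (\int[mu]_x (`|near_part a g i x - g x ord0 i| `^ p)%:E <= t%:E)%E.
  by apply: filter_forall => i; exact: near_part_cvg.
have hf : \forall a \near 1^'-, forall i,
    (\int[mu]_x (`|far_part a f i x| `^ p)%:E <= t%:E)%E.
  by apply: filter_forall => i; exact: far_part_cvg.
apply: filterS2 hn hf => a hn hf.
have mN i : measurable_fun setT (fun x => (`|near_part a g i x - g x ord0 i| `^ p)%:E).
  by apply: measurable_norm_powR; apply: measurable_funB => //; exact: measurable_near_part (mg i).
have mF i : measurable_fun setT (fun x => (`|far_part a f i x| `^ p)%:E).
  by apply: measurable_norm_powR; exact: measurable_far_part.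
have pw0 (u : R) : (0 <= (`|u| `^ p)%:E)%E by rewrite lee_fin powR_ge0.
have mS i : measurable_fun setT (fun x => (`|near_part a g i x - g x ord0 i| `^ p)%:E +
    (`|far_part a f i x| `^ p)%:E)%E by exact: emeasurable_funD.
apply: (@le_trans _ _ (\int[mu]_x ((C * 2 `^ p)%:E * \sum_i
    ((`|near_part a g i x - g x ord0 i| `^ p)%:E + (`|far_part a f i x| `^ p)%:E)))%E).
  apply: ge0_le_integral => //.
  - by move=> x _; rewrite lee_fin powR_ge0.
  - apply/measurable_EFinP; apply: measurable_fun_powR.
    apply: (measurableT_comp (@measurable_enorm R n)); apply: measurable_fun_rV => i.
    under eq_fun do rewrite !mxE.
    by apply: measurable_funB => //; apply: measurable_funB;
      [exact: measurable_near_part (mg i)|exact: measurable_far_part].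
  - by apply: measurable_funeM; exact: emeasurable_sum.
  - move=> x _; under eq_bigr do rewrite -EFinD.
    rewrite sumEFin -EFinM lee_fin.
    apply: (@le_trans _ _ ((\sum_i `|(frac_grad a f g x - g x) ord0 i|) `^ p)).
      apply: ge0_ler_powR; rewrite ?nnegrE ?enorm_ge0 ?enorm_le_sum//.
      by apply: sumr_ge0.
    apply: le_trans (hC _ _) _; first by move=> i.
    rewrite -mulrA; apply: ler_wpM2l => //; rewrite mulr_sumr; apply: ler_sum => i _.
    rewrite !mxE; apply: le_trans (powRD_le p0 (normr_ge0 _) (normr_ge0 _)).
    apply: ge0_ler_powR; rewrite ?nnegrE ?addr_ge0//.
    by rewrite addrAC ler_normB.
rewrite ge0_integralZl//; last 3 first.
- exact: emeasurable_sum.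
- by move=> x _; apply: sume_ge0 => i _; rewrite adde_ge0.
- by rewrite lee_fin mulr_ge0 ?powR_ge0.
rewrite ge0_integral_sum//; last by move=> i x _; rewrite adde_ge0.
apply: (@le_trans _ _ ((C * 2 `^ p)%:E * \sum_(i < n) (t%:E + t%:E))%E).
  apply: lee_wpmul2l; first by rewrite lee_fin mulr_ge0 ?powR_ge0.
  apply: lee_sum => i _; rewrite ge0_integralD//.
  by apply: leeD.
under eq_bigr do rewrite -EFinD.
rewrite sumEFin -EFinM lee_fin sumr_const card_ord.
have -> : C * 2 `^ p * ((t + t) *+ n) = c * t by rewrite -(mulr_natr (t + t) n) /c; ring.
by rewrite /t mulrA ler_pdivrMr ?ltr_wpDl//; nra.
Qed.

End limits.
End convergence.

(** * From integrals of powers to norms, and conclusion *)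

Section Lp_fields.
Context {R : realType} (n : nat).
Local Notation E := 'rV[R]_n.
Local Notation mu := (lebesgue_rV R n).
Implicit Types (p : R) (v w : E -> E).

Lemma Lpnorm_poweR p v : 0 < p ->
  (Lpnorm p v `^ p = \int[mu]_x (enorm (v x) `^ p)%:E)%E.
Proof.
move=> p0; rewrite /Lpnorm (poweR_Lnorm _ _ (lt0r_neq0 p0)); apply: eq_integral => x _.
by rewrite /= ger0_norm// sqrtr_ge0.
Qed.

Lemma Lpnorm_le p v (d : R) : 0 < p -> 0 <= d ->
  (\int[mu]_x (enorm (v x) `^ p)%:E <= (d `^ p)%:E)%E -> (Lpnorm p v <= d%:E)%E.
Proof.
move=> p0 d0 h.
have root (X : \bar R) : (0 <= X -> (X `^ p) `^ p^-1 = X)%E.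
  by move=> X0; rewrite -poweRrM mulfV ?gt_eqF// poweRe1.
rewrite -(root (Lpnorm p v)) ?Lnorm_ge0// -(root d%:E) ?lee_fin// Lpnorm_poweR// poweR_EFin.
apply: gt0_ler_poweR; rewrite ?invr_ge0 ?(ltW p0)//.
- rewrite in_itv/= leey andbT; apply: integral_ge0 => x _; by rewrite lee_fin powR_ge0.
- by rewrite in_itv/= lee_fin powR_ge0 leey.
Qed.

Lemma integral_powR_ae p (u v : E -> R) : measurable_fun setT u -> measurable_fun setT v ->
  {ae mu, forall x, u x = v x} ->
  (\int[mu]_x (u x `^ p)%:E = \int[mu]_x (v x `^ p)%:E)%E.
Proof.
move=> mu' mv uv; apply: ae_eq_integral => //.
- by apply/measurable_EFinP; exact: measurable_fun_powR.
- by apply/measurable_EFinP; exact: measurable_fun_powR.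
- by apply: filterS uv => x -> _.
Qed.

End Lp_fields.

Theorem theorem4p11 (R : realType) (n : nat) (p : R) (f : 'rV[R]_n -> R) :
  (1 <= n)%N -> 1 <= p -> W1p p f ->
  Lpnorm p (fun x => weak_frac_grad alpha f x - weak_grad f x)
    @[alpha --> 1^'-] --> 0%E.
Proof.
move=> n1 p1 [fL [g0 wg0 [mg0 Lg0]]].
have p0 : 0 < p by lra.
have mf : measurable_fun setT f by have := sub_Lfun_mfun fL; rewrite inE.
have fp : (\int[lebesgue_rV R n]_x (`|f x| `^ p)%:E < +oo)%E.
  have := sub_Lfun_finLfun fL; rewrite inE /= /finite_norm => h.
  have := poweR_lty p h; rewrite poweR_Lnorm ?gt_eqF//.
have wg : is_weak_grad f (weak_grad f).
  by apply: (@xgetPex _ (cst 0) [set g | is_weak_grad f g]); exists g0.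
set g := weak_grad f in wg *.
(* The chosen representative is so far only known to be a weak gradient; its [L^p] bound is
   inherited from [g0] through this equality. *)
have gg0 : {ae lebesgue_rV R n, forall x, g x = g0 x}.
  apply: weak_unique wg.1 wg0.1 _ => phi tphi.
  by apply: oppr_inj; rewrite -wg.2// -wg0.2.
have mg := wg.1.1.
have men (v : 'rV[R]_n -> 'rV[R]_n) : measurable_fun setT v -> measurable_fun setT (fun x => enorm (v x)).
  by move=> mv; exact: (measurableT_comp (@measurable_enorm R n) mv).
have gp i : (\int[lebesgue_rV R n]_x (`|g x ord0 i| `^ p)%:E < +oo)%E.
  apply: (@le_lt_trans _ _ (\int[lebesgue_rV R n]_x (enorm (g x) `^ p)%:E)%E).
    apply: ge0_le_integral => //.
    - by apply: measurable_norm_powR; exact: measurable_coord_field.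
    - by apply/measurable_EFinP; apply: measurable_fun_powR; exact: men.
    - move=> x _; rewrite lee_fin; apply: ge0_ler_powR; rewrite ?nnegrE ?enorm_ge0 ?coord_le_enorm//.
      exact: ltW.
  rewrite (@integral_powR_ae _ _ _ (fun x => enorm (g x)) (fun x => enorm (g0 x)))//.
  - by rewrite -Lpnorm_poweR// poweR_lty.
  - exact: men.
  - exact: men.
  - by apply: filterS gg0 => x ->.
have key (d : R) : 0 < d -> \forall a \near 1^'-,
    (Lpnorm p (fun x => (weak_frac_grad a f x - g x)%R) <= d%:E)%E.
  move=> d0.
  have mgi i : measurable_fun setT (fun x => g x ord0 i) by exact: measurable_coord_field.
  have hc := frac_grad_cvg p1 mf fp mgi gp (powR_gt0 p d0).
  apply: filterS2 hc (inv_Gamma_near (@ltr01 R)) => a hc [a2 [a1 _]].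
  have wh : is_weak_frac_grad a f (frac_grad a f g) := is_weak_frac_grad_frac_grad a2 a1 p1 mf fp wg gp.
  (* Once a weak fractional gradient has been exhibited, the choice operator returns a genuine one
     and not the zero default. *)
  have wa : is_weak_frac_grad a f (weak_frac_grad a f).
    by apply: (@xgetPex _ (cst 0) [set h | is_weak_frac_grad a f h]); exists (frac_grad a f g).
  have ha : {ae lebesgue_rV R n, forall x, weak_frac_grad a f x = frac_grad a f g x}.
    apply: weak_unique wa.1 wh.1 _ => phi tphi.
    by apply: oppr_inj; rewrite -wa.2// -wh.2.
  have mB (v : 'rV[R]_n -> 'rV[R]_n) : measurable_fun setT v -> measurable_fun setT (fun x => enorm (v x - g x)).
    move=> mv; apply: men; apply: (measurable_fun_rVD mv).
    exact: (measurableT_comp (@measurable_rV_opp R n) mg).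
  apply: (Lpnorm_le p0 (ltW d0)).
  have hB : {ae lebesgue_rV R n, forall x,
      enorm (weak_frac_grad a f x - g x) = enorm (frac_grad a f g x - g x)}.
    by apply: filterS ha => x ->.
  by have -> := integral_powR_ae p (mB _ wa.1.1) (mB _ wh.1.1) hB.
(* The norms are extended reals: [key] at 1 gives eventual finiteness, then [key] at each [d] the
   limit. *)
apply/fine_cvgP; split.
  apply: filterS (key 1 ltr01) => a ha; rewrite ge0_fin_numE ?Lnorm_ge0//.
  by rewrite (le_lt_trans ha)// ltry.
apply/cvgrPdist_le => d d0; apply: filterS (key d d0) => a ha.
rewrite sub0r normrN ger0_norm; last by rewrite fine_ge0// Lnorm_ge0.
by rewrite -lee_fin fineK// ge0_fin_numE ?Lnorm_ge0// (le_lt_trans ha)// ltry.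
Qed.
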